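(* Let $\mathcal{F}$ be a family of extrapolation pairs on $\mathbb{R}^n$. Suppose that $u$ and $v$ are weights on $\mathbb{R}^n$ such that $v\in A_\infty$ and $uv\in L^1_{\mathrm{loc}}(\mathbb{R}^n)$, and $\mathbb{X}_{uv}$ is a Banach function space over $(\mathbb{R}^n,uv\,dx)$. Assume that there exist $q_0>1$ and $K_0>0$ such that $$\|M'_uf\|_{(\mathbb{X}_{uv}^{q'})'}\le K_0\,\|f\|_{(\mathbb{X}_{uv}^{q'})'}\qquad\text{for all measurable } f \text{ and all } q\ge q_0.$$ If for some $p_0\in(0,\infty)$ and for every $w\in A_\infty$, $$\|f\|_{L^{p_0}(w)}\le C\,\|g\|_{L^{p_0}(w)},\qquad (f,g)\in\mathcal{F},$$ where $C$ is independent of $(f,g)$ and depends on $w$ only through its $A_\infty$ characteristic, then there is a constant $C$ such that $$\Big\|\frac fv\Big\|_{\mathbb{X}_{uv}}\le C\,\Big\|\frac gv\Big\|_{\mathbb{X}_{uv}},\qquad (f,g)\in\mathcal{F}.$$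
   Context: A weight on $\mathbb{R}^n$ is a measurable $w$ with $0<w<\infty$ a.e.; $w(E)=\int_E w\,dx$; $\|f\|_{L^p(w)}=(\int|f|^p w\,dx)^{1/p}$; $1/q+1/q'=1$. The Hardy–Littlewood maximal operator is $Mf(x)=\sup_{Q\ni x}\frac1{|Q|}\int_Q|f|\,dy$ (sup over cubes $Q\ni x$). For a weight $u$, $M'_uf(x)=M(fu)(x)/u(x)$ if $u(x)\ne0$ and $0$ otherwise. For $1<p<\infty$, $w\in A_p$ if $[w]_{A_p}=\sup_Q\big(\frac1{|Q|}\int_Q w\big)\big(\frac1{|Q|}\int_Q w^{1-p'}\big)^{p-1}<\infty$; $w\in A_1$ if $[w]_{A_1}=\|Mw/w\|_{L^\infty}<\infty$; $A_\infty=\bigcup_{p\ge1}A_p$. A constant depends on $w\in A_\infty$ only through its $A_\infty$ characteristic if, for every $q\in[1,\infty)$ and $K\ge1$, the same constant can be taken for all $w$ with $[w]_{A_q}\le K$. A family of extrapolation pairs is a collection of pairs $(f,g)$ of nonnegative measurable functions on $\mathbb{R}^n$. Let $\mathbb{M}$ be the set of (classes of) measurable functions on $\mathbb{R}^n$. For a weight $\omega$, a Banach function space (BFS) over $(\mathbb{R}^n,\omega\,dx)$ is $\mathbb{X}_\omega=\{f\in\mathbb{M}:\|f\|_{\mathbb{X}_\omega}<\infty\}$, where $\|\cdot\|=\|\cdot\|_{\mathbb{X}_\omega}:\mathbb{M}\to[0,\infty]$ satisfies: (1) $\|f\|=\||f|\|$, and $\|f\|=0$ iff $f=0$ a.e.;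 (2) $\|f+g\|\le\|f\|+\|g\|$; (3) $\|\lambda f\|=|\lambda|\|f\|$; (4) $|f|\le|g|$ a.e. implies $\|f\|\le\|g\|$; (5) $|f_j|\uparrow|f|$ a.e. implies $\|f_j\|\uparrow\|f\|$; (6) if $\omega(E)<\infty$ then $\|\mathbf{1}_E\|<\infty$ and $\int_E|f|\,\omega\,dx\le C_E\|f\|$. The associate space $\mathbb{X}_\omega'$ has norm $\|f\|_{\mathbb{X}_\omega'}=\sup\{\int|fg|\,\omega\,dx:\|g\|_{\mathbb{X}_\omega}\le1\}$. For $0<p<\infty$, $\|f\|_{\mathbb{X}_\omega^p}:=\||f|^p\|_{\mathbb{X}_\omega}^{1/p}$; this is again a BFS over $(\mathbb{R}^n,\omega\,dx)$ if $p\ge1$, and $(\mathbb{X}_{uv}^{q'})'$ is its associate space with respect to $uv\,dx$. Functions not in a space have norm $+\infty$. *)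

(* Defs.v *)
From HB Require Import structures.
From mathcomp Require Import all_boot all_order all_algebra.
From mathcomp Require Import all_classical all_reals all_analysis.
From mathcomp Require Import measurable_realfun ess_sup_inf.

Set Implicit Arguments.
Unset Strict Implicit.
Unset Printing Implicit Defensive.

Import Order.TTheory GRing.Theory Num.Theory.
Import numFieldNormedType.Exports.

Local Open Scope classical_set_scope.
Local Open Scope ring_scope.
Local Open Scope ereal_scope.

Section borel_lebesgue.
Variable R : realType.
Local Notation tupleR n := (n.-tuple (measurableTypeR R)).

Definition tuple_cons n (p : measurableTypeR R * tupleR n) : tupleR n.+1 :=
  [tuple of p.1 :: p.2].

Lemma measurable_tuple_cons n : measurable_fun [set: _] (@tuple_cons n).
Proof. exact: measurable_cons. Qed.

Section succ.
Context n (m : {measure set (tupleR n) -> \bar R}).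

Definition borel_lebesgueS : set (tupleR n.+1) -> \bar R :=
  pushforward (@lebesgue_measure R \x^ m) (@tuple_cons n).

Let borel_lebesgueS0 : borel_lebesgueS set0 = 0.
Proof. by rewrite /borel_lebesgueS /pushforward preimage_set0 measure0. Qed.

Let borel_lebesgueS_ge0 A : 0 <= borel_lebesgueS A.
Proof. by rewrite /borel_lebesgueS /pushforward measure_ge0. Qed.

Let borel_lebesgueS_sigma_additive : semi_sigma_additive borel_lebesgueS.
Proof.
apply: measure_semi_sigma_additive; exact: measurable_tuple_cons.
Qed.

HB.instance Definition _ := isMeasure.Build _ _ _ borel_lebesgueS
  borel_lebesgueS0 borel_lebesgueS_ge0 borel_lebesgueS_sigma_additive.

End succ.

(* The n-fold product of the one-dimensional Lebesgue measure, on Borel sets. *)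
Fixpoint borel_lebesgue n : {measure set (tupleR n) -> \bar R} :=
  if n is n'.+1 then borel_lebesgueS (borel_lebesgue n') else \d_[tuple].

End borel_lebesgue.

(* R^n with the sigma-algebra of Lebesgue measurable sets, obtained by the
   Caratheodory extension of borel_lebesgue. *)
Definition euclidean (R : realType) (n : nat) : Type :=
  caratheodory_type (borel_lebesgue R n)^*%mu.

HB.instance Definition _ (R : realType) (n : nat) :=
  Measurable.on (euclidean R n).

Definition euclidean_lebesgue (R : realType) (n : nat) :
    {measure set (euclidean R n) -> \bar R} :=
  @completed_measure_extension _ _ _ (borel_lebesgue R n).

Section weights.
Variables (R : realType) (n : nat).
Local Notation E := (euclidean R n).
Local Notation fct := (E -> \bar R).
Local Notation mu := (euclidean_lebesgue R n).

Definition coord (x : E) (i : 'I_n) : R := tnth (x : n.-tuple R) i.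

(* Functions on R^n are extended real-valued throughout; the finiteness of a
   weight is only required almost everywhere. *)
Definition weight (w : fct) : Prop :=
  measurable_fun setT w /\ {ae mu, forall x, 0 < w x < +oo}.

(* n.-tuple carries no topology, so compactness is read off in 'rV_n. *)
Definition L1loc (f : fct) : Prop :=
  measurable_fun setT f /\
  forall K : set E, compact [set (\row_i coord x i : 'rV[R]_n) | x in K] ->
    \int[mu]_(x in K) `|f x| < +oo.

(* Closed, with sides parallel to the axes. *)
Definition cube (a : 'I_n -> R) (l : R) : set E :=
  [set x | forall i, (a i <= coord x i <= a i + l)%R].

Definition cubes : set (set E) :=
  [set Q | exists a l, (0 < l)%R /\ Q = cube a l].

Definition average (f : fct) (Q : set E) : \bar R :=
  (\int[mu]_(x in Q) f x) / mu Q.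

Definition maximal (f : fct) : fct := fun x =>
  ereal_sup [set average (fun y => `|f y|) Q | Q in [set Q | cubes Q /\ Q x]].

Definition weighted_maximal (u f : fct) : fct := fun x =>
  if u x == 0 then 0 else maximal (fun y => f y * u y) x / u x.

Definition conj_exponent (q : R) : R := ((1 - q^-1)^-1)%R.

(* Meaningful for p in [1, +oo[ only. *)
Definition Ap_constant (p : R) (w : fct) : \bar R :=
  if p == 1%R then ess_sup mu (fun x => maximal w x / w x)
  else ereal_sup [set average w Q *
    average (fun x => w x `^ (1 - conj_exponent p)) Q `^ (p - 1) | Q in cubes].

Definition Ap (p : R) (w : fct) : Prop := weight w /\ Ap_constant p w < +oo.

Definition Ainfty (w : fct) : Prop := exists2 p : R, (1 <= p)%R & Ap p w.

(* For every w in A_infty, P C w holds for a constant C > 0 that depends on w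
   only through its A_infty characteristic: C is chosen before w. Each w in
   A_infty is covered by some q and K since its A_q constant is finite. *)
Definition for_all_Ainfty (P : R -> fct -> Prop) : Prop :=
  forall q K : R, (1 <= q)%R -> (1 <= K)%R ->
    exists2 C : R, (0 < C)%R &
      forall w, weight w -> Ap_constant q w <= K%:E -> P C w.

Definition weighted_Lnorm (p : R) (w f : fct) : \bar R :=
  (\int[mu]_x (`|f x| `^ p * w x)) `^ p^-1.

Definition extrapolation_family (F : set (fct * fct)) : Prop :=
  forall f g, F (f, g) ->
    [/\ measurable_fun setT f, measurable_fun setT g,
        (forall x, 0 <= f x) & (forall x, 0 <= g x)].

(* N is the norm of a Banach function space over (R^n, omega dx). Functions are
   extended real-valued, with N f = +oo when f is not in the space; only the
   values of N on measurable functions matter. Since +oo - oo = -oo in \bar R,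
   |f + g| <= |f| + |g| holds everywhere, so BFS_triangle is harmless there. *)
Record is_BFS (omega : fct) (N : fct -> \bar R) : Prop := {
  BFS_ge0 : forall f, measurable_fun setT f -> 0 <= N f;
  BFS_abs : forall f, measurable_fun setT f -> N f = N (fun x => `|f x|);
  BFS_eq0 : forall f, measurable_fun setT f ->
    N f = 0 <-> {ae mu, forall x, f x = 0};
  BFS_triangle : forall f g, measurable_fun setT f -> measurable_fun setT g ->
    N (fun x => f x + g x) <= N f + N g;
  BFS_scale : forall (c : R) f, measurable_fun setT f ->
    N (fun x => c%:E * f x) = `|c|%:E * N f;
  BFS_le : forall f g, measurable_fun setT f -> measurable_fun setT g ->
    {ae mu, forall x, `|f x| <= `|g x|} -> N f <= N g;
  BFS_Fatou : forall (f_ : nat -> fct) f,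
    (forall j, measurable_fun setT (f_ j)) -> measurable_fun setT f ->
    {ae mu, forall x, nondecreasing_seq (fun j => `|f_ j x|) /\
                      `|f_ j x| @[j --> \oo] --> `|f x|} ->
    nondecreasing_seq (fun j => N (f_ j)) /\ N (f_ j) @[j --> \oo] --> N f;
  BFS_indic : forall A, measurable A -> \int[mu]_(x in A) omega x < +oo ->
    N (fun x => (\1_A x)%:E) < +oo;
  BFS_integral : forall A, measurable A -> \int[mu]_(x in A) omega x < +oo ->
    exists2 C : R, (0 < C)%R & forall f, measurable_fun setT f ->
      \int[mu]_(x in A) (`|f x| * omega x) <= C%:E * N f }.

Definition associate_norm (omega : fct) (N : fct -> \bar R) (f : fct) :
    \bar R :=
  ereal_sup [set \int[mu]_x (`|f x * g x| * omega x) |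
    g in [set g | measurable_fun setT g /\ N g <= 1]].

Definition power_norm (N : fct -> \bar R) (p : R) (f : fct) : \bar R :=
  N (fun x => `|f x| `^ p) `^ p^-1.

End weights.

(* Main.v *)
From mathcomp Require Import all_boot all_order all_algebra.
From mathcomp Require Import all_classical all_reals all_analysis.
From mathcomp Require Import measurable_realfun ess_sup_inf.
From mathcomp Require Import ring lra.
Require Import Defs.

(** Let F, u, v, X be as in the theorem. For an exponent q > 1, let s be its
    conjugate, r = 1 / s = 1 - 1/q, and let P be the set of the functions
    phi >= 0 with X(phi^s) <= 1. Take (f, g) in F and H > 0 with X(g/v) <= H. Then
    (g/v)^r / H^r belongs to P, and the goal X(f/v) <= t^s H says that
    phi = (f/v)^r / (t H^r) does; here t does not depend on the pair.

    Suppose that phi is not in P. As P is solid, convex and closed under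
    increasing limits, it equals its bipolar ([bipolar]): some h >= 0 in the unit
    ball of the associate space of X^s satisfies int phi h uv > 1. Since M'_u has
    norm at most K on that space, the Rubio de Francia iteration replaces h by a
    larger function gam of norm at most 2 with M'_u gam <= 2 K gam
    ([dual_majorant]). This means that gam u is an A_1 weight with constant at
    most 2 K + 1. For q large in terms of this constant, W = gam u v^(1/q) is an
    A_infty weight ([Acond_A1_power]), so that, granted an L^r inequality for the
    family F,
      t H^r < int (f/v)^r gam uv = int f^r W
            <= B int g^r W = B int (g/v)^r gam uv <= 2 B H^r,
    which is absurd for t = 2 B. That the bound K is uniform in q makes it
    possible to choose q after the A_1 constant, and hence B independently of
    the pair.

    Two facts about A_infty weights remain. The inequality, given in L^p0, holds
    in L^p for every p > 0 ([Ainfty_bound_any]): the exponent is doubled by using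
    a majorant of f as a part of the weight, and lowered by using a negative
    power of a majorant of a power of g. Both majorants come from the iteration
    of the maximal operator relative to an A_p weight, which is bounded on L^2 by
    the Vitali covering lemma and interpolation. And an A_1 weight gives small
    subsets of a cube a small fraction of the weight of the cube ([A1_decay]), by
    a stopping time argument. Hence, for q large, the average over a cube of its
    product with v^(1/q), whose level sets in the cube have measure of order
    2^(-q k) at most at the level 2^k, is controlled by the product of the
    averages.

    Up to constants, w is in A_p with p = 1 + 1/e when every cube Q has a scale
    s > 0 with w(Q) <= C s |Q| and w^(-e)(Q) <= C s^(-e) |Q| ([Acond]). With this
    form of the condition, products of weights are handled by multiplying
    scales. Cubes with rational data suffice in it ([cube_basis]), and the
    arguments up to the change of exponent only use a few properties of such a
    family of sets in a measure space. *)

Set Implicit Arguments.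
Unset Strict Implicit.
Unset Printing Implicit Defensive.

Import Order.TTheory GRing.Theory Num.Theory.
Import numFieldNormedType.Exports.

Local Open Scope classical_set_scope.
Local Open Scope ring_scope.
Local Open Scope ereal_scope.

(** * Suprema of sequences and integrals *)

Section sups.
Context {R : realType}.
Implicit Types u : nat -> \bar R.

Lemma le_sup_range u k : u k <= ereal_sup (range u).
Proof. by apply: ereal_sup_ubound; exists k. Qed.

Lemma sup_range_le u c : (forall k, u k <= c) -> ereal_sup (range u) <= c.
Proof. by move=> uc; apply: ge_ereal_sup => _ [k _ <-]. Qed.

Lemma lt_sup_range u (c : \bar R) : c < ereal_sup (range u) -> exists k, c < u k.
Proof. by move=> /ereal_sup_gt[_ [k _ <-] ck]; exists k. Qed.

Lemma ge0_sup_range u : (forall k, 0 <= u k) -> 0 <= ereal_sup (range u).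
Proof. by move=> u0; exact: (le_trans (u0 0%N) (le_sup_range u 0%N)). Qed.

Lemma sup_range_pZl u (c : R) : (0 < c)%R ->
  ereal_sup (range (fun k => c%:E * u k)) = c%:E * ereal_sup (range u).
Proof.
move=> c0; apply/eqP; rewrite eq_le; apply/andP; split.
  by apply: sup_range_le => k; rewrite lee_pmul2l//; exact: le_sup_range.
rewrite -lee_pdivlMl//; apply: sup_range_le => k.
by rewrite lee_pdivlMl//; exact: (le_sup_range (fun k => c%:E * u k)).
Qed.

Lemma sup_range_pZr u (c : R) : (0 < c)%R ->
  ereal_sup (range (fun k => u k * c%:E)) = ereal_sup (range u) * c%:E.
Proof.
move=> c0; rewrite [RHS]muleC -sup_range_pZl//.
by under eq_fun do rewrite muleC.
Qed.

Lemma sup_range_square u : (forall n, 0 <= u n) -> nondecreasing_seq u ->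
  ereal_sup (range (fun n => u n * u n)) = ereal_sup (range u) * ereal_sup (range u).
Proof.
move=> u0 ndu; have cu := ereal_nondecreasing_cvgn ndu.
have cuu : (u n * u n) @[n --> \oo] --> ereal_sup (range u) * ereal_sup (range u).
  apply: cvgeM => //; rewrite mule_defE.
  by have [->|] := eqVneq (ereal_sup (range u)) 0; rewrite ?abse0.
rewrite -(cvg_lim _ cuu)//; apply/esym/cvg_lim => //.
by apply: ereal_nondecreasing_cvgn => m n mn; apply: lee_pmul => //; exact: ndu.
Qed.

End sups.

Section integral_tools.
Context d (T : measurableType d) (R : realType).
Variable mu : {measure set T -> \bar R}.

Lemma measurable_sup_range (D : set T) (g : nat -> T -> \bar R) :
  (forall n, measurable_fun D (g n)) ->
  measurable_fun D (fun x => ereal_sup (range (g ^~ x))).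
Proof.
move=> mg; rewrite (_ : (fun _ => _) = (fun x => esups (g ^~ x) 0%N)).
  exact: measurable_fun_esups.
apply/funext => x; rewrite /esups /sdrop.
by congr ereal_sup; apply/seteqP; split => _ [k _ <-]; exists k.
Qed.

Lemma integral_sup_range (D : set T) (g : nat -> T -> \bar R) :
  measurable D -> (forall n, measurable_fun D (g n)) ->
  (forall n x, 0 <= g n x) -> (forall x, nondecreasing_seq (g ^~ x)) ->
  \int[mu]_(x in D) ereal_sup (range (g ^~ x)) =
  ereal_sup (range (fun n => \int[mu]_(x in D) g n x)).
Proof.
move=> mD mg g0 ndg.
transitivity (\int[mu]_(x in D) limn (g ^~ x)).
  apply: eq_integral => x _; apply/esym/cvg_lim => //.
  exact: ereal_nondecreasing_cvgn.
rewrite monotone_convergence//; apply/cvg_lim => //.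
apply: ereal_nondecreasing_cvgn => m n mn; apply: ge0_le_integral => // x _.
exact: ndg.
Qed.

Lemma le_integral_nng (D : set T) (f g : T -> \bar R) :
  measurable D -> measurable_fun D f -> measurable_fun D g ->
  (forall x, D x -> 0 <= f x) -> (forall x, D x -> f x <= g x) ->
  \int[mu]_(x in D) f x <= \int[mu]_(x in D) g x.
Proof. by move=> mD mf mg f0 fg; apply: ge0_le_integral. Qed.

Lemma ge0_integral_setU_le (A B : set T) (f : T -> \bar R) :
  measurable A -> measurable B -> measurable_fun setT f -> (forall x, 0 <= f x) ->
  \int[mu]_(x in A `|` B) f x <=
  \int[mu]_(x in A) f x + \int[mu]_(x in B) f x.
Proof.
move=> mA mB mf f0; have mBA : measurable (B `\` A) by exact: measurableD.
have -> : A `|` B = A `|` (B `\` A).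
  by rewrite setUDr setDv setD0.
rewrite ge0_integral_setU//; first apply: leeD => //.
- apply: ge0_subset_integral => //; exact: measurable_funTS.
- exact: measurable_funTS.
- by apply/disj_setPS => x [Ax []].
Qed.

Lemma measurable_superlevel (f : T -> \bar R) (c : \bar R) :
  measurable_fun setT f -> measurable [set x | c < f x].
Proof.
by move=> mf; rewrite -[X in measurable X]setTI; exact: emeasurable_fun_o_infty.
Qed.

Lemma integral_superlevel (f g : T -> \bar R) (c : \bar R) :
  \int[mu]_x (if c < f x then g x else 0) = \int[mu]_(x in [set x | c < f x]) g x.
Proof.
rewrite [RHS]integral_mkcond; apply: eq_integral => x _; rewrite patchE.
by case: ifPn => [cf|cf]; [rewrite mem_set|rewrite memNset//; exact/negP].
Qed.

Lemma measurable_if_superlevel (f g : T -> \bar R) (c : \bar R) :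
  measurable_fun setT f -> measurable_fun setT g ->
  measurable_fun setT (fun x => if c < f x then g x else 0).
Proof.
move=> mf mg; apply: (measurable_fun_ifT _ mg (measurable_cst 0)) => //=.
by apply: (measurable_fun_bool true); rewrite setTI; exact: measurable_superlevel.
Qed.

End integral_tools.

(** * Majorants of monotone operators *)

Section iteration.
Context d (T : measurableType d) (R : realType).
Variable S : (T -> \bar R) -> T -> \bar R.

(** Monotonicity makes the iterates below increase, and continuity along
    increasing sequences carries the iteration inequality to their supremum.
    Maximal operators have all these properties. *)
Record iterable := Iterable {
  iterable_meas : forall f, measurable_fun setT f -> (forall x, 0 <= f x) ->
    measurable_fun setT (S f);
  iterable_ge0 : forall f x, (forall x, 0 <= f x) -> 0 <= S f x;
  iterable_le : forall f g, measurable_fun setT f -> measurable_fun setT g ->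
    (forall x, 0 <= f x) -> (forall x, f x <= g x) -> forall x, S f x <= S g x;
  iterable_sup : forall f_ : nat -> T -> \bar R,
    (forall n, measurable_fun setT (f_ n)) -> (forall n x, 0 <= f_ n x) ->
    (forall x, nondecreasing_seq (f_ ^~ x)) -> forall x,
    S (fun y => ereal_sup (range (f_ ^~ y))) x <=
      ereal_sup (range (fun n => S (f_ n) x)) }.

Variables (c : R) (f : T -> \bar R).
Hypotheses (itS : iterable) (c0 : (0 < c)%R).
Hypotheses (mf : measurable_fun setT f) (f0 : forall x, 0 <= f x).

(** The Rubio de Francia iteration. Where a sublinear operator would be summed
    in the geometric series of (S / c)^k f, the recursion g |-> f + S g / c only
    relies on the monotonicity of S and serves the same purpose. *)
Fixpoint majorant_seq n : T -> \bar R :=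
  if n is n'.+1 then fun x => f x + (c^-1)%:E * S (majorant_seq n') x else f.

Definition majorant x := ereal_sup (range (majorant_seq ^~ x)).

Lemma majorant_seq_ge0 n x : 0 <= majorant_seq n x.
Proof.
elim: n x => [//|n IH] x /=; apply: adde_ge0 => //.
by apply: mule_ge0; [rewrite lee_fin invr_ge0 ltW|exact: iterable_ge0].
Qed.

Lemma measurable_majorant_seq n : measurable_fun setT (majorant_seq n).
Proof.
elim: n => [//|n IH] /=; apply: emeasurable_funD => //.
apply: measurable_funeM; apply: iterable_meas => //.
exact: majorant_seq_ge0.
Qed.

Lemma majorant_seqS n x : majorant_seq n x <= majorant_seq n.+1 x.
Proof.
elim: n x => [|n IH] x.
  rewrite leeDl// mule_ge0//; first by rewrite lee_fin invr_ge0 ltW.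
  exact: iterable_ge0.
apply: leeD => //; apply: lee_wpmul2l; first by rewrite lee_fin invr_ge0 ltW.
apply: (iterable_le itS); [exact: measurable_majorant_seq|
  exact: (measurable_majorant_seq n.+1)|exact: majorant_seq_ge0|exact: IH].
Qed.

Lemma nondecreasing_majorant_seq x : nondecreasing_seq (majorant_seq ^~ x).
Proof. by apply/nondecreasing_seqP => n; exact: majorant_seqS. Qed.

Lemma measurable_majorant : measurable_fun setT majorant.
Proof. by apply: measurable_sup_range; exact: measurable_majorant_seq. Qed.

Lemma le_majorant x : f x <= majorant x.
Proof. exact: (le_sup_range (majorant_seq ^~ x) 0%N). Qed.

Lemma majorant_ge0 x : 0 <= majorant x.
Proof. exact: (le_trans (f0 x) (le_majorant x)). Qed.

(** The majorant is a fixed point of g |-> f + S g / c up to inequality. *)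
Lemma iter_majorant_le x : S majorant x <= c%:E * majorant x.
Proof.
apply: (le_trans (iterable_sup itS _ _ _ _)).
- exact: measurable_majorant_seq.
- exact: majorant_seq_ge0.
- exact: nondecreasing_majorant_seq.
apply: sup_range_le => n; rewrite -lee_pdivrMl//.
apply: (le_trans _ (le_sup_range (majorant_seq ^~ x) n.+1)).
by rewrite /= leeDr.
Qed.

End iteration.

Section conjugation.
Context d (T : measurableType d) (R : realType).
Variables (S : (T -> \bar R) -> T -> \bar R) (u : T -> R).
Hypotheses (itS : iterable S) (mu_ : measurable_fun setT u).
Hypothesis u0 : forall x, (0 < u x)%R.

(** Conjugation by a weight turns the maximal operator into the operator
    f |-> M(f u) / u whose iteration produces A_1 weights. *)
Lemma iterable_conj :
  iterable (fun f x => S (fun y => f y * (u y)%:E) x * ((u x)^-1)%:E).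
Proof.
have uE0 x : 0 <= (u x)%:E by rewrite lee_fin ltW.
have vE0 x : 0 <= ((u x)^-1)%:E by rewrite lee_fin invr_ge0 ltW.
have mfu f : measurable_fun setT f -> measurable_fun setT (fun y => f y * (u y)%:E).
  by move=> mf; apply: emeasurable_funM => //; exact: measurableT_comp.
have fu0 f : (forall x, 0 <= f x) -> forall x, 0 <= f x * (u x)%:E.
  by move=> f0 x; exact: mule_ge0.
split.
- move=> f mf f0; apply: emeasurable_funM.
    exact: (iterable_meas itS (mfu f mf) (fu0 f f0)).
  apply: measurableT_comp => //; rewrite (_ : (fun x => _) = fun x => (u x `^ (-1))%R).
    exact: measurableT_comp (measurable_powR _) mu_.
  by apply/funext => x; rewrite powR_inv1// ltW.
- move=> f x f0; apply: mule_ge0 => //.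
  exact: (iterable_ge0 itS x (fu0 f f0)).
- move=> f g mf mg f0 fg x; apply: lee_wpmul2r => //.
  apply: (iterable_le itS (mfu f mf) (mfu g mg) (fu0 f f0)) => y.
  exact: lee_wpmul2r.
- move=> f_ mf f0 nd x; rewrite sup_range_pZr ?invr_gt0//.
  apply: lee_wpmul2r => //.
  rewrite (_ : (fun y => ereal_sup (range (f_ ^~ y)) * (u y)%:E) =
      fun y => ereal_sup (range ((fun n z => f_ n z * (u z)%:E) ^~ y))).
    apply: (iterable_sup itS).
    + by move=> n; exact: mfu.
    + by move=> n y; exact: fu0.
    + by move=> y m n mn; apply: lee_wpmul2r => //; exact: nd.
  by apply/funext => y; rewrite sup_range_pZr.
Qed.

End conjugation.

(** * Dyadic level sums *)

Section dyadic_levels.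
Context {R : realType}.
Implicit Types (y z : \bar R) (N k : nat).

(** The dyadic levels from 2^-N on. Sums over all the dyadic levels of R are
    reached by letting N tend to infinity. *)
Definition lam N k : R := (2 ^+ k / 2 ^+ N)%R.

Lemma lam_gt0 N k : (0 < lam N k)%R.
Proof. by rewrite divr_gt0// exprn_gt0. Qed.

Lemma lamS N k : lam N k.+1 = (2 * lam N k)%R.
Proof. by rewrite /lam exprS mulrA. Qed.

Lemma lam_ge N (A : R) : exists k, (A <= lam N k)%R.
Proof.
pose k := Num.truncn (`|A| * 2 ^+ N).
exists k.+1; rewrite /lam ler_pdivlMr ?exprn_gt0//.
apply: (@le_trans _ _ (`|A| * 2 ^+ N)%R).
  by rewrite ler_wpM2r ?exprn_ge0// ler_norm.
apply: (@le_trans _ _ k.+1%:R); last first.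
  by rewrite -natrX ler_nat ltnW// ltn_expl.
by apply/ltW/truncnS_gt; rewrite mulr_ge0 ?exprn_ge0.
Qed.

(** The largest level below y is at least y / 2. *)
Lemma square_le_levels N y : (lam N 0)%:E < y ->
  y * y <= 4%:E * \sum_(k <oo) (if (lam N k)%:E < y then (lam N k * lam N k)%:E else 0).
Proof.
set a := fun k => if (lam N k)%:E < y then (lam N k * lam N k)%:E else 0.
move=> y0; have a0 k : 0 <= a k.
  by rewrite /a; case: ifP => // _; rewrite lee_fin mulr_ge0// ltW// lam_gt0.
have ak k : a k <= \sum_(k <oo) a k.
  apply: (le_trans _ (nneseries_lim_ge k.+1 _)) => //.
  by rewrite big_nat_recr//= leeDr// sume_ge0.
move: y y0 @a a0 ak => [y| |] y0 a a0 ak //; last first.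
  suff -> : \sum_(k <oo) a k = +oo by rewrite mulry gtr0_sg// mul1e leey.
  apply/eqyP => A A0; have [k Ak] := lam_ge N (Num.max A 1%R).
  apply: (le_trans _ (ak k)); rewrite /a ltry lee_fin.
  move: Ak; rewrite ge_max => /andP[Ak k1].
  by rewrite (le_trans Ak)// ler_peMl// (le_trans _ k1).
have ex : exists k, (y <= lam N k)%R by exact: lam_ge.
have [[|k] yk kmin] := ex_minnP ex.
  by move: y0; rewrite lte_fin ltNge yk.
have ky : (lam N k < y)%R.
  by rewrite ltNge; apply/negP => /kmin; rewrite ltnn.
apply: (@le_trans _ _ (4%:E * a k)); last by rewrite lee_pmul2l ?lte_fin.
rewrite /a lte_fin ky -!EFinM lee_fin.
have y0' : (0 <= y)%R by rewrite ltW// (lt_trans (lam_gt0 N 0)).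
apply: (@le_trans _ _ (lam N k.+1 * lam N k.+1)%R); first exact: ler_pM.
by rewrite lamS le_eqVlt; apply/orP; left; apply/eqP; ring.
Qed.

(** A geometric sum is at most twice its largest term, which here is less
    than 2 z. *)
Lemma levels_le N z : 0 <= z ->
  \sum_(k <oo) (if (lam N k / 2)%:E < z then (lam N k)%:E else 0) <= 4%:E * z.
Proof.
move=> z0; apply: lime_le.
  by apply: is_cvg_nneseries => k _ _; case: ifP => // _; rewrite lee_fin ltW// lam_gt0.
apply: nearW => m.
suff [] : \sum_(0 <= k < m) (if (lam N k / 2)%:E < z then (lam N k)%:E else 0) <=
    (lam N m)%:E /\
  \sum_(0 <= k < m) (if (lam N k / 2)%:E < z then (lam N k)%:E else 0) <= 4%:E * z.
  by [].
elim: m => [|m [IH1 IH2]].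
  by rewrite big_geq//; split; [rewrite lee_fin ltW// lam_gt0|exact: mule_ge0].
rewrite big_nat_recr//=; case: ifPn => [mz|_].
  have S2 : \sum_(0 <= k < m) (if (lam N k / 2)%:E < z then (lam N k)%:E else 0) +
    (lam N m)%:E <= (lam N m.+1)%:E.
    by rewrite lamS mulr2n mulrDl !mul1r EFinD leeD.
  split=> //; apply: (le_trans S2).
  have -> : (lam N m.+1)%:E = 4%:E * (lam N m / 2)%:E.
    by rewrite -EFinM lamS; congr EFin; field.
  by rewrite lee_pmul2l ?lte_fin// ltW.
rewrite adde0; split => //; apply: (le_trans IH1).
by rewrite lamS lee_fin ler_peMl ?ler1n// ltW// lam_gt0.
Qed.

End dyadic_levels.

(** * Weighted maximal operators *)

Section vitali_maximal.
Context d (T : measurableType d) (R : realType).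
Variable mu : {measure set T -> \bar R}.
Variables (Q : nat -> set T) (w : T -> R).

Definition wvol k : R := fine (\int[mu]_(x in Q k) (w x)%:E).

Definition wavg (f : T -> \bar R) k : \bar R :=
  (wvol k)^-1%:E * \int[mu]_(x in Q k) (f x * (w x)%:E).

Definition wmax (f : T -> \bar R) (x : T) : \bar R :=
  ereal_sup (range (fun k => wavg f k * (\1_(Q k) x)%:E)).

Hypothesis mQ : forall k, measurable (Q k).
Hypothesis mw : measurable_fun setT w.
Hypothesis w_gt0 : forall x, (0 < w x)%R.
Hypothesis wQ : forall k, 0 < \int[mu]_(x in Q k) (w x)%:E < +oo.

Let mwE (D : set T) : measurable_fun D (fun x => (w x)%:E).
Proof. by apply: measurable_funTS; exact: measurableT_comp. Qed.

Let wE_ge0 x : 0 <= (w x)%:E. Proof. by rewrite lee_fin ltW. Qed.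

Lemma wvolE k : \int[mu]_(x in Q k) (w x)%:E = (wvol k)%:E.
Proof.
have /andP[k0 koo] := wQ k; rewrite /wvol fineK// ge0_fin_numE//.
exact: ltW.
Qed.

Lemma wvol_gt0 k : (0 < wvol k)%R.
Proof. by rewrite -lte_fin -wvolE; have /andP[] := wQ k. Qed.

Lemma measurable_mulw (f : T -> \bar R) (D : set T) :
  measurable_fun setT f -> measurable_fun D (fun x => f x * (w x)%:E).
Proof. by move=> mf; apply: measurable_funTS; exact: emeasurable_funM. Qed.

Lemma wavg_ge0 f k : (forall x, 0 <= f x) -> 0 <= wavg f k.
Proof.
move=> f0; apply: mule_ge0; first by rewrite lee_fin invr_ge0 ltW// wvol_gt0.
by apply: integral_ge0 => x _; exact: mule_ge0.
Qed.

Lemma wmax_ge f k x : Q k x -> wavg f k <= wmax f x.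
Proof.
move=> Qx; have := le_sup_range (fun k => wavg f k * (\1_(Q k) x)%:E) k.
by rewrite /= indicE mem_set// mule1.
Qed.

Lemma wmax_le f x c : 0 <= c -> (forall k, Q k x -> wavg f k <= c) ->
  wmax f x <= c.
Proof.
move=> c0 h; apply: sup_range_le => k; rewrite indicE.
have [xQ|xQ] := boolP (x \in Q k); last by rewrite mule0.
by rewrite mule1; apply: h; rewrite inE in xQ.
Qed.

Lemma wmax_gtP f x c : 0 <= c -> c < wmax f x ->
  exists2 k, Q k x & c < wavg f k.
Proof.
move=> c0 /lt_sup_range[k]; rewrite indicE.
have [xQ|xQ] := boolP (x \in Q k).
  by rewrite mule1 => ck; exists k => //; rewrite inE in xQ.
by rewrite mule0 ltNge c0.
Qed.

Lemma wmax_iterable : iterable wmax.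
Proof.
split.
- move=> f mf f0; apply: measurable_sup_range => k.
  apply: measurable_funeM; apply: measurableT_comp => //.
- move=> f x f0; apply: ge0_sup_range => k.
  by rewrite mule_ge0 ?wavg_ge0// lee_fin.
- move=> f g mf mg f0 fg x; apply: wmax_le.
    apply: ge0_sup_range => k; rewrite mule_ge0 ?lee_fin// wavg_ge0// => y.
    exact: le_trans (fg y).
  move=> k Qk; apply: (le_trans _ (wmax_ge g Qk)).
  apply: lee_wpmul2l; first by rewrite lee_fin invr_ge0 ltW// wvol_gt0.
  apply: le_integral_nng => //; try exact: measurable_mulw.
  + by move=> y _; exact: mule_ge0.
  + by move=> y _; exact: lee_wpmul2r.
- move=> f_ mf f0 ndf x; apply: wmax_le.
    apply: ge0_sup_range => k; apply: ge0_sup_range => n.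
    by rewrite mule_ge0 ?wavg_ge0// lee_fin.
  move=> k Qk; rewrite /wavg.
  under eq_integral do rewrite -sup_range_pZr//.
  rewrite integral_sup_range//.
  + rewrite -sup_range_pZl ?invr_gt0 ?wvol_gt0//; apply: sup_range_le => n.
    apply: (le_trans _ (le_sup_range _ n)).
    exact: (wmax_ge (f_ n) Qk).
  + by move=> n; exact: measurable_mulw.
  + by move=> n y; exact: mule_ge0.
  + by move=> y m n mn; apply: lee_wpmul2r => //; exact: ndf.
Qed.

Variables (size_of : nat -> R) (D : R).
Hypothesis D0 : (0 < D)%R.
Hypothesis doubling : forall k (s : seq nat),
  (forall j, j \in s -> (size_of j <= size_of k)%R /\ Q j `&` Q k !=set0) ->
  \int[mu]_(x in \big[setU/set0]_(j <- s) Q j) (w x)%:E <=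
  D%:E * (wvol k)%:E.

Let mbig (s : seq nat) : measurable (\big[setU/set0]_(j <- s) Q j).
Proof. exact: bigsetU_measurable. Qed.

Lemma seq_max (s : seq nat) : s != [::] ->
  exists2 k, k \in s & forall j, j \in s -> (size_of j <= size_of k)%R.
Proof.
elim: s => // a s IH _; have [->|/IH[k ks kM]] := eqVneq s [::].
  by exists a; rewrite ?inE// => j; rewrite inE => /eqP ->.
have [ak|ka] := leP (size_of a) (size_of k).
  exists k; first by rewrite inE ks orbT.
  by move=> j; rewrite inE => /predU1P[->//|/kM].
exists a; first by rewrite inE eqxx.
move=> j; rewrite inE => /predU1P[->//|/kM/le_trans]; apply; exact: ltW.
Qed.

(** The Vitali selection: a largest set of the list swallows, at the price of
    the doubling constant, every set that it meets; the others are disjoint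
    from it, so that the bounds obtained by induction add up. *)
Lemma vitali_finite (g : T -> \bar R) (l : R) (s : seq nat) :
  measurable_fun setT g -> (forall x, 0 <= g x) -> (0 < l)%R ->
  (forall k, k \in s -> l%:E * (wvol k)%:E <= \int[mu]_(x in Q k) g x) ->
  l%:E * \int[mu]_(x in \big[setU/set0]_(j <- s) Q j) (w x)%:E <=
  D%:E * \int[mu]_(x in \big[setU/set0]_(j <- s) Q j) g x.
Proof.
move=> mg g0 l0; have [n] := ubnP (size s); elim: n s => // n IH s sn sl.
have [->|s0] := eqVneq s [::].
  by rewrite big_nil !integral_set0 !mule0.
have [k ks kM] := seq_max s0.
pose P j := `[< Q j `&` Q k !=set0 >].
pose s1 := [seq j <- s | P j]; pose s2 := [seq j <- s | ~~ P j].
have Qk0 : Q k !=set0.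
  apply/set0P/negP => /eqP Qk0; have := wQ k.
  by rewrite Qk0 integral_set0 ltxx.
have Pk : P k by apply/asboolP; rewrite setIid.
have s2n : (size s2 < n)%N.
  rewrite -ltnS; apply: leq_trans sn; rewrite ltnS /s2 size_filter.
  rewrite -(count_predC P) -addn1 addnC leq_add2r -has_count.
  by apply/hasP; exists k.
have sE : \big[setU/set0]_(j <- s) Q j =
    \big[setU/set0]_(j <- s1) Q j `|` \big[setU/set0]_(j <- s2) Q j.
  by rewrite !big_filter (bigID P).
have s2Q : [disjoint Q k & \big[setU/set0]_(j <- s2) Q j].
  apply/disj_setPRL => x; rewrite -bigcup_seq => -[j /=].
  rewrite mem_filter => /andP[/asboolPn Pj _] Qjx Qkx.
  by apply: Pj; exists x.
have IH2 := IH s2 s2n (fun j (js : j \in s2) =>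
  sl j (mem_subseq (filter_subseq _ _) js)).
apply: (@le_trans _ _ (l%:E * (D%:E * (wvol k)%:E +
    \int[mu]_(x in \big[setU/set0]_(j <- s2) Q j) (w x)%:E))).
  rewrite lee_pmul2l ?lte_fin//.
  rewrite sE.
  apply: (le_trans (ge0_integral_setU_le mu (mbig s1) (mbig s2) (@mwE setT)
    wE_ge0)).
  apply: leeD => //; apply: doubling => j; rewrite mem_filter => /andP[Pj js].
  by split; [exact: kM|exact/asboolP].
have D0E : 0 <= D%:E * (wvol k)%:E.
  by rewrite mule_ge0// lee_fin ltW// wvol_gt0.
have I2 : 0 <= \int[mu]_(x in \big[setU/set0]_(j <- s2) Q j) (w x)%:E.
  by apply: integral_ge0 => x _.
rewrite ge0_muleDr//.
apply: (@le_trans _ _ (D%:E * (\int[mu]_(x in Q k) g x +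
    \int[mu]_(x in \big[setU/set0]_(j <- s2) Q j) g x))).
  have J1 : 0 <= \int[mu]_(x in Q k) g x by exact: integral_ge0.
  have J2 : 0 <= \int[mu]_(x in \big[setU/set0]_(j <- s2) Q j) g x.
    exact: integral_ge0.
  rewrite (ge0_muleDr _ J1 J2); apply: leeD => //.
  by rewrite muleCA lee_pmul2l ?lte_fin//; exact: sl.
rewrite lee_pmul2l ?lte_fin// -ge0_integral_setU//; last exact: measurable_funTS.
apply: ge0_subset_integral => //; [exact: measurableU|exact: measurable_funTS|].
rewrite subUset; split; last by rewrite sE; exact: subsetUr.
by rewrite -bigcup_seq => x Qx; exists k.
Qed.

Definition wlevel (f : T -> \bar R) (l : R) : set T :=
  [set x | l%:E < wmax f x].

Lemma measurable_wlevel f l : measurable_fun setT f -> (forall x, 0 <= f x) ->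
  measurable (wlevel f l).
Proof.
move=> mf f0; apply: measurable_superlevel.
exact: (iterable_meas wmax_iterable mf f0).
Qed.

(** Of the mass that makes an average exceed l, at most half comes from the
    points where f <= l / 2, so the covering argument can be applied to f
    restricted to the other points. This is what makes the inequality sum up to
    an L^2 bound. *)
Lemma weak_type (f : T -> \bar R) (l : R) :
  measurable_fun setT f -> (forall x, 0 <= f x) -> (0 < l)%R ->
  l%:E * \int[mu]_(x in wlevel f l) (w x)%:E <=
  (D * 2)%:E * \int[mu]_(x in [set x | (l / 2)%:E < f x]) (f x * (w x)%:E).
Proof.
move=> mf f0 l0.
pose c : pred nat := fun k => `[< l%:E < wavg f k >].
(* the level set is an increasing union of finite unions of sets Q k *)
pose F n := \big[setU/set0]_(j <- [seq j <- iota 0 n | c j]) Q j.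
have FE : wlevel f l = \bigcup_n F n.
  apply/seteqP; split => [x|x [n _]].
    move=> /wmax_gtP[|k Qk lk]; first by rewrite lee_fin ltW.
    exists k.+1 => //; rewrite /F -bigcup_seq.
    suff kF : k \in [seq j <- iota 0 k.+1 | c j] by exists k.
    by rewrite mem_filter mem_iota add0n ltnSn !andbT; exact/asboolP.
  rewrite /F -bigcup_seq => -[k /=]; rewrite mem_filter => /andP[/asboolP ck _] Qx.
  exact: lt_le_trans ck (wmax_ge _ Qx).
have ndF : nondecreasing_seq F.
  move=> m n mn; apply/subsetPset; rewrite /F -!bigcup_seq => x [k /=].
  rewrite mem_filter mem_iota add0n => /andP[ck /andP[_ km]] Qx; exists k => //.
  by rewrite /= mem_filter ck mem_iota/= add0n (leq_trans km).
pose A := [set x | (l / 2)%:E < f x].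
have mA : measurable A by exact: measurable_superlevel.
pose g x := f x * (w x)%:E.
have mg : measurable_fun setT g by exact: measurable_mulw.
have g0 x : 0 <= g x by exact: mule_ge0.
pose gA := g \_ A.
have mgA : measurable_fun setT gA by apply/(measurable_restrictT _ _).1 => //;
  exact: measurable_funTS.
have gA0 x : 0 <= gA x by apply: erestrict_ge0.
have Fbound n : l%:E * \int[mu]_(x in F n) (w x)%:E <=
    (D * 2)%:E * \int[mu]_(x in A) g x.
  have l20 : (0 < l / 2)%R by rewrite divr_gt0.
  have := @vitali_finite gA (l / 2) [seq j <- iota 0 n | c j] mgA gA0 l20.
  move=> /(_ _)/le_trans H.
  have -> : l%:E = 2%:E * (l / 2)%:E by rewrite -EFinM mulrC divfK.
  rewrite [(D * 2)%R]mulrC [(2 * D)%:E]EFinM -[leLHS]muleA -[leRHS]muleA lee_pmul2l ?lte_fin//; apply: H.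
    move=> k; rewrite mem_filter => /andP[/asboolP ck _].
    have gk : l%:E * (wvol k)%:E <= \int[mu]_(x in Q k) g x.
      by move/ltW : ck; rewrite /wavg lee_pdivlMl ?wvol_gt0// muleC.
    have : \int[mu]_(x in Q k) g x <=
        \int[mu]_(x in Q k) gA x + (l / 2)%:E * (wvol k)%:E.
      have l2E : 0 <= (l / 2)%:E by rewrite lee_fin ltW.
      rewrite -wvolE -ge0_integralZl//.
      rewrite -ge0_integralD//; last 3 first.
      - exact: measurable_funTS.
      - by move=> x _; exact: mule_ge0.
      - by apply: measurable_funeM; exact: mwE.
      apply: le_integral_nng => //.
      + exact: measurable_funTS.
      + apply: emeasurable_funD; first exact: measurable_funTS.
        by apply: measurable_funeM; exact: mwE.
      move=> x _; rewrite /gA patchE; case: ifPn => [|/negP xA].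
        by move=> _; rewrite leeDl// mule_ge0// lee_fin ltW.
      rewrite add0e /g; apply: lee_wpmul2r => //.
      by rewrite leNgt; apply/negP => fx; apply: xA; rewrite inE.
    move=> /(le_trans gk).
    have -> : l%:E * (wvol k)%:E =
        (l / 2)%:E * (wvol k)%:E + (l / 2)%:E * (wvol k)%:E.
      by rewrite -!EFinM -EFinD -mulrDl -splitr.
    by rewrite leeD2rE.
  rewrite lee_pmul2l ?lte_fin// [leRHS]integral_mkcond.
  exact: ge0_subset_integral.
have cvF := @ge0_nondecreasing_set_cvg_integral _ _ _ F (fun x => (w x)%:E) mu
  ndF (fun n => mbig _) (fun n => @mwE _) (fun _ x _ => wE_ge0 x).
rewrite FE -(cvg_lim _ cvF)//.
rewrite -lee_pdivlMl//; apply: lime_le; first by apply/cvg_ex; eexists; exact: cvF.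
by apply: nearW => n; rewrite lee_pdivlMl.
Qed.

(** Marcinkiewicz interpolation in discrete form: multiplying the weak type
    inequality at level l by l and adding over dyadic l gives the square of the
    maximal function on the left and the square of f on the right. *)
Lemma strong_type (f : T -> \bar R) :
  measurable_fun setT f -> (forall x, 0 <= f x) ->
  \int[mu]_x (wmax f x * wmax f x * (w x)%:E) <=
  (32 * D)%:E * \int[mu]_x (f x * f x * (w x)%:E).
Proof.
move=> mf f0.
have mM : measurable_fun setT (wmax f) := iterable_meas wmax_iterable mf f0.
have M0 x : 0 <= wmax f x := iterable_ge0 wmax_iterable x f0.
pose g N x := if (lam N 0)%:E < wmax f x
  then wmax f x * wmax f x * (w x)%:E else 0 : \bar R.
have mg N : measurable_fun setT (g N).
  apply: measurable_if_superlevel => //; apply: measurable_mulw.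
  exact: emeasurable_funM.
have g0 N x : 0 <= g N x.
  by rewrite /g; case: ifP => // _; rewrite mule_ge0// mule_ge0.
have ndg x : nondecreasing_seq (g ^~ x).
  apply/nondecreasing_seqP => N; rewrite /g; case: ifPn => [NM|_]; last exact: g0.
  case: ifPn => // /negP; rewrite (lt_trans _ NM)// lte_fin.
  by rewrite /lam ltr_pM2l ?expr0// ltf_pV2 ?posrE ?exprn_gt0// exprS ltr_pMl
    ?exprn_gt0// ltr1n.
have -> : \int[mu]_x (wmax f x * wmax f x * (w x)%:E) =
    \int[mu]_x ereal_sup (range (g ^~ x)).
  apply: eq_integral => x _; apply/eqP; rewrite eq_le; apply/andP; split.
    have [M_gt0|M_le0] := ltP 0 (wmax f x); last first.
      have -> : wmax f x = 0 by apply/eqP; rewrite eq_le M_le0 M0.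
      by rewrite !mul0e; exact: ge0_sup_range.
    suff [N NM] : exists N, (lam N 0)%:E < wmax f x.
      by apply: (le_trans _ (le_sup_range _ N)); rewrite /g NM.
    move: M_gt0; case: (wmax f x) => [r| |//]; last by exists 0%N; exact: ltry.
    rewrite lte_fin => r0; have [N Nr] := lam_ge 0 (r^-1 + 1)%R.
    exists N; rewrite lte_fin /lam expr0 mul1r invf_plt ?posrE ?exprn_gt0//.
    by move: Nr; rewrite /lam expr0 divr1; apply: lt_le_trans; rewrite ltrDl.
  by apply: sup_range_le => N; rewrite /g; case: ifP => // _;
    rewrite mule_ge0// mule_ge0.
rewrite integral_sup_range//; apply: sup_range_le => N.
pose b k x := if (lam N k)%:E < wmax f x
  then (lam N k * lam N k)%:E * (w x)%:E else 0 : \bar R.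
pose e k x := if (lam N k / 2)%:E < f x
  then (lam N k)%:E * (f x * (w x)%:E) else 0 : \bar R.
have l0 k : 0 <= (lam N k)%:E by rewrite lee_fin ltW// lam_gt0.
have b0 k x : 0 <= b k x.
  by rewrite /b; case: ifP => // _; rewrite EFinM !mule_ge0.
have e0 k x : 0 <= e k x.
  by rewrite /e; case: ifP => // _; rewrite !mule_ge0.
have mb k : measurable_fun setT (b k).
  by apply: measurable_if_superlevel => //; apply: measurable_funeM; exact: mwE.
have me k : measurable_fun setT (e k).
  by apply: measurable_if_superlevel => //; apply: measurable_funeM;
    exact: measurable_mulw.
have be k : \int[mu]_x b k x <= (D * 2)%:E * \int[mu]_x e k x.
  rewrite !integral_superlevel ge0_integralZl//; last 2 first.
  - exact: measurable_wlevel.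
  - by rewrite lee_fin mulr_ge0// ltW// lam_gt0.
  rewrite ge0_integralZl//; last 3 first.
  - exact: measurable_superlevel.
  - exact: measurable_mulw.
  - by move=> x _; exact: mule_ge0.
  rewrite [leRHS]muleCA [(lam N k * lam N k)%:E]EFinM -[leLHS]muleA.
  apply: lee_wpmul2l; first exact: l0.
  by apply: weak_type => //; exact: lam_gt0.
have gb x : g N x <= 4%:E * \sum_(k <oo) b k x.
  rewrite {1}/g; case: ifPn => [NM|_]; last first.
    by rewrite mule_ge0// nneseries_ge0.
  apply: (@le_trans _ _ (4%:E * (\sum_(k <oo) (if (lam N k)%:E < wmax f x
      then (lam N k * lam N k)%:E else 0)) * (w x)%:E)).
    by apply: lee_wpmul2r => //; exact: square_le_levels.
  rewrite -muleA; apply: lee_wpmul2l => //; rewrite muleC -nneseriesZl//; last first.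
    by move=> k _; case: ifP => // _; rewrite EFinM mule_ge0.
  apply: lee_nneseries => k _.
    by case: ifP => // _; rewrite ?mule0// !mule_ge0// EFinM mule_ge0.
  by rewrite /b; case: ifP => // _; rewrite ?mule0// muleC.
have ef x : \sum_(k <oo) e k x <= 4%:E * (f x * f x * (w x)%:E).
  have [fxoo|] := eqVneq (f x) +oo.
    by rewrite fxoo mulyy gt0_mulye ?lte_fin// gt0_muley ?lte_fin// leey.
  rewrite -ltey => fxoo.
  have fwE : f x * (w x)%:E = (fine (f x) * w x)%:E.
    by rewrite EFinM fineK// ge0_fin_numE.
  apply: (@le_trans _ _ ((f x * (w x)%:E) * \sum_(k <oo)
      (if (lam N k / 2)%:E < f x then (lam N k)%:E else 0))).
    rewrite fwE -nneseriesZl//; last by move=> k _; case: ifP.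
    rewrite -fwE; apply: lee_nneseries => k _; first by move=> _; exact: e0.
    by rewrite /e; case: ifP => // _; rewrite ?mule0// muleC.
  apply: (@le_trans _ _ ((f x * (w x)%:E) * (4%:E * f x))).
    by apply: lee_wpmul2l; [exact: mule_ge0|exact: levels_le].
  by rewrite muleCA [f x * _ * f x]muleAC.
apply: (@le_trans _ _ (\int[mu]_x (4%:E * \sum_(k <oo) b k x))).
  apply: le_integral_nng => //; apply: measurable_funeM.
  exact: ge0_emeasurable_sum.
rewrite ge0_integralZl//; last 2 first.
- exact: ge0_emeasurable_sum.
- by move=> x _; exact: nneseries_ge0.
rewrite integral_nneseries//.
apply: (@le_trans _ _ (4%:E * ((D * 2)%:E * \int[mu]_x \sum_(k <oo) e k x))).
  apply: lee_wpmul2l => //; rewrite integral_nneseries//.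
  have D2 : 0 <= (D * 2)%:E by rewrite lee_fin mulr_ge0// ltW.
  rewrite -nneseriesZl//; last by move=> k _; exact: integral_ge0.
  by apply: lee_nneseries => k _; [move=> _; exact: integral_ge0|exact: be].
have -> : (32 * D)%:E = 4%:E * ((D * 2)%:E * 4%:E) :> \bar R.
  by rewrite -!EFinM; congr EFin; ring.
have mff : measurable_fun setT (fun x => f x * f x * (w x)%:E).
  by apply: measurable_mulw; exact: emeasurable_funM.
rewrite -!muleA; apply: lee_wpmul2l => //; apply: lee_wpmul2l.
  by rewrite lee_fin mulr_ge0// ltW.
rewrite -ge0_integralZl//; last by move=> x _; rewrite !mule_ge0.
apply: le_integral_nng => //.
- exact: ge0_emeasurable_sum.
- exact: measurable_funeM.
- by move=> x _; exact: nneseries_ge0.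
Qed.

End vitali_maximal.

Section wmajorant.
Context d (T : measurableType d) (R : realType).
Variable mu : {measure set T -> \bar R}.
Variables (Q : nat -> set T) (w : T -> R) (size_of : nat -> R) (D : R).
Hypothesis mQ : forall k, measurable (Q k).
Hypothesis mw : measurable_fun setT w.
Hypothesis w_gt0 : forall x, (0 < w x)%R.
Hypothesis wQ : forall k, 0 < \int[mu]_(x in Q k) (w x)%:E < +oo.
Hypothesis D0 : (0 < D)%R.
Hypothesis doubling : forall k (s : seq nat),
  (forall j, j \in s -> (size_of j <= size_of k)%R /\ Q j `&` Q k !=set0) ->
  \int[mu]_(x in \big[setU/set0]_(j <- s) Q j) (w x)%:E <=
  D%:E * (wvol mu Q w k)%:E.
Variable f : T -> \bar R.
Hypotheses (mf : measurable_fun setT f) (f0 : forall x, 0 <= f x).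

(** Large enough for the contribution of S g / c to the square integral of the
    majorant to be at most a half, as the constant of [strong_type] is 32 D. *)
Let c : R := (1 + 128 * D)%R.

Let c0 : (0 < c)%R. Proof. exact: addr_gt0 ltr01 (mulr_gt0 (ltr0Sn _ _) D0). Qed.

Let it := wmax_iterable mQ mw w_gt0 wQ.

Lemma square_add_le (a b : \bar R) : 0 <= a -> 0 <= b ->
  (a + b) * (a + b) <= 2%:E * (a * a) + 2%:E * (b * b).
Proof.
move: a b => [a| |] [b| |]//= a0 b0; rewrite -?EFinD -?EFinM -?EFinD.
- rewrite lee_fin; suff : (0 <= (a - b) ^+ 2)%R by rewrite !expr2; lra.
  exact: sqr_ge0.
- by rewrite [(+oo * +oo)%E in leRHS]mulyy [(_ * +oo)%E in leRHS]gt0_muley ?lte_fin// [leRHS]addey// leey.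
- by rewrite [(+oo * +oo)%E in leRHS]mulyy [(_ * +oo)%E in leRHS]gt0_muley ?lte_fin// [leRHS]addye// leey.
- by rewrite [(+oo * +oo)%E in leRHS]mulyy [(_ * +oo)%E in leRHS]gt0_muley ?lte_fin// [leRHS]addye// leey.
Qed.

(** If the square integral of g is at most 4 times that of f, then so is that of
    f + S g / c, by (a + b)^2 <= 2 a^2 + 2 b^2 and the choice of c. *)
Lemma wmajorant_square :
  \int[mu]_x (majorant (wmax mu Q w) c f x * majorant (wmax mu Q w) c f x *
    (w x)%:E) <=
  4%:E * \int[mu]_x (f x * f x * (w x)%:E).
Proof.
pose G := majorant_seq (wmax mu Q w) c f.
have mG n : measurable_fun setT (G n) := measurable_majorant_seq it c0 mf f0 n.
have G0 n x : 0 <= G n x := majorant_seq_ge0 it c0 f0 n x.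
have ndG x : nondecreasing_seq (G ^~ x) := nondecreasing_majorant_seq it c0 mf f0 x.
have wE0 x : 0 <= (w x)%:E by rewrite lee_fin ltW.
have mGG n : measurable_fun setT (fun x => G n x * G n x * (w x)%:E).
  by apply: measurable_mulw => //; exact: emeasurable_funM.
have GG0 n x : 0 <= G n x * G n x * (w x)%:E by rewrite !mule_ge0.
have mff : measurable_fun setT (fun x => f x * f x * (w x)%:E).
  by apply: measurable_mulw => //; exact: emeasurable_funM.
have ff0 x : 0 <= f x * f x * (w x)%:E by rewrite !mule_ge0.
have I0 : 0 <= \int[mu]_x (f x * f x * (w x)%:E) by exact: integral_ge0.
have step n : \int[mu]_x (G n x * G n x * (w x)%:E) <=
    4%:E * \int[mu]_x (f x * f x * (w x)%:E).
  elim: n => [|n IH]; first by rewrite /G /= lee_pemull// lee_fin ler1n.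
  pose M := wmax mu Q w (G n).
  have mM : measurable_fun setT M := iterable_meas it (mG n) (G0 n).
  have M0 x : 0 <= M x := iterable_ge0 it x (G0 n).
  have mMM : measurable_fun setT (fun x => M x * M x * (w x)%:E).
    by apply: measurable_mulw => //; exact: emeasurable_funM.
  have MM0 x : 0 <= M x * M x * (w x)%:E by rewrite !mule_ge0.
  have k0 : (0 <= 2 * (c^-1 * c^-1))%R.
    by rewrite mulr_ge0// mulr_ge0// invr_ge0 ltW.
  apply: (@le_trans _ _ (\int[mu]_x (2%:E * (f x * f x * (w x)%:E) +
      (2 * (c^-1 * c^-1))%:E * (M x * M x * (w x)%:E)))).
    apply: le_integral_nng => //.
      by apply: emeasurable_funD; exact: measurable_funeM.
    move=> x _; rewrite [G n.+1 x]/=.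
    apply: (@le_trans _ _ ((2%:E * (f x * f x) +
      2%:E * ((c^-1%:E * M x) * (c^-1%:E * M x))) * (w x)%:E)).
      apply: lee_wpmul2r => //; apply: square_add_le => //.
      by rewrite mule_ge0// lee_fin invr_ge0 ltW.
    rewrite muleDl//; last first.
      by rewrite ge0_adde_def// inE !mule_ge0// lee_fin invr_ge0 ltW.
    rewrite -[2%:E * (f x * f x) * _]muleA leeD2l// muleACA -EFinM.
    by rewrite [2%:E * _]muleA -EFinM -muleA.
  rewrite ge0_integralD//; last 4 first.
  - by move=> x _; exact: mule_ge0.
  - exact: measurable_funeM.
  - by move=> x _; rewrite mule_ge0// lee_fin.
  - exact: measurable_funeM.
  rewrite !ge0_integralZl//.
  have -> : 4%:E = 2%:E + 2%:E :> \bar R by rewrite -EFinD; congr EFin; ring.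
  rewrite [leRHS]ge0_muleDl//; apply: leeD => //.
  apply: (@le_trans _ _ ((2 * (c^-1 * c^-1))%:E * ((32 * D)%:E *
      (4%:E * \int[mu]_x (f x * f x * (w x)%:E))))).
    apply: lee_wpmul2l; first by rewrite lee_fin.
    apply: (le_trans (strong_type mQ mw w_gt0 wQ D0 doubling (mG n) (G0 n))).
    by apply: lee_wpmul2l => //; rewrite lee_fin mulr_ge0// ltW.
  rewrite !muleA -!EFinM; apply: lee_wpmul2r => //; rewrite lee_fin.
  have -> : (2 * (c^-1 * c^-1) * (32 * D) * 4 = 2 * (128 * D / (c * c)))%R.
    by rewrite invfM; ring.
  rewrite ler_piMr// ler_pdivrMr ?mulr_gt0// mul1r /c.
  have := D0; nra.
rewrite (_ : (fun x => _) =
    fun x => ereal_sup (range (fun n => G n x * G n x * (w x)%:E))).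
  rewrite integral_sup_range//; first exact: sup_range_le.
  by move=> x m n mn; apply: lee_wpmul2r => //; apply: lee_pmul => //; exact: ndG.
apply/funext => x; rewrite sup_range_pZr// sup_range_square//.
Qed.
End wmajorant.

(** * Bases of sets and the A_p condition *)

Section posfin.
Context d (T : measurableType d) (R : realType).
Variable mu : {measure set T -> \bar R}.

(** Weights are positive and finite only almost everywhere; this version of f is
    so everywhere and agrees with f where f is positive and finite. *)
Definition posfin (f : T -> \bar R) (x : T) : R :=
  if 0 < f x < +oo then fine (f x) else 1%R.

Lemma posfin_gt0 f x : (0 < posfin f x)%R.
Proof.
rewrite /posfin; case: ifPn => // /andP[f0 foo].
by rewrite -lte_fin fineK// ge0_fin_numE// ltW.
Qed.

Lemma posfinE f x : 0 < f x < +oo -> (posfin f x)%:E = f x.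
Proof.
move=> fx; rewrite /posfin fx; have /andP[f0 foo] := fx.
by rewrite fineK// ge0_fin_numE// ltW.
Qed.

Lemma measurable_posfin f : measurable_fun setT f ->
  measurable_fun setT (posfin f).
Proof.
move=> mf; apply: measurable_fun_ifT => //; last exact: measurableT_comp.
have m1 : measurable [set x | 0 < f x < +oo].
  rewrite (_ : [set _ | _] = [set x | 0 < f x] `&` [set x | f x < +oo]); last first.
    by apply/seteqP; split => x /=; [move=> /andP[]|move=> [-> ->]].
  apply: measurableI; first exact: measurable_superlevel.
  by rewrite -[X in measurable X]setTI; exact: emeasurable_fun_infty_o.
by apply: (measurable_fun_bool true); rewrite setTI.
Qed.

Lemma ae_lty_integral (f : T -> \bar R) : measurable_fun setT f ->
  (forall x, 0 <= f x) -> \int[mu]_x f x < +oo -> {ae mu, forall x, f x < +oo}.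
Proof.
move=> mf f0 foo.
have : mu.-integrable setT f.
  apply/integrableP; split => //; apply: le_lt_trans foo.
  by under eq_integral do rewrite gee0_abs//.
move=> /(integrable_ae measurableT); apply: filterS => x /(_ I).
by rewrite fin_numElt => /andP[].
Qed.

Lemma integral_gt0 (A : set T) (f : T -> \bar R) : measurable A ->
  measurable_fun setT f -> (forall x, 0 < f x) -> 0 < mu A ->
  0 < \int[mu]_(x in A) f x.
Proof.
move=> mA mf f0 A0; rewrite lt_neqAle integral_ge0 ?andbT; last first.
  by move=> x _; exact: ltW.
apply/eqP => /esym I0.
have := ae_eq_integral_abs mu mA (measurable_funTS mf).
under eq_integral do rewrite gee0_abs ?ltW//.
move=> [/(_ I0) [N [mN N0 sN]] _].
have : A `<=` N.
  by move=> x Ax; apply: sN => /= /(_ Ax) /eqP; rewrite gt_eqF.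
by move=> /(subset_measure0 mA mN)/(_ N0) A00; rewrite A00 ltxx in A0.
Qed.

Lemma ae_gt0_meet (A : set T) (P : T -> Prop) : measurable A -> 0 < mu A ->
  {ae mu, forall x, P x} -> exists2 x, A x & P x.
Proof.
move=> mA A0 [N [mN N0 sN]]; apply/not_exists2P => AP.
have : A `<=` N by move=> x Ax; apply: sN => /= Px; have [] := AP x.
by move=> /(subset_measure0 mA mN)/(_ N0) A00; rewrite A00 ltxx in A0.
Qed.

Lemma integral_eq0_ae (f : T -> \bar R) : measurable_fun setT f ->
  (forall x, 0 <= f x) -> \int[mu]_x f x = 0 -> {ae mu, forall x, f x = 0}.
Proof.
move=> mf f0 I0; have := ae_eq_integral_abs mu measurableT mf.
under eq_integral do rewrite gee0_abs//.
by move=> [/(_ I0) + _]; apply: filterS => x /(_ I).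
Qed.

Lemma ae_eq0_integral (A : set T) (f : T -> \bar R) : measurable A ->
  measurable_fun setT f -> (forall x, 0 <= f x) ->
  {ae mu, forall x, f x = 0} -> \int[mu]_(x in A) f x = 0.
Proof.
move=> mA mf f0 fae; have := ae_eq_integral_abs mu mA (measurable_funTS mf).
under eq_integral do rewrite gee0_abs//.
by move=> [_]; apply; apply: filterS fae => x.
Qed.

End posfin.

(** In the change of exponent, the family of cubes of R^n with rational data only
    enters through these properties; [basis_triple] is the engulfing property behind the Vitali
    covering argument and [basis_join] says that the family is directed. *)
Record basis d (T : measurableType d) (R : realType)
    (mu : {measure set T -> \bar R}) := Basis {
  bset : nat -> set T;
  bsize : nat -> R;
  bratio : R;
  basis_meas : forall k, measurable (bset k);
  basis_vol : forall k, 0 < mu (bset k) < +oo;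
  basis_triple : forall k, exists m, [/\ bset k `<=` bset m,
    (forall j, (bsize j <= bsize k)%R -> bset j `&` bset k !=set0 ->
      bset j `<=` bset m) & mu (bset m) <= bratio%:E * mu (bset k)];
  basis_cover : forall x, exists k, bset k x;
  basis_join : forall j k, exists m, bset j `|` bset k `<=` bset m }.

Section Acond.
Context d (T : measurableType d) (R : realType).
Variable mu : {measure set T -> \bar R}.
Variable b : basis mu.
Local Notation Q := (bset b).

Definition bvol k : R := fine (mu (Q k)).

Lemma bvolE k : mu (Q k) = (bvol k)%:E.
Proof.
have /andP[k0 koo] := basis_vol b k.
by rewrite /bvol fineK// ge0_fin_numE.
Qed.

Lemma bvol_gt0 k : (0 < bvol k)%R.
Proof. by rewrite -lte_fin -bvolE; have /andP[] := basis_vol b k. Qed.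

Lemma bratio_ge1 : (1 <= bratio b)%R.
Proof.
have [m [km _]] := basis_triple b 0.
rewrite !bvolE -EFinM lee_fin => H.
have : (bvol 0 <= bvol m)%R.
  by rewrite -lee_fin -!bvolE le_measure ?inE//; exact: basis_meas.
by move=> /le_trans/(_ H); rewrite ler_pMl// bvol_gt0.
Qed.

(** Up to constants this is the A_p condition with p = 1 + 1/e: the scale [s]
    stands for the average of the weight. Leaving it existentially quantified
    avoids every computation with (1/e)-th roots of averages. *)
Definition Acond (e C : R) (w : T -> R) : Prop :=
  [/\ measurable_fun setT w, (forall x, (0 < w x)%R) &
    forall k, exists2 s : R, (0 < s)%R &
      \int[mu]_(x in Q k) (w x)%:E <= (C * s * bvol k)%:E /\
      \int[mu]_(x in Q k) (w x `^ (- e))%:E <= (C * s `^ (- e) * bvol k)%:E].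

Variables (e C : R) (w : T -> R).
Hypotheses (e0 : (0 < e)%R) (C0 : (0 < C)%R) (Aw : Acond e C w).

Let mw : measurable_fun setT w. Proof. by case: Aw. Qed.

Let w0 x : (0 < w x)%R. Proof. by case: Aw. Qed.

Lemma Acond_vol k : 0 < \int[mu]_(x in Q k) (w x)%:E < +oo.
Proof.
case: Aw => _ _ /(_ k)[s s0 [sw _]].
rewrite (le_lt_trans sw) ?ltry// andbT.
apply: integral_gt0 => //; first exact: basis_meas.
- exact: measurableT_comp.
- by have /andP[] := basis_vol b k.
Qed.

Definition doubling_const : R :=
  (2 * (C * bratio b) * (2 * C * bratio b) `^ e^-1)%R.

Lemma doubling_const_gt0 : (0 < doubling_const)%R.
Proof.
have A0 : (0 < bratio b)%R by apply: lt_le_trans bratio_ge1.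
by rewrite /doubling_const !mulr_gt0// powR_gt0// !mulr_gt0.
Qed.

(** For l = (2CA)^(1/e), at each point one of l w / s and (l w / s)^-e is at
    least 1, whence |Q| <= l w(Q) / s + |Q| / 2. *)
Lemma Acond_doubling k (t : seq nat) :
  (forall j, j \in t -> (bsize b j <= bsize b k)%R /\ Q j `&` Q k !=set0) ->
  \int[mu]_(x in \big[setU/set0]_(j <- t) Q j) (w x)%:E <=
  doubling_const%:E * (wvol mu Q w k)%:E.
Proof.
move=> tk; have [m [km mt mA]] := basis_triple b k.
set A := bratio b in mA.
have A0 : (0 < A)%R by apply: lt_le_trans bratio_ge1.
have mwE D : measurable_fun D (fun x => (w x)%:E).
  by apply: measurable_funTS; exact: measurableT_comp.
apply: (@le_trans _ _ (\int[mu]_(x in Q m) (w x)%:E)).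
  apply: ge0_subset_integral => //.
  - by apply: bigsetU_measurable => j _; exact: basis_meas.
  - exact: basis_meas.
  - by move=> x _; rewrite lee_fin ltW.
  - by rewrite -bigcup_seq => x [j /tk[jk jQ] Qx]; exact: (mt j).
case: Aw => _ _ /(_ m)[s s0 [sw swe]].
apply: (le_trans sw); rewrite -EFinM lee_fin.
rewrite !bvolE -EFinM lee_fin in mA.
pose l := ((2 * C * A) `^ e^-1)%R.
have l0 : (0 < l)%R by rewrite powR_gt0// !mulr_gt0.
have le : (l `^ (- e) = (2 * C * A)^-1)%R.
  rewrite powRN /l -powRrM mulVf ?gt_eqF// powRr1// ltW// !mulr_gt0//.
have wk : \int[mu]_(x in Q k) (w x)%:E = (wvol mu Q w k)%:E.
  by rewrite wvolE//; exact: Acond_vol.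
have ls0 : (0 < l / s)%R by rewrite divr_gt0.
have se0 : (0 < (l / s) `^ (- e))%R by rewrite powR_gt0.
have mwe D : measurable_fun D (fun x => (w x `^ (- e))%:E).
  apply: measurable_funTS; apply: measurableT_comp => //.
  exact: measurableT_comp (measurable_powR _) _.
have : mu (Q k) <= (l / s)%:E * (wvol mu Q w k)%:E +
    ((l / s) `^ (- e))%:E * (C * s `^ (- e) * bvol m)%:E.
  rewrite -wk; apply: (@le_trans _ _ ((l / s)%:E * \int[mu]_(x in Q k) (w x)%:E +
      ((l / s) `^ (- e))%:E * \int[mu]_(x in Q k) (w x `^ (- e))%:E)); last first.
    apply: leeD => //; apply: lee_wpmul2l; first by rewrite lee_fin ltW.
    apply: le_trans swe; apply: ge0_subset_integral => //; try exact: basis_meas.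
    by move=> x _; rewrite lee_fin powR_ge0.
  rewrite -!ge0_integralZl//; try exact: basis_meas; last 4 first.
  - by move=> x _; rewrite lee_fin powR_ge0.
  - by rewrite lee_fin ltW.
  - by move=> x _; rewrite lee_fin ltW.
  - by rewrite lee_fin ltW.
  rewrite -ge0_integralD//; try exact: basis_meas; last 4 first.
  - by move=> x _; rewrite -EFinM lee_fin mulr_ge0// ltW.
  - exact: measurable_funeM.
  - by move=> x _; rewrite -EFinM lee_fin mulr_ge0// ?powR_ge0// ltW.
  - exact: measurable_funeM.
  rewrite -[mu _]mul1e -integral_cst; last exact: basis_meas.
  apply: le_integral_nng => //; first exact: basis_meas.
    by apply: emeasurable_funD; exact: measurable_funeM.
  move=> x _; rewrite -!EFinM -EFinD lee_fin -(powRM _ (ltW ls0) (ltW (w0 x))).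
  set y := (l / s * w x)%R.
  have y0 : (0 < y)%R by rewrite mulr_gt0.
  have [y1|y1] := leP 1%R y; first by rewrite (le_trans y1)// lerDl powR_ge0.
  rewrite (@le_trans _ _ (y `^ (- e))%R)//; last by rewrite lerDr ltW.
  rewrite powRN invf_ge1 ?powR_gt0//.
  have := @ge0_ler_powR R e (ltW e0) y 1%R; rewrite powR1; apply; rewrite ?nnegrE//;
    exact: ltW.
have s'0 : (0 <= s^-1)%R by rewrite invr_ge0 ltW.
rewrite bvolE -!EFinM -EFinD lee_fin (powRM _ (ltW l0) s'0) le.
have -> : (s^-1 `^ (- e) = (s `^ (- e))^-1)%R.
  by rewrite !powRN -[in LHS](powR_inv1 (ltW s0)) -powRrM mulN1r powRN.
have -> : ((2 * C * A)^-1 / s `^ (- e) * (C * s `^ (- e) * bvol m) =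
   (2 * A)^-1 * bvol m)%R.
  by field; rewrite !gt_eqF// powR_gt0.
move=> H; rewrite /doubling_const -/A -/l.
have H2 : ((2 * A)^-1 * bvol m <= bvol k / 2)%R.
  rewrite ler_pdivrMl ?mulr_gt0//.
  by have -> : (2 * A * (bvol k / 2) = A * bvol k)%R by field.
have H3 : (bvol k * s <= 2 * l * wvol mu Q w k)%R.
  have H4 : (bvol k / 2 <= l / s * wvol mu Q w k)%R by lra.
  by move: H4; rewrite mulrAC ler_pdivlMr// => H4; lra.
apply: (@le_trans _ _ (C * s * (A * bvol k))%R).
  by rewrite ler_pM2l// mulr_gt0.
have -> : (C * s * (A * bvol k) = C * A * (bvol k * s))%R by ring.
have -> : (2 * (C * A) * l * wvol mu Q w k = C * A * (2 * l * wvol mu Q w k))%R.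
  by ring.
by rewrite ler_pM2l// mulr_gt0.
Qed.

End Acond.

(** * Products with powers of A_1 weights *)

Section powR_tools.
Context {R : realType}.
Implicit Types a b t e : R.

Lemma measurable_fun_powR d (T : measurableType d) (w : T -> R) e D :
  measurable_fun setT w -> measurable_fun D (fun x => w x `^ e)%R.
Proof.
by move=> mw; apply: measurable_funTS; exact: measurableT_comp (measurable_powR _) mw.
Qed.

Lemma measurable_fun_invr d (T : measurableType d) (w : T -> R) :
  measurable_fun setT w -> (forall x, (0 < w x)%R) ->
  measurable_fun setT (fun x => (w x)^-1)%R.
Proof.
move=> mw w0; rewrite (_ : (fun x => _) = (fun x => w x `^ (- 1))%R).
  exact: measurable_fun_powR.
by apply/funext => x; rewrite powR_inv1// ltW.
Qed.

Lemma ler_powRN a b e : (0 <= e)%R -> (0 < a)%R -> (a <= b)%R ->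
  (b `^ (- e) <= a `^ (- e))%R.
Proof.
move=> e0 a0 ab; have b0 := lt_le_trans a0 ab.
rewrite !powRN lef_pV2 ?posrE ?powR_gt0//.
by apply: ge0_ler_powR; rewrite ?nnegrE//; exact: ltW.
Qed.

Lemma powR_interpolate_le a b t : (0 < a)%R -> (0 < b)%R -> (0 <= t <= 1)%R ->
  (a `^ (1 - t) * b `^ t <= a + b)%R.
Proof.
move=> a0 b0 /andP[t0 t1]; pose m := Num.max a b.
have m0 : (0 < m)%R by rewrite lt_max a0.
apply: (@le_trans _ _ (m `^ (1 - t) * m `^ t)%R).
  apply: ler_pM; rewrite ?powR_ge0//; apply: ge0_ler_powR;
    rewrite ?nnegrE ?subr_ge0 ?(ltW m0) ?(ltW a0) ?(ltW b0)//.
    by rewrite /m le_max lexx.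
  by rewrite /m le_max lexx orbT.
rewrite -powRD; last by rewrite (gt_eqF m0) implybT.
rewrite subrK (powRr1 (ltW m0)) /m ge_max; apply/andP; split.
  by rewrite lerDl ltW.
by rewrite lerDr ltW.
Qed.

End powR_tools.

Section Acond_stable.
Context d (T : measurableType d) (R : realType).
Variable mu : {measure set T -> \bar R}.
Variable b : basis mu.
Local Notation Q := (bset b).
Variables (e C c : R) (w h : T -> R).
Hypotheses (e0 : (0 < e)%R) (C0 : (0 < C)%R) (c0 : (0 < c)%R).
Hypothesis Aw : Acond b e C w.

(** The A_1 condition for [h] relative to the measure with density [w]. *)
Definition A1_rel : Prop :=
  [/\ measurable_fun setT h, (forall x, (0 < h x)%R) &
  forall k, {ae mu, forall x, Q k x ->
    wavg mu Q w (EFin \o h) k <= (c * h x)%:E}].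

Hypothesis Ah : A1_rel.

Let mw : measurable_fun setT w. Proof. by case: Aw. Qed.
Let w0 x : (0 < w x)%R. Proof. by case: Aw. Qed.
Let mh : measurable_fun setT h. Proof. by case: Ah. Qed.
Let h0 x : (0 < h x)%R. Proof. by case: Ah. Qed.
Let mQ k : measurable (Q k). Proof. exact: basis_meas. Qed.

Let vQ k : wvol mu Q w k = fine (\int[mu]_(x in Q k) (w x)%:E).
Proof. by []. Qed.

(** The w-average y of h over a cube is finite because it is bounded by c h at
    some point, and y / c is a lower bound of h on the cube. *)
Lemma A1_rel_avg k : exists2 y : R, (0 < y)%R &
  \int[mu]_(x in Q k) (h x * w x)%:E = (y * wvol mu Q w k)%:E /\
  {ae mu, forall x, Q k x -> (y / c <= h x)%R}.
Proof.
have vk0 : (0 < wvol mu Q w k)%R by apply: wvol_gt0 => j; exact: Acond_vol Aw _.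
case: Ah => _ _ /(_ k) Ak.
have muk : 0 < mu (Q k) by have /andP[] := basis_vol b k.
have [x Qx] := ae_gt0_meet (mQ k) muk Ak.
move=> /(_ Qx) ax.
set Y := wavg mu Q w (EFin \o h) k in Ak ax.
have Ioo : 0 < \int[mu]_(x in Q k) (h x * w x)%:E.
  apply: integral_gt0 => //; first by apply: measurableT_comp => //; exact: measurable_funM.
  by move=> z; rewrite lte_fin mulr_gt0.
have YE : Y = (wvol mu Q w k)^-1%:E * \int[mu]_(x in Q k) (h x * w x)%:E.
  by [].
have Y0 : 0 < Y by rewrite YE mule_gt0// lte_fin invr_gt0.
have Yfin : Y \is a fin_num.
  by rewrite ge0_fin_numE ?ltW// (le_lt_trans ax)// ltry.
exists (fine Y); first by rewrite -lte_fin fineK.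
split; last first.
  apply: filterS Ak => z H /H; rewrite -(fineK Yfin) lee_fin => H'.
  by rewrite ler_pdivrMr// mulrC.
rewrite EFinM fineK// YE muleC muleA -EFinM divff ?mul1e// gt_eqF//.
Qed.

(** With the scale y s, where y is the w-average of h: the integral of h w is
    that of w times y by definition of y, and h >= y / c bounds the negative
    power. *)
Lemma Acond_mul : Acond b e (C * (1 + c `^ e)) (fun x => h x * w x)%R.
Proof.
split; [exact: measurable_funM|by move=> x; rewrite mulr_gt0|move=> k].
have [y y0 [hw hy]] := A1_rel_avg k.
have [_ _ /(_ k)[s s0 [sw swe]]] := Aw.
have ce0 : (0 < c `^ e)%R by rewrite powR_gt0.
have CC : (C <= C * (1 + c `^ e))%R by rewrite ler_peMr ?ltW// ltrDl.
have vk := wvolE (Acond_vol Aw) k.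
exists (y * s)%R; first by rewrite mulr_gt0.
split.
  rewrite hw lee_fin; rewrite vk lee_fin in sw.
  apply: (@le_trans _ _ (y * (C * s * bvol b k))%R); first by rewrite ler_pM2l.
  have -> : (y * (C * s * bvol b k) = C * (y * s * bvol b k))%R by ring.
  by rewrite -[leRHS]mulrA ler_wpM2r// !mulr_ge0 ?ltW// bvol_gt0.
apply: (@le_trans _ _ (\int[mu]_(x in Q k)
   (((y / c) `^ (- e))%:E * (w x `^ (- e))%:E))).
  apply: ae_ge0_le_integral => //.
  - by move=> x _; rewrite lee_fin powR_ge0.
  - by apply: measurableT_comp => //; apply: measurable_fun_powR; exact: measurable_funM.
  - by move=> x _; rewrite -EFinM lee_fin mulr_ge0// powR_ge0.
  - by apply: measurable_funeM; apply: measurableT_comp => //; exact: measurable_fun_powR.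
  apply: filterS hy => x H /H hx; rewrite -EFinM lee_fin (powRM _ (ltW (h0 x)) (ltW (w0 x))).
  by rewrite ler_wpM2r ?powR_ge0// ler_powRN ?(ltW e0) ?divr_gt0.
rewrite ge0_integralZl//; last 3 first.
- by apply: measurableT_comp => //; exact: measurable_fun_powR.
- by move=> x _; rewrite lee_fin powR_ge0.
- by rewrite lee_fin powR_ge0.
apply: (@le_trans _ _ (((y / c) `^ (- e))%:E * (C * s `^ (- e) * bvol b k)%:E)).
  by apply: lee_wpmul2l => //; rewrite lee_fin powR_ge0.
rewrite -EFinM lee_fin powRM ?invr_ge0 ?(ltW y0) ?(ltW c0)//.
rewrite [((y * s) `^ _)%R]powRM ?(ltW y0) ?(ltW s0)//.
have -> : (c^-1 `^ (- e) = c `^ e)%R.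
  by rewrite -(powR_inv1 (ltW c0)) -powRrM mulN1r opprK.
have -> : (y `^ (- e) * c `^ e * (C * s `^ (- e) * bvol b k) =
    C * c `^ e * (y `^ (- e) * s `^ (- e) * bvol b k))%R by ring.
rewrite -[leRHS]mulrA ler_wpM2r ?mulr_ge0 ?powR_ge0 ?(ltW (bvol_gt0 _ _))//.
by rewrite ler_wpM2l ?(ltW C0)// lerDr.
Qed.

Variable K : R.
Hypothesis K0 : (0 <= K)%R.

Definition Adiv_exp : R := (e / (1 + (e + 1) * K))%R.

Let den0 : (0 < 1 + (e + 1) * K)%R.
Proof. by rewrite ltr_pwDl// mulr_ge0// addr_ge0// ltW. Qed.

Lemma Adiv_exp_gt0 : (0 < Adiv_exp)%R.
Proof. by rewrite divr_gt0. Qed.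

(** With t = K e' and X = w / s, Y = h / y, the choice of e' makes
    X^-e' Y^t = (X^-e)^(1-t) (X Y)^t, and the integral of X Y over a cube is
    that of X because y is the w-average of h. *)
Lemma Acond_div : Acond b Adiv_exp (C * (2 + c `^ K)) (fun x => h x `^ (- K) * w x)%R.
Proof.
set e' := Adiv_exp.
have e'0 : (0 < e')%R := Adiv_exp_gt0.
split; first by apply: measurable_funM => //; exact: measurable_fun_powR.
  by move=> x; rewrite mulr_gt0// powR_gt0.
move=> k.
have [y y0 [hw hy]] := A1_rel_avg k.
have [_ _ /(_ k)[s s0 [sw swe]]] := Aw.
have cK0 : (0 < c `^ K)%R by rewrite powR_gt0.
have bk0 := bvol_gt0 b k.
have vk := wvolE (Acond_vol Aw) k.
exists (s * y `^ (- K))%R; first by rewrite mulr_gt0// powR_gt0.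
split.
  apply: (@le_trans _ _ (\int[mu]_(x in Q k) (((y / c) `^ (- K))%:E * (w x)%:E))).
    apply: ae_ge0_le_integral => //.
    - by move=> x _; rewrite lee_fin mulr_ge0 ?powR_ge0// ltW.
    - apply: measurableT_comp => //; apply: measurable_funM; last exact: measurable_funTS.
      exact: measurable_fun_powR.
    - by move=> x _; rewrite -EFinM lee_fin mulr_ge0 ?powR_ge0// ltW.
    - by apply: measurable_funeM; apply: measurable_funTS; exact: measurableT_comp.
    apply: filterS hy => x H /H hx; rewrite -EFinM lee_fin ler_wpM2r ?(ltW (w0 x))//.
    by rewrite ler_powRN// divr_gt0.
  rewrite ge0_integralZl//; last 3 first.
  - by apply: measurable_funTS; exact: measurableT_comp.
  - by move=> x _; rewrite lee_fin ltW.
  - by rewrite lee_fin powR_ge0.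
  apply: (@le_trans _ _ (((y / c) `^ (- K))%:E * (C * s * bvol b k)%:E)).
    by apply: lee_wpmul2l => //; rewrite lee_fin powR_ge0.
  rewrite -EFinM lee_fin powRM ?invr_ge0 ?(ltW y0) ?(ltW c0)//.
  have -> : (c^-1 `^ (- K) = c `^ K)%R.
    by rewrite -(powR_inv1 (ltW c0)) -powRrM mulN1r opprK.
  have -> : (y `^ (- K) * c `^ K * (C * s * bvol b k) =
    C * c `^ K * (s * y `^ (- K) * bvol b k))%R by ring.
  rewrite -[leRHS]mulrA ler_wpM2r ?mulr_ge0 ?powR_ge0 ?(ltW bk0) ?(ltW s0)//.
  by rewrite ler_wpM2l ?(ltW C0)// lerDr.
pose t := (K * e')%R.
have t01 : (0 <= t <= 1)%R.
  rewrite mulr_ge0 ?(ltW e'0)//= /t /e' /Adiv_exp mulrA ler_pdivrMr// mul1r.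
  by rewrite mulrDl mul1r [(e * K)%R]mulrC addrCA lerDl addr_ge0.
have expE : (- e * (1 - t) + t = - e')%R.
  by rewrite /t /e' /Adiv_exp; field; rewrite gt_eqF.
have key x : ((h x `^ (- K) * w x) `^ (- e') <= (s * y `^ (- K)) `^ (- e') *
    ((s `^ e) * w x `^ (- e) + (s * y)^-1 * (h x * w x)))%R.
  pose X := (w x / s)%R; pose Y := (h x / y)%R.
  have X0 : (0 < X)%R by rewrite divr_gt0.
  have Y0 : (0 < Y)%R by rewrite divr_gt0.
  have -> : ((h x `^ (- K) * w x) = (s * y `^ (- K)) * (X * Y `^ (- K)))%R.
    rewrite /X /Y powRM ?invr_ge0 ?(ltW y0) ?(ltW (h0 x))//.
    have -> : (y^-1 `^ (- K) = (y `^ (- K))^-1)%R.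
      by rewrite -(powR_inv1 (ltW y0)) -!powRrM mulN1r powRN invrK opprK.
    by field; rewrite !gt_eqF// powR_gt0.
  have sy : (0 <= s * y `^ (- K))%R by rewrite mulr_ge0 ?powR_ge0 ?(ltW s0).
  have XY : (0 <= X * Y `^ (- K))%R by exact: mulr_ge0 (ltW X0) (powR_ge0 _ _).
  rewrite (powRM _ sy XY).
  rewrite ler_wpM2l ?powR_ge0//.
  have -> : (s `^ e * w x `^ (- e) = X `^ (- e))%R.
    rewrite /X powRM ?invr_ge0 ?(ltW s0) ?(ltW (w0 x))//.
    by rewrite -(powR_inv1 (ltW s0)) -powRrM mulN1r opprK mulrC.
  have -> : ((s * y)^-1 * (h x * w x) = X * Y)%R.
    by rewrite /X /Y; field; rewrite !gt_eqF.
  have -> : ((X * Y `^ (- K)) `^ (- e') =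
      (X `^ (- e)) `^ (1 - t) * (X * Y) `^ t)%R.
    rewrite powRM ?powR_ge0 ?(ltW X0)// powRM ?(ltW X0) ?(ltW Y0)//.
    rewrite mulrA -!powRrM -powRD; last by rewrite (gt_eqF X0) implybT.
    by rewrite expE mulrNN.
  by apply: powR_interpolate_le => //; [exact: powR_gt0|exact: mulr_gt0].
pose S := ((s * y `^ (- K)) `^ (- e'))%R.
have S0 : (0 < S)%R by rewrite powR_gt0// mulr_gt0// powR_gt0.
have mwe : measurable_fun (Q k) (fun x => (s `^ e)%:E * (w x `^ (- e))%:E).
  by apply: measurable_funeM; apply: measurableT_comp => //; exact: measurable_fun_powR.
have mhw : measurable_fun (Q k) (fun x => ((s * y)^-1)%:E * (h x * w x)%:E).
  apply: measurable_funeM; apply: measurable_funTS; apply: measurableT_comp => //.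
  exact: measurable_funM.
have sy0 : (0 <= (s * y)^-1)%R by rewrite invr_ge0 mulr_ge0// ltW.
apply: (@le_trans _ _ (\int[mu]_(x in Q k) (S%:E * ((s `^ e)%:E * (w x `^ (- e))%:E +
    ((s * y)^-1)%:E * (h x * w x)%:E)))).
  apply: le_integral_nng => //.
  - apply: measurableT_comp => //; apply: measurable_fun_powR.
    by apply: measurable_funM => //; exact: measurable_fun_powR.
  - by apply: measurable_funeM; exact: emeasurable_funD.
  - by move=> x _; rewrite lee_fin powR_ge0.
  - by move=> x _; have := key x; rewrite -lee_fin.
have we0 x : 0 <= (s `^ e)%:E * (w x `^ (- e))%:E.
  by rewrite -EFinM lee_fin mulr_ge0// powR_ge0.
have hw0 x : 0 <= ((s * y)^-1)%:E * (h x * w x)%:E.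
  by rewrite -EFinM lee_fin !mulr_ge0// ltW.
rewrite ge0_integralZl//; last 3 first.
- exact: emeasurable_funD.
- by move=> x _; exact: adde_ge0.
- by rewrite lee_fin ltW.
rewrite ge0_integralD// ge0_integralZl//; last 3 first.
- by apply: measurableT_comp => //; exact: measurable_fun_powR.
- by move=> x _; rewrite lee_fin powR_ge0.
- by rewrite lee_fin powR_ge0.
rewrite ge0_integralZl//; last 2 first.
- apply: measurable_funTS; apply: measurableT_comp => //; exact: measurable_funM.
- by move=> x _; rewrite lee_fin mulr_ge0// ltW.
rewrite vk lee_fin in sw.
apply: (@le_trans _ _ (S%:E * ((s `^ e)%:E * (C * s `^ (- e) * bvol b k)%:E +
    ((s * y)^-1)%:E * (y * wvol mu Q w k)%:E))).
  apply: lee_wpmul2l; first by rewrite lee_fin ltW.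
  rewrite hw; apply: leeD => //; apply: lee_wpmul2l => //.
  by rewrite lee_fin powR_ge0.
rewrite -!EFinM lee_fin -/S.
have -> : (s `^ e * (C * s `^ (- e) * bvol b k) = C * bvol b k)%R.
  by rewrite powRN; field; rewrite gt_eqF// powR_gt0.
have H : ((s * y)^-1 * (y * wvol mu Q w k) <= C * bvol b k)%R.
  have -> : ((s * y)^-1 * (y * wvol mu Q w k) = wvol mu Q w k / s)%R.
    by field; rewrite !gt_eqF.
  by rewrite ler_pdivrMr// mulrAC.
apply: (@le_trans _ _ (S * (C * bvol b k + C * bvol b k))%R).
  by rewrite ler_pM2l// lerD2l.
have -> : (C * (2 + c `^ K) * S * bvol b k =
  S * (C * bvol b k + C * bvol b k) + C * c `^ K * S * bvol b k)%R by ring.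
by rewrite lerDl !mulr_ge0// ltW.
Qed.

End Acond_stable.

(** * Changing the exponent *)

Section extrapolation.
Context d (T : measurableType d) (R : realType).
Variable mu : {measure set T -> \bar R}.
Variable b : basis mu.
Local Notation Q := (bset b).

(** Since the basis is directed, every point lies in a set of the basis on which
    f has positive integral. *)
Lemma wmax_gt0 (w : T -> R) (f : T -> \bar R) : measurable_fun setT w ->
  (forall x, (0 < w x)%R) -> (forall k, 0 < \int[mu]_(x in Q k) (w x)%:E < +oo) ->
  measurable_fun setT f -> (forall x, 0 <= f x) -> ~ {ae mu, forall x, f x = 0} ->
  forall x, 0 < wmax mu Q w f x.
Proof.
move=> mw w0 wQ mf f0 fn0 x.
have mQ k : measurable (Q k) by exact: basis_meas.
have fw0 x' : 0 <= f x' * (w x')%:E by rewrite mule_ge0// lee_fin ltW.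
have mfw D : measurable_fun D (fun x => f x * (w x)%:E) by exact: measurable_mulw.
have [k fk] : exists k, 0 < \int[mu]_(x in Q k) (f x * (w x)%:E).
  apply/not_existsP => H; apply: fn0.
  have : {ae mu, forall x, forall k, Q k x -> f x * (w x)%:E = 0}.
    apply/ae_foralln => k.
    have Ik : \int[mu]_(x in Q k) `|f x * (w x)%:E| = 0.
      under eq_integral do rewrite gee0_abs//.
      apply/eqP; rewrite eq_le integral_ge0// andbT leNgt; apply/negP; exact: H.
    exact: (ae_eq_integral_abs mu (mQ k) (mfw _)).1 Ik.
  apply: filterS => y H'; have [k /H'/eqP] := basis_cover b y.
  by rewrite mule_eq0 [(w y)%:E == 0]gt_eqF ?lte_fin// orbF => /eqP.
have [j Qj] := basis_cover b x.
have [m jkm] := basis_join b j k.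
apply: (@lt_le_trans _ _ (wavg mu Q w f m)); last by apply: wmax_ge; apply: jkm; left.
rewrite mule_gt0 ?lte_fin ?invr_gt0//; first exact: wvol_gt0 wQ _.
apply: (lt_le_trans fk); apply: ge0_subset_integral => //.
by move=> y Qy; apply: jkm; right.
Qed.

Section A1_majorant.
Variables (e C : R) (w : T -> R).
Hypotheses (e0 : (0 < e)%R) (C0 : (0 < C)%R) (Aw : Acond b e C w).

(** An iteration constant for which [wmajorant_square] bounds the majorant. *)
Definition majorant_const (e C : R) : R := (1 + 128 * doubling_const b e C)%R.

Lemma majorant_const_gt0 : (0 < majorant_const e C)%R.
Proof. by rewrite addr_gt0// mulr_gt0// doubling_const_gt0. Qed.

Let c := majorant_const e C.
Let mw : measurable_fun setT w. Proof. by case: Aw. Qed.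
Let w0 x : (0 < w x)%R. Proof. by case: Aw. Qed.
Let mQ k : measurable (Q k). Proof. exact: basis_meas. Qed.

Lemma A1_rel_cst1 : A1_rel b c w (fun=> 1%R).
Proof.
split=> // k; apply: aeW => x _; rewrite /wavg.
under eq_integral do rewrite /= mul1e.
rewrite (wvolE (Acond_vol Aw)) -EFinM lee_fin mulVf ?gt_eqF//; last first.
  exact: wvol_gt0 (Acond_vol Aw) _.
by rewrite mulr1 lerDl mulr_ge0// ltW// doubling_const_gt0.
Qed.

(** The majorant of a square integrable function is finite almost everywhere,
    positive everywhere, and satisfies the A_1 condition relative to w with a
    constant that depends on the A_p data of w alone. *)
Lemma A1_majorant (f : T -> \bar R) : measurable_fun setT f ->
  (forall x, 0 <= f x) -> 0 < \int[mu]_x (f x * f x * (w x)%:E) < +oo ->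
  exists h : T -> R, [/\ A1_rel b c w h,
    {ae mu, forall x, f x <= (h x)%:E} &
    \int[mu]_x (h x * h x * w x)%:E <= 4%:E * \int[mu]_x (f x * f x * (w x)%:E)].
Proof.
move=> mf f0 /andP[I0 Ioo].
have wQ := Acond_vol Aw.
have c0 : (0 < c)%R := majorant_const_gt0.
have it := wmax_iterable mQ mw w0 wQ.
have D0 := doubling_const_gt0 b e C0.
pose gam := majorant (wmax mu Q w) c f.
have mg : measurable_fun setT gam := measurable_majorant it c0 mf f0.
have g0 x : 0 <= gam x := majorant_ge0 _ _ f0 x.
have sq := wmajorant_square mQ mw w0 wQ D0 (Acond_doubling e0 C0 Aw) mf f0.
have mgg : measurable_fun setT (fun x => gam x * gam x * (w x)%:E).
  by apply: measurable_mulw => //; exact: emeasurable_funM.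
have wE0 x : 0 <= (w x)%:E by rewrite lee_fin ltW.
have goo : {ae mu, forall x, gam x < +oo}.
  have : {ae mu, forall x, gam x * gam x * (w x)%:E < +oo}.
    apply: ae_lty_integral => //; first by move=> x; rewrite !mule_ge0.
    by apply: (le_lt_trans sq); rewrite lte_mul_pinfty// lee_fin.
  apply: filterS => x; rewrite !ltey; apply: contraNneq => ->.
  by rewrite mulyy gt0_mulye ?lte_fin.
have g_gt0 x : 0 < gam x.
  have fn0 : ~ {ae mu, forall x, f x = 0}.
    move=> fae; move: I0; rewrite ae_eq0_integral ?ltxx//.
    - by apply: measurable_mulw => //; exact: emeasurable_funM.
    - by move=> y; rewrite !mule_ge0.
    - by apply: (filterS _ fae) => y ->; rewrite !mul0e.
  apply: (lt_le_trans _ (le_sup_range _ 1%N)) => /=.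
  apply: (@lt_le_trans _ _ (c^-1%:E * wmax mu Q w f x)); last by rewrite leeDr.
  by rewrite mule_gt0 ?lte_fin ?invr_gt0//; exact: (wmax_gt0 mw w0 wQ).
pose h := posfin gam.
have hE : {ae mu, forall x, (h x)%:E = gam x}.
  by apply: filterS goo => x gx; apply: posfinE; rewrite g_gt0.
have mh : measurable_fun setT h := measurable_posfin mg.
have h0 x : (0 < h x)%R := posfin_gt0 gam x.
exists h; split.
- split=> // k; apply: (filterS _ hE) => x hx Qx.
  rewrite EFinM hx; apply: le_trans (iter_majorant_le it c0 mf f0 x).
  apply: (le_trans _ (@wmax_ge _ _ _ mu Q w gam k x Qx)); rewrite /wavg.
  apply: lee_wpmul2l; first by rewrite lee_fin invr_ge0 ltW// (wvol_gt0 wQ).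
  apply: ae_ge0_le_integral => //.
  + by move=> y _; rewrite -EFinM lee_fin mulr_ge0// ltW.
  + by apply: measurable_mulw => //; exact: measurableT_comp.
  + by move=> y _; exact: mule_ge0.
  + exact: measurable_mulw.
  + by apply: (filterS _ hE) => y hy _ /=; rewrite hy.
- by apply: (filterS _ hE) => x ->; exact: le_majorant.
- apply: le_trans sq; apply: ae_ge0_le_integral => //.
  + by move=> x _; rewrite lee_fin !mulr_ge0// ltW.
  + apply: measurableT_comp => //; apply: measurable_funM => //.
    exact: measurable_funM.
  + by move=> x _; rewrite !mule_ge0.
  + by apply: (filterS _ hE) => x hx _; rewrite !EFinM hx.
Qed.

End A1_majorant.

(** The exponent can be doubled: the square of f is f times the weight f, and a
    truncation of f is dominated by a majorant h for which h w is again an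
    A_infty weight. The term in h is absorbed since its square integral is
    controlled by that of the truncation. *)
Lemma extrapolate_square (f g : T -> \bar R) (e C B : R) (w : T -> R) :
  measurable_fun setT f -> measurable_fun setT g ->
  (forall x, 0 <= f x) -> (forall x, 0 <= g x) ->
  (0 < e)%R -> (0 < C)%R -> (0 < B)%R ->
  (forall W, Acond b e (C * (1 + majorant_const e C `^ e)) W ->
    \int[mu]_x (f x * (W x)%:E) <= B%:E * \int[mu]_x (g x * (W x)%:E)) ->
  Acond b e C w ->
  \int[mu]_x (f x * f x * (w x)%:E) <=
  (4 * B ^+ 2)%:E * \int[mu]_x (g x * g x * (w x)%:E).
Proof.
move=> mf mg f0 g0 e0 C0 B0 H Aw.
have [mw w0 _] := Aw.
have wE0 x : 0 <= (w x)%:E by rewrite lee_fin ltW.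
have mwE D : measurable_fun D (fun x => (w x)%:E).
  by apply: measurable_funTS; exact: measurableT_comp.
pose A N := \big[setU/set0]_(k <- iota 0 N) Q k.
have mA N : measurable (A N) by apply: bigsetU_measurable => k _; exact: basis_meas.
have AP x k N : Q k x -> (k < N)%N -> A N x.
  by move=> Qx kN; rewrite /A -bigcup_seq; exists k => //=; rewrite mem_iota.
have A_sub M N x : (M <= N)%N -> A M x -> A N x.
  move=> MN; rewrite /A -!bigcup_seq => -[k /=]; rewrite mem_iota add0n => /andP[_ kM] Qx.
  by exists k => //=; rewrite mem_iota add0n (leq_trans kM).
have Awoo N : \int[mu]_(x in A N) (w x)%:E < +oo.
  elim: N => [|N IH]; first by rewrite /A big_nil integral_set0.
  rewrite /A -addn1 iotaD big_cat/= add0n big_seq1.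
  apply: (le_lt_trans (ge0_integral_setU_le mu (mA N) (basis_meas b N) (mwE _) wE0)).
  by rewrite lte_add_pinfty//; have /andP[] := Acond_vol Aw N.
(* truncation makes the square integral finite, which the absorption needs *)
pose F (N : nat) (x : T) : \bar R := if x \in A N then mine (f x) N%:R%:E else 0.
have F0 N x : 0 <= F N x.
  by rewrite /F; case: ifP => // _; rewrite le_min f0 lee_fin ler0n.
have Ff N x : F N x <= f x.
  by rewrite /F; case: ifP => // _; rewrite ge_min lexx.
have mF N : measurable_fun setT (F N).
  rewrite (_ : F N = (fun x => mine (f x) N%:R%:E) \_ (A N)); last first.
    by apply/funext => x; rewrite patchE.
  apply/(measurable_restrictT _ _).1 => //; apply: measurable_funTS.
  by apply: measurable_mine.
have ndF x : nondecreasing_seq (F ^~ x).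
  move=> M N MN; rewrite /F; case: ifPn => [xM|_]; last exact: F0.
  rewrite mem_set; last by apply: (A_sub M) => //; rewrite inE in xM.
  by rewrite le_min !ge_min lexx/= lee_fin ler_nat MN orbT.
have mFF N : measurable_fun setT (fun x => F N x * F N x * (w x)%:E).
  by apply: measurable_mulw => //; exact: emeasurable_funM.
have FF0 N x : 0 <= F N x * F N x * (w x)%:E by rewrite !mule_ge0.
have mgg : measurable_fun setT (fun x => g x * g x * (w x)%:E).
  by apply: measurable_mulw => //; exact: emeasurable_funM.
have gg0 x : 0 <= g x * g x * (w x)%:E by rewrite !mule_ge0.
have supF x : ereal_sup (range (F ^~ x)) = f x.
  apply/eqP; rewrite eq_le; apply/andP; split; first exact: sup_range_le.
  have [k Qx] := basis_cover b x.
  have FE N : (k < N)%N -> F N x = mine (f x) N%:R%:E.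
    by move=> kN; rewrite /F mem_set//; exact: (AP x k).
  have [fx|] := eqVneq (f x) +oo.
    rewrite fx leye_eq; apply/eqP/eqyP => a a0.
    pose N := maxn k.+1 (Num.truncn a).+1.
    apply: (le_trans _ (le_sup_range _ N)).
    rewrite FE ?leq_max ?ltnSn// fx minye lee_fin.
    apply: (@le_trans _ _ (Num.truncn a).+1%:R); first exact/ltW/truncnS_gt.
    by rewrite ler_nat leq_max leqnn orbT.
  rewrite -ltey => fx.
  pose N := maxn k.+1 (Num.truncn (fine (f x))).+1.
  apply: (le_trans _ (le_sup_range _ N)).
  rewrite FE ?leq_max ?ltnSn// le_min lexx/=.
  rewrite -(@fineK _ (f x)) ?ge0_fin_numE// lee_fin.
  apply: (@le_trans _ _ (Num.truncn (fine (f x))).+1%:R).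
    exact/ltW/truncnS_gt.
  by rewrite ler_nat leq_max leqnn orbT.
suff step N : \int[mu]_x (F N x * F N x * (w x)%:E) <=
    (4 * B ^+ 2)%:E * \int[mu]_x (g x * g x * (w x)%:E).
  rewrite (_ : (fun x => _) =
      fun x => ereal_sup (range (fun N => F N x * F N x * (w x)%:E))).
    rewrite integral_sup_range//; first exact: sup_range_le.
    by move=> x m n mn; apply: lee_wpmul2r => //; apply: lee_pmul => //; exact: ndF.
  by apply/funext => x; rewrite sup_range_pZr// sup_range_square// supF.
set I := \int[mu]_x (F N x * F N x * (w x)%:E).
set J := \int[mu]_x (g x * g x * (w x)%:E).
have I0 : 0 <= I by exact: integral_ge0.
have J0 : 0 <= J by exact: integral_ge0.
have Ioo : I < +oo.
  apply: (@le_lt_trans _ _ (\int[mu]_(x in A N) ((N%:R * N%:R)%:E * (w x)%:E))).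
    rewrite [leRHS]integral_mkcond; apply: le_integral_nng => //.
      apply/(measurable_restrictT _ _).1 => //; exact: measurable_funeM.
    move=> x _; rewrite patchE /F; case: ifPn => xA; last by rewrite !mul0e.
    apply: lee_wpmul2r => //; rewrite EFinM.
    by apply: lee_pmul; rewrite ?ge_min ?lexx ?orbT// le_min f0 lee_fin ler0n.
  rewrite ge0_integralZl//.
  by rewrite lte_mul_pinfty// lee_fin mulr_ge0.
have [I_gt0|] := ltP 0 I; last first.
  move=> /le_trans; apply; apply: mule_ge0 => //.
  by rewrite lee_fin mulr_ge0// sqr_ge0.
have I0oo : 0 < I < +oo by rewrite I_gt0.
have [h [Ah Fh hI]] := A1_majorant e0 C0 Aw (mF N) (F0 N) I0oo.
have [mh h0 _] := Ah.
have AW := Acond_mul e0 C0 (majorant_const_gt0 e C0) Aw Ah.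
have hE0 x : 0 <= (h x)%:E by rewrite lee_fin ltW.
have mhE : measurable_fun setT (fun x => (h x)%:E) by exact: measurableT_comp.
have mhw : measurable_fun setT (fun x => (h x * h x * w x)%:E).
  by apply: measurableT_comp => //; apply: measurable_funM => //; exact: measurable_funM.
have hhw0 x : 0 <= (h x * h x * w x)%:E by rewrite lee_fin !mulr_ge0// ltW.
(* int f h w <= B int g h w, and B g h <= 2 B^2 g^2 + h^2 / 8 where the
   square integral of h is at most 4 I *)
have IJ : I <= (2 * B ^+ 2)%:E * J + (2^-1)%:E * I.
  apply: (@le_trans _ _ (\int[mu]_x (f x * (h x * w x)%:E))).
    apply: ae_ge0_le_integral => //.
    - by move=> x _; rewrite mule_ge0// EFinM mule_ge0.
    - by apply: emeasurable_funM => //; apply: measurableT_comp => //; exact: measurable_funM.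
    - apply: filterS Fh => x Fhx _; rewrite EFinM muleA.
      by apply: lee_wpmul2r => //; apply: lee_pmul.
  apply: (le_trans (H _ AW)).
  have mghw : measurable_fun setT (fun x => g x * (h x * w x)%:E).
    by apply: emeasurable_funM => //; apply: measurableT_comp => //; exact: measurable_funM.
  have ghw0 x : 0 <= g x * (h x * w x)%:E by rewrite mule_ge0// EFinM mule_ge0.
  rewrite -ge0_integralZl//; last by rewrite lee_fin ltW.
  apply: (@le_trans _ _ (\int[mu]_x ((2 * B ^+ 2)%:E * (g x * g x * (w x)%:E) +
      (8^-1)%:E * (h x * h x * w x)%:E))).
    apply: le_integral_nng => //.
    - exact: measurable_funeM.
    - by apply: emeasurable_funD; exact: measurable_funeM.
    - by move=> x _; rewrite mule_ge0// lee_fin ltW.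
    move=> x _; have [gx|] := eqVneq (g x) +oo.
      rewrite [leRHS](_ : _ = +oo) ?leey// gx mulyy gt0_mulye ?lte_fin//.
      by rewrite gt0_muley ?lte_fin ?mulr_gt0 ?exprn_gt0// addye.
    rewrite -ltey => gx; rewrite -(@fineK _ (g x)) ?ge0_fin_numE//.
    set a := fine (g x); rewrite -!EFinM -EFinD lee_fin.
    have : (0 <= (B * a - h x / 4) ^+ 2)%R by exact: sqr_ge0.
    have := w0 x; move=> wx sq; rewrite -subr_ge0.
    have -> : (2 * B ^+ 2 * (a * a * w x) + 8^-1 * (h x * h x * w x) -
        B * (a * (h x * w x)) = 2 * (B * a - h x / 4) ^+ 2 * w x)%R by field.
    by apply: mulr_ge0; [exact: mulr_ge0|exact: ltW].
  rewrite ge0_integralD//; last 4 first.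
  - by move=> x _; rewrite mule_ge0// lee_fin mulr_ge0// sqr_ge0.
  - exact: measurable_funeM.
  - by move=> x _; rewrite mule_ge0// lee_fin.
  - exact: measurable_funeM.
  rewrite !ge0_integralZl//; last by rewrite lee_fin mulr_ge0// sqr_ge0.
  rewrite leeD2l//.
  apply: (@le_trans _ _ ((8^-1)%:E * (4%:E * I))); first exact: lee_wpmul2l.
  by rewrite muleA -EFinM le_eqVlt; apply/orP; left; apply/eqP; congr (_%:E * _); field.
have [->|Joo] := eqVneq J +oo.
  by rewrite gt0_muley ?leey// lte_fin mulr_gt0// exprn_gt0.
have Jfin : J \is a fin_num by rewrite ge0_fin_numE// ltey.
have Ifin : I \is a fin_num by rewrite ge0_fin_numE.
move: IJ; rewrite -(fineK Jfin) -(fineK Ifin) -!EFinM -EFinD !lee_fin => IJ.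
lra.
Qed.

Lemma poweR_mul_self (x : \bar R) (p : R) : (0 < p)%R -> 0 <= x ->
  x `^ p * x `^ p = x `^ (2 * p).
Proof.
move=> p0; move: x => [x| |]// x0.
  rewrite !poweR_EFin -EFinM mulr2n mulrDl !mul1r powRD//.
  by rewrite gt_eqF// addr_gt0.
by rewrite !poweRyr ?gt_eqF ?mulr_gt0// mulyy.
Qed.

Lemma measurable_fun_poweR (f : T -> \bar R) (p : R) D :
  measurable_fun setT f -> measurable_fun D (fun x => f x `^ p).
Proof.
by move=> mf; apply: measurable_funTS; exact: measurableT_comp (measurable_poweR _) mf.
Qed.

(** The term h^2 takes over where a is small compared with h^(2/r). *)
Lemma poweR_split_le (a : \bar R) (h r P : R) : 0 <= a -> (0 < h)%R ->
  (0 < r)%R -> (r < P)%R ->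
  a `^ r <= a `^ P * (h `^ (- (2 * (P - r) / r)))%:E + (h * h)%:E.
Proof.
move=> a0 h0 r0 rP; have P0 := lt_trans r0 rP.
move: a a0 => [a| |]// a0; last first.
  rewrite !poweRyr ?gt_eqF// gt0_mulye ?lte_fin ?powR_gt0// addye//.
rewrite lee_fin in a0; rewrite !poweR_EFin -EFinM -EFinD lee_fin.
pose z := (a * h `^ (- (2 / r)))%R.
have z0 : (0 <= z)%R by rewrite mulr_ge0// powR_ge0.
have hK : (h `^ (- (2 * (P - r) / r)) = h * h * h `^ (- (2 / r) * P))%R.
  have -> : (h * h = h `^ (2%:R))%R by rewrite powR_mulrn ?expr2// ltW.
  rewrite -powRD; last by rewrite (gt_eqF h0) implybT.
  by congr (_ `^ _)%R; field; rewrite gt_eqF.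
have hr : (h * h * h `^ (- (2 / r) * r) = 1)%R.
  have -> : (h * h = h `^ (2%:R))%R by rewrite powR_mulrn ?expr2// ltW.
  rewrite -powRD; last by rewrite (gt_eqF h0) implybT.
  by rewrite mulNr divfK ?gt_eqF// subrr powRr0.
have -> : (a `^ r = h * h * z `^ r)%R.
  rewrite /z powRM ?powR_ge0// -powRrM.
  by rewrite mulrCA hr mulr1.
have -> : (a `^ P * h `^ (- (2 * (P - r) / r)) = h * h * z `^ P)%R.
  by rewrite hK /z powRM ?powR_ge0// -powRrM; ring.
rewrite -[X in (_ <= _ + X)%R]mulr1 -mulrDr ler_pM2l ?mulr_gt0//.
have [z1|z1] := leP 1%R z.
  apply: (@le_trans _ _ (z `^ P)%R); last by rewrite lerDl.
  by apply: ler_powR => //; exact: ltW.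
apply: (@le_trans _ _ 1%R); last by rewrite lerDr powR_ge0.
have := @ge0_ler_powR R r (ltW r0) z 1%R; rewrite powR1; apply; rewrite ?nnegrE//.
exact: ltW.
Qed.

Lemma poweR_dominated_le (a : \bar R) (h r P : R) : 0 <= a -> (0 < h)%R ->
  (0 < r)%R -> (r < P)%R -> a `^ (r / 2) <= h%:E ->
  a `^ P * (h `^ (- (2 * (P - r) / r)))%:E <= (h * h)%:E.
Proof.
move=> a0 h0 r0 rP; have P0 := lt_trans r0 rP.
have r20 : (0 < r / 2)%R by rewrite divr_gt0.
move: a a0 => [a| |]// a0; last by rewrite poweRyr ?gt_eqF.
rewrite lee_fin in a0; rewrite !poweR_EFin -EFinM !lee_fin => ah.
have hK : (h `^ (2 * P / r) * h `^ (- (2 * (P - r) / r)) = h * h)%R.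
  rewrite -powRD; last by rewrite (gt_eqF h0) implybT.
  have -> : (2 * P / r - 2 * (P - r) / r = 2%:R)%R by field; rewrite gt_eqF.
  by rewrite powR_mulrn ?expr2// ltW.
rewrite -hK ler_wpM2r ?powR_ge0//.
have -> : (a `^ P = (a `^ (r / 2)) `^ (2 * P / r))%R.
  by rewrite -powRrM; congr (_ `^ _)%R; field; rewrite gt_eqF.
have k0 : (0 <= 2 * P / r)%R by rewrite divr_ge0 ?mulr_ge0// ltW.
by apply: (ge0_ler_powR k0); rewrite ?nnegrE ?powR_ge0//; exact: ltW.
Qed.

(** The exponent can be lowered: with h a majorant of g^(r/2), Young's
    inequality bounds f^r by f^P h^-K + h^2, where K = 2(P - r)/r is such that
    both terms have the homogeneity of g^r. *)
Lemma extrapolate_down (f g : T -> \bar R) (e C B P r : R) (w : T -> R) :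
  measurable_fun setT f -> measurable_fun setT g ->
  (forall x, 0 <= f x) -> (forall x, 0 <= g x) ->
  (0 < e)%R -> (0 < C)%R -> (0 < B)%R -> (0 < r)%R -> (r < P)%R ->
  let K := (2 * (P - r) / r)%R in
  (forall W, Acond b (Adiv_exp e K) (C * (2 + majorant_const e C `^ K)) W ->
    \int[mu]_x (f x `^ P * (W x)%:E) <= B%:E * \int[mu]_x (g x `^ P * (W x)%:E)) ->
  Acond b e C w ->
  is_true (\int[mu]_x (f x `^ r * (w x)%:E) <=
  (4 * (B + 1))%:E * \int[mu]_x (g x `^ r * (w x)%:E)).
Proof.
move=> mf mg f0 g0 e0 C0 B0 r0 rP K H Aw.
have P0 := lt_trans r0 rP.
have r20 : (0 < r / 2)%R by rewrite divr_gt0.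
have K0 : (0 <= K)%R by rewrite /K divr_ge0 ?mulr_ge0 ?subr_ge0// ltW.
have [mw w0 _] := Aw.
have wE0 x : 0 <= (w x)%:E by rewrite lee_fin ltW.
have mpw (u : T -> \bar R) p : measurable_fun setT u ->
    measurable_fun setT (fun x => u x `^ p * (w x)%:E).
  by move=> mu'; apply: measurable_mulw => //; exact: measurable_fun_poweR.
have pw0 (u : T -> \bar R) p x : 0 <= u x `^ p * (w x)%:E.
  by rewrite mule_ge0// poweR_ge0.
pose phi x := g x `^ (r / 2).
have mphi : measurable_fun setT phi by exact: measurable_fun_poweR.
have phi0 x : 0 <= phi x by exact: poweR_ge0.
have phiE : \int[mu]_x (g x `^ r * (w x)%:E) = \int[mu]_x (phi x * phi x * (w x)%:E).
  apply: eq_integral => x _; rewrite /phi poweR_mul_self//.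
  by rewrite mulrC divfK.
rewrite phiE; set I := \int[mu]_x (phi x * phi x * (w x)%:E).
have I0 : 0 <= I by apply: integral_ge0 => x _; rewrite !mule_ge0.
have B40 : (0 < 4 * (B + 1))%R by rewrite mulr_gt0// addr_gt0.
have [->|] := eqVneq I +oo; first by rewrite gt0_muley ?leey.
rewrite -ltey => Ioo.
have [I_gt0|I_le0] := ltP 0 I; last first.
  (* g = 0 almost everywhere; the bound at the exponent P, applied to w
     itself, shows that f = 0 almost everywhere *)
  have I_eq0 : I = 0 by apply/eqP; rewrite eq_le I_le0.
  have AW := Acond_div e0 C0 (majorant_const_gt0 e C0) Aw (A1_rel_cst1 C0 Aw) K0.
  have W1 : (fun x => (1 `^ (- K) * w x)%R) = w.
    by apply/funext => x; rewrite powR1 mul1r.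
  rewrite /= W1 in AW; have := H _ AW.
  have gae : {ae mu, forall x, g x = 0}.
    have : {ae mu, forall x, g x `^ r * (w x)%:E = 0}.
      by apply: integral_eq0_ae; rewrite ?phiE//; exact: mpw.
    apply: filterS => x /eqP; rewrite mule_eq0 [(w x)%:E == 0]gt_eqF ?lte_fin// orbF.
    by move=> /eqP/poweR_eq0_eq0 ->.
  rewrite (_ : \int[mu]_x (g x `^ P * (w x)%:E) = 0); last first.
    apply: ae_eq0_integral => //; first exact: mpw.
    by apply: (filterS _ gae) => x ->; rewrite poweR0r ?mul0e// gt_eqF.
  rewrite mule0 => fP.
  have fae : {ae mu, forall x, f x = 0}.
    have : {ae mu, forall x, f x `^ P * (w x)%:E = 0}.
      apply: integral_eq0_ae => //; first exact: mpw.
      by apply/eqP; rewrite eq_le fP integral_ge0.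
    apply: filterS => x /eqP; rewrite mule_eq0 [(w x)%:E == 0]gt_eqF ?lte_fin// orbF.
    by move=> /eqP/poweR_eq0_eq0 ->.
  rewrite I_eq0 mule0 (_ : \int[mu]_x _ = 0)//.
  apply: ae_eq0_integral => //; first exact: mpw.
  by apply: (filterS _ fae) => x ->; rewrite poweR0r ?mul0e// gt_eqF.
have I0oo : 0 < I < +oo by rewrite I_gt0.
have [h [Ah gh hI]] := A1_majorant e0 C0 Aw mphi phi0 I0oo.
have [mh h0 _] := Ah.
have AW := Acond_div e0 C0 (majorant_const_gt0 e C0) Aw Ah K0.
have mhK : measurable_fun setT (fun x => (h x `^ (- K) * w x)%:E).
  by apply: measurableT_comp => //; apply: measurable_funM => //; exact: measurable_fun_powR.
have hK0 x : 0 <= (h x `^ (- K) * w x)%:E by rewrite lee_fin mulr_ge0 ?powR_ge0// ltW.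
have mhh : measurable_fun setT (fun x => (h x * h x * w x)%:E).
  by apply: measurableT_comp => //; apply: measurable_funM => //; exact: measurable_funM.
have hh0 x : 0 <= (h x * h x * w x)%:E by rewrite lee_fin !mulr_ge0// ltW.
have mfP : measurable_fun setT (fun x => f x `^ P * (h x `^ (- K) * w x)%:E).
  by apply: emeasurable_funM => //; exact: measurable_fun_poweR.
have mgP : measurable_fun setT (fun x => g x `^ P * (h x `^ (- K) * w x)%:E).
  by apply: emeasurable_funM => //; exact: measurable_fun_poweR.
apply: (@le_trans _ _ (\int[mu]_x (f x `^ P * (h x `^ (- K) * w x)%:E +
    (h x * h x * w x)%:E))).
  apply: le_integral_nng => //; first exact: mpw.
    exact: emeasurable_funD.
  move=> x _; have := poweR_split_le (f0 x) (h0 x) r0 rP.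
  rewrite -/K => /(lee_wpmul2r (wE0 x))/le_trans; apply.
  by rewrite ge0_muleDl ?mule_ge0 ?poweR_ge0 ?lee_fin ?powR_ge0 ?mulr_ge0 ?(ltW (h0 x))//
    -muleA -!EFinM.
rewrite ge0_integralD//; last by move=> x _; rewrite mule_ge0// poweR_ge0.
apply: (@le_trans _ _ (B%:E * (4%:E * I) + 4%:E * I)).
  apply: leeD => //; apply: (le_trans (H _ AW)).
  apply: lee_wpmul2l; first by rewrite lee_fin ltW.
  apply: le_trans hI; apply: ae_ge0_le_integral => //.
  - by move=> x _; rewrite mule_ge0// poweR_ge0.
  - apply: (filterS _ gh) => x ghx _; rewrite EFinM muleA EFinM.
    by apply: lee_wpmul2r => //; exact: poweR_dominated_le.
have Ifin : I \is a fin_num by rewrite ge0_fin_numE.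
rewrite -(fineK Ifin) -!EFinM -EFinD lee_fin.
by rewrite le_eqVlt; apply/orP; left; apply/eqP; ring.
Qed.

Variable F : set ((T -> \bar R) * (T -> \bar R)).
Hypothesis F_pairs : forall f g, F (f, g) ->
  [/\ measurable_fun setT f, measurable_fun setT g,
      (forall x, 0 <= f x) & (forall x, 0 <= g x)].

(** The L^p inequality for all the pairs of the family and all A_infty weights,
    with a constant depending on the weight through [e] and [C] only. *)
Definition Ainfty_bound (p : R) : Prop :=
  forall e C : R, (0 < e)%R -> (0 < C)%R ->
  exists2 B : R, (0 < B)%R & forall w, Acond b e C w ->
  forall f g, F (f, g) -> \int[mu]_x (f x `^ p * (w x)%:E) <=
    B%:E * \int[mu]_x (g x `^ p * (w x)%:E).

Lemma Ainfty_bound_double p : (0 < p)%R -> Ainfty_bound p -> Ainfty_bound (2 * p).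
Proof.
move=> p0 H e C e0 C0.
have C'0 : (0 < C * (1 + majorant_const e C `^ e))%R.
  by rewrite mulr_gt0// addr_gt0// powR_gt0// majorant_const_gt0.
have [B B0 HB] := H e _ e0 C'0.
exists (4 * B ^+ 2)%R; first by rewrite mulr_gt0// exprn_gt0.
move=> w Aw f g Ffg; have [mf mg f0 g0] := F_pairs Ffg.
under eq_integral do rewrite -(poweR_mul_self p0 (f0 _)).
under [in leRHS]eq_integral do rewrite -(poweR_mul_self p0 (g0 _)).
apply: (extrapolate_square (e := e) (C := C)) => //.
- exact: measurable_fun_poweR.
- exact: measurable_fun_poweR.
- by move=> x; exact: poweR_ge0.
- by move=> x; exact: poweR_ge0.
- by move=> W AW; exact: HB.
Qed.

Lemma Ainfty_bound_lower P r : (0 < r)%R -> (r < P)%R ->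
  Ainfty_bound P -> Ainfty_bound r.
Proof.
move=> r0 rP H e C e0 C0; pose K := (2 * (P - r) / r)%R.
have K0 : (0 <= K)%R by rewrite /K divr_ge0 ?mulr_ge0 ?subr_ge0// ltW.
have C'0 : (0 < C * (2 + majorant_const e C `^ K))%R.
  by rewrite mulr_gt0// addr_gt0// powR_gt0// majorant_const_gt0.
have [B B0 HB] := H _ _ (Adiv_exp_gt0 e0 K0) C'0.
exists (4 * (B + 1))%R; first by rewrite mulr_gt0// addr_gt0.
move=> w Aw f g Ffg; have [mf mg f0 g0] := F_pairs Ffg.
by apply: (extrapolate_down (e := e) (C := C) (P := P)) => // W AW; exact: HB.
Qed.

(** Double the exponent until it exceeds r, then lower it to r. *)
Lemma Ainfty_bound_any p r : (0 < p)%R -> (0 < r)%R ->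
  Ainfty_bound p -> Ainfty_bound r.
Proof.
move=> p0 r0 H.
have pow m : Ainfty_bound (lam 0 m * p)%R.
  elim: m => [|m IH]; first by rewrite /lam !expr0 divr1 mul1r.
  by rewrite lamS -mulrA; apply: Ainfty_bound_double => //; rewrite mulr_gt0// lam_gt0.
have [m rm] := lam_ge 0 (r / p + 1)%R.
apply: (Ainfty_bound_lower r0 _ (pow m)).
by rewrite -ltr_pdivrMr//; apply: lt_le_trans rm; rewrite ltrDl.
Qed.

End extrapolation.

(** * Cubes in Euclidean space *)

Section boxes.
Variables (R : realType) (n : nat).
Local Notation E := (euclidean R n).
Local Notation mu := (euclidean_lebesgue R n).

Lemma borel_measurable (A : set (n.-tuple (measurableTypeR R))) :
  measurable A -> measurable (A : set E).
Proof.
by move=> mA; apply: sub_caratheodory; exact: sub_sigma_algebra.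
Qed.

Lemma euclidean_lebesgueE (A : set (n.-tuple (measurableTypeR R))) :
  measurable A -> mu (A : set E) = borel_lebesgue R n A.
Proof.
by move=> mA; rewrite /euclidean_lebesgue /= /completed_measure_extension
  measurable_mu_extE.
Qed.

Definition box (A : 'I_n -> set R) : set E := [set x | forall i, A i (coord x i)].

Lemma measurable_coord (i : 'I_n) : measurable_fun setT (@coord R n ^~ i).
Proof.
move=> _ B mB; rewrite setTI; apply: borel_measurable.
by rewrite -[X in measurable X]setTI; exact: (@measurable_tnth _ (measurableTypeR R) n i measurableT _ mB).
Qed.

End boxes.

Lemma measurable_borel_box (R : realType) n (A : 'I_n -> set R) :
  (forall i, measurable (A i)) ->
  measurable ([set x | forall i, A i (tnth x i)] : set (n.-tuple (measurableTypeR R))).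
Proof.
move=> mA; rewrite (_ : [set _ | _] = \bigcap_(i in [set: 'I_n])
    (fun x : n.-tuple (measurableTypeR R) => tnth x i) @^-1` A i).
  apply: fin_bigcap_measurable => //
  => i _; rewrite -[X in measurable X]setTI.
  exact: (@measurable_tnth _ (measurableTypeR R) n i measurableT _ (mA i)).
by apply/seteqP; split => x /= H i; [move=> _|]; exact: H.
Qed.

Lemma borel_lebesgue_box (R : realType) n (A : 'I_n -> set R) (l : R) :
  (forall i, measurable (A i)) -> (forall i, lebesgue_measure (A i) = l%:E) ->
  borel_lebesgue R n [set x | forall i, A i (tnth x i)] = (l ^+ n)%:E.
Proof.
elim: n A => [|n IH] A mA Al.
  rewrite /= diracE mem_set ?expr0//.
  by case.
rewrite /= /borel_lebesgueS /pushforward.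
pose B (i : 'I_n) := A (lift ord0 i).
rewrite (_ : _ @^-1` _ = A ord0 `*`
    [set x : n.-tuple (measurableTypeR R) | forall i : 'I_n, B i (tnth x i)]).
  have mB := @measurable_borel_box R n B (fun i => mA _).
  have Bl : borel_lebesgue R n [set x | forall i : 'I_n, B i (tnth x i)] = (l ^+ n)%:E.
    by apply: IH => i; [exact: mA|exact: Al].
  rewrite product_measure2E//; last exact: mA.
  by transitivity (l%:E * (l ^+ n)%:E);
    [congr (_ * _); [exact: Al|exact: Bl]|rewrite -EFinM exprS].
apply/seteqP; split => [[y x] /= H|[y x] /= [H0 H] i].
  split; first by have := H ord0; rewrite tnth0.
  by move=> i; have := H (lift ord0 i); rewrite tnthS.
by case: (unliftP ord0 i) => [j ->|->]; rewrite /tuple_cons ?tnth0 ?tnthS//; exact: H.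
Qed.

Section cubes_geometry.
Variables (R : realType) (n : nat).
Local Notation E := (euclidean R n).
Local Notation mu := (euclidean_lebesgue R n).

Lemma euclidean_lebesgue_box (A : 'I_n -> set R) (l : R) :
  (forall i, measurable (A i)) -> (forall i, lebesgue_measure (A i) = l%:E) ->
  mu (box A) = (l ^+ n)%:E.
Proof.
move=> mA Al; rewrite euclidean_lebesgueE; last exact: measurable_borel_box.
exact: borel_lebesgue_box.
Qed.

Lemma measurable_box (A : 'I_n -> set R) :
  (forall i, measurable (A i)) -> measurable (box A).
Proof. by move=> mA; apply: borel_measurable; exact: measurable_borel_box. Qed.

(** Half-open cubes are used to cut cubes into disjoint pieces. *)
Definition hcube (a : 'I_n -> R) (l : R) : set E :=
  [set x | forall i, (a i <= coord x i < a i + l)%R].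

Lemma cubeE a l : @cube R n a l = box (fun i => `[a i, (a i + l)%R]%classic).
Proof.
by apply/seteqP; split => x /= H i; have := H i; rewrite /= in_itv.
Qed.

Lemma hcubeE a l : hcube a l = box (fun i => `[a i, (a i + l)%R[%classic).
Proof.
by apply/seteqP; split => x /= H i; have := H i; rewrite /= in_itv.
Qed.

Lemma measurable_cube a l : measurable (@cube R n a l).
Proof. by rewrite cubeE; apply: measurable_box. Qed.

Lemma measurable_hcube a l : measurable (hcube a l).
Proof. by rewrite hcubeE; apply: measurable_box. Qed.

Lemma mu_cube a l : (0 < l)%R -> mu (@cube R n a l) = (l ^+ n)%:E.
Proof.
move=> l0; rewrite cubeE; apply: euclidean_lebesgue_box => // i.
by rewrite lebesgue_measure_itv/= lte_fin ltrDl l0 -EFinD addrAC subrr add0r.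
Qed.

Lemma mu_hcube a l : (0 < l)%R -> mu (hcube a l) = (l ^+ n)%:E.
Proof.
move=> l0; rewrite hcubeE; apply: euclidean_lebesgue_box => // i.
by rewrite lebesgue_measure_itv/= lte_fin ltrDl l0 -EFinD addrAC subrr add0r.
Qed.

Lemma hcube_sub a l : hcube a l `<=` @cube R n a l.
Proof. by move=> x H i; have /andP[-> /ltW] := H i. Qed.

Lemma cube_sub (a a' : 'I_n -> R) l l' :
  (forall i, (a' i <= a i)%R /\ (a i + l <= a' i + l')%R) ->
  @cube R n a l `<=` @cube R n a' l'.
Proof.
move=> H x Qx i; have /andP[ax xa] := Qx i; have [aa' ll'] := H i.
by rewrite (le_trans aa')//= (le_trans xa).
Qed.

Lemma cube_triple (a a' : 'I_n -> R) l l' : (l' <= l)%R ->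
  @cube R n a' l' `&` @cube R n a l !=set0 ->
  @cube R n a' l' `<=` @cube R n (fun i => (a i - l)%R) (3 * l)%R.
Proof.
move=> ll' [z [z1 z2]]; apply: cube_sub => i.
by have /andP[? ?] := z1 i; have /andP[? ?] := z2 i; split; lra.
Qed.

End cubes_geometry.

Section rational_cubes.
Variables (R : realType) (n : nat).
Local Notation E := (euclidean R n).
Local Notation mu := (euclidean_lebesgue R n).

(** The value 1 is a default for the rationals that are not positive. *)
Definition side (q : rat) : R := if (0 < q)%R then ratr q else 1%R.

Lemma side_gt0 q : (0 < side q)%R.
Proof. by rewrite /side; case: ifPn => // q0; rewrite ltr0q. Qed.

Lemma sideE q : (0 < q)%R -> side q = ratr q.
Proof. by rewrite /side => ->. Qed.

(** Cubes with rational corner and side, numbered by the enumeration of the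
    countable type of their data. *)
Definition rcorner (k : nat) (i : 'I_n) : R :=
  if @unpickle ({ffun 'I_n -> rat} * rat)%type k is Some (a, _)
  then ratr (a i) else 0%R.

Definition rside (k : nat) : R :=
  if @unpickle ({ffun 'I_n -> rat} * rat)%type k is Some (_, q)
  then side q else 1%R.

Definition rcube (k : nat) : set E := cube (rcorner k) (rside k).

Lemma rside_gt0 k : (0 < rside k)%R.
Proof. by rewrite /rside; case: unpickle => [[a q]|//]; exact: side_gt0. Qed.

Lemma rcube_exists (a : 'I_n -> rat) (q : rat) : (0 < q)%R ->
  exists2 k, rside k = ratr q & rcorner k =1 (fun i => ratr (a i)).
Proof.
move=> q0; exists (pickle ([ffun i => a i] : {ffun 'I_n -> rat}, q)).
  by rewrite /rside pickleK/= sideE.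
by move=> i; rewrite /rcorner pickleK ffunE.
Qed.

Lemma rcube_triple k : exists2 m, rside m = (3 * rside k)%R &
  rcorner m =1 (fun i => (rcorner k i - rside k)%R).
Proof.
have r3 : (0 < 3 :> rat)%R by [].
rewrite /rcorner /rside; case Ek : (unpickle k) => [[a q]|]; last first.
  have [m mE1 mE2] := @rcube_exists (fun=> -1)%R 3%R r3.
  exists m; first by rewrite -/(rside m) mE1 mulr1 ratr_nat.
  by move=> i; rewrite -/(rcorner m i) mE2 rmorphN1 sub0r.
have [q0|q0] := boolP (0 < q)%R.
  have [m mE1 mE2] := @rcube_exists (fun i => a i - q)%R (3 * q)%R (mulr_gt0 r3 q0).
  exists m; first by rewrite -/(rside m) mE1 /= sideE// rmorphM/= ratr_nat.
  by move=> i; rewrite -/(rcorner m i) mE2 /= sideE// rmorphB.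
have [m mE1 mE2] := @rcube_exists (fun i => a i - 1)%R 3%R r3.
exists m; first by rewrite -/(rside m) mE1 /= /side (negbTE q0) mulr1 ratr_nat.
by move=> i; rewrite -/(rcorner m i) mE2 /= /side (negbTE q0) rmorphB rmorph1.
Qed.

(** A rational side strictly between l and l' leaves room for moving the corner
    to a rational point. *)
Lemma rcube_above (a : 'I_n -> R) (l l' : R) : (0 < l)%R -> (l < l')%R ->
  exists2 k, cube a l `<=` rcube k & (rside k <= l')%R.
Proof.
move=> l0 ll'; pose e := ((l' - l) / 3)%R.
have e0 : (0 < e)%R by rewrite divr_gt0// subr_gt0.
have [q] : exists q : rat, (l + e < ratr q < l + e + e)%R.
  have [q] := @rat_in_itvoo R (l + e) (l + e + e) ltac:(lra).
  by rewrite in_itv/=; exists q.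
move=> /andP[q1 q2].
have ra i : exists q' : rat, (a i - e < ratr q' < a i)%R.
  have [q'] := @rat_in_itvoo R (a i - e) (a i) ltac:(lra).
  by rewrite in_itv/=; exists q'.
have [r rE] := choice ra.
have q0 : (0 < q)%R by rewrite -(@ltr0q R); lra.
have [k kE1 kE2] := rcube_exists r q0.
exists k; last by rewrite kE1 /e in q2 *; lra.
apply: cube_sub => i; rewrite kE1 kE2; have /andP[? ?] := rE i.
by split; lra.
Qed.

Lemma rcube_cover (B : R) : exists k, forall x : E,
  (forall i, `|coord x i| <= B)%R -> rcube k x.
Proof.
have [k kP _] := @rcube_above (fun=> - (`|B| + 1))%R (2 * (`|B| + 1))%R
  (2 * (`|B| + 1) + 1)%R ltac:(have := normr_ge0 B; lra) ltac:(lra).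
exists k => x xB; apply: kP => i; have := xB i; rewrite ler_norml => /andP[? ?].
by have := ler_norm B; lra.
Qed.

Lemma cube_bounded (a : 'I_n -> R) l : exists B : R, forall x : E,
  cube a l x -> forall i, (`|coord x i| <= B)%R.
Proof.
exists (\sum_i `|a i| + `|l|)%R => x Qx i; have /andP[ax xa] := Qx i.
have ai : (`|a i| <= \sum_i `|a i|)%R.
  by rewrite (bigD1 i)//= lerDl sumr_ge0.
rewrite ler_norml; have := ler_norm (a i); have := ler_norm (- a i)%R; rewrite normrN.
by have := ler_norm l; have := normr_ge0 l; lra.
Qed.

Lemma rcube_vol k : mu (rcube k) = (rside k ^+ n)%:E.
Proof. by rewrite mu_cube// rside_gt0. Qed.

Definition cube_basis : basis mu.
Proof.
apply: (@Basis _ _ _ mu rcube rside (3 ^+ n)%R).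
- by move=> k; exact: measurable_cube.
- by move=> k; rewrite rcube_vol lte_fin ltry exprn_gt0// rside_gt0.
- move=> k; have [m m1 m2] := rcube_triple k; exists m.
  have mE : rcube m = cube (fun i => rcorner k i - rside k)%R (3 * rside k)%R.
    by rewrite /rcube m1; congr cube; apply/funext.
  have k0 := rside_gt0 k; split.
  + rewrite mE; apply: cube_sub => i; split; lra.
  + by move=> j jk jkQ; rewrite mE; exact: (cube_triple jk jkQ).
  + by rewrite !rcube_vol m1 -EFinM exprMn.
- move=> x; have [k kP] := rcube_cover (\sum_i `|coord x i|)%R.
  by exists k; apply: kP => i; rewrite (bigD1 i)//= lerDl sumr_ge0.
- move=> j k; have [B1 H1] := @cube_bounded (rcorner j) (rside j).
  have [B2 H2] := @cube_bounded (rcorner k) (rside k).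
  have [m mP] := rcube_cover (Num.max B1 B2); exists m => x [jx|kx]; apply: mP => i.
    by rewrite le_max H1.
  by rewrite le_max H2 ?orbT.
Defined.

End rational_cubes.

(** * Decay of A_1 weights on small sets *)

Section dyadic.
Variables (R : realType) (n : nat).
Local Notation E := (euclidean R n).
Local Notation mu := (euclidean_lebesgue R n).
Local Notation bits := {ffun 'I_n -> bool}.
Implicit Types (a : 'I_n -> R) (l : R) (s : bits).

Definition child a l s : 'I_n -> R := fun i => (if s i then a i + l / 2 else a i)%R.

Definition child_bits a l (x : E) : bits :=
  [ffun i => (a i + l / 2 <= coord x i)%R].

(** A point of a cell lies in exactly one of the 2^n cells of half the side. *)
Lemma in_childP a l s x : (0 < l)%R ->
  hcube (child a l s) (l / 2) x <-> hcube a l x /\ s = child_bits a l x.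
Proof.
move=> l0; split.
  move=> H; split.
    move=> i; have := H i; rewrite /child; case: (s i) => /andP[? ?]; apply/andP; split; lra.
  apply/ffunP => i; rewrite ffunE; have := H i; rewrite /child.
  case: (s i) => /andP[h1 h2]; first by apply/esym; lra.
  by apply/esym/negP => ?; lra.
move=> [H ->] i; rewrite /child ffunE; have /andP[h1 h2] := H i.
by case: ifPn => [h|/negP h]; apply/andP; split; lra.
Qed.

(** Finite unions of dyadic subcells of a cell, as trees: inductions on the tree
    follow the bisection of the cell, as in a stopping time argument. *)
Inductive dyadic : ('I_n -> R) -> R -> set E -> Prop :=
| dyadic0 a l : dyadic a l set0
| dyadicT a l : dyadic a l (hcube a l)
| dyadicS a l (D : bits -> set E) :
    (forall s, dyadic (child a l s) (l / 2) (D s)) ->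
    dyadic a l (\bigcup_(s in [set: bits]) D s).

Lemma dyadic_measurable a l D : dyadic a l D -> measurable D.
Proof.
elim=> {a l D} [a l|a l|a l D _ IH]; [exact: measurable0|exact: measurable_hcube|].
by apply: fin_bigcup_measurable => // s _; exact: IH.
Qed.

Lemma dyadic_sub a l D : dyadic a l D -> (0 < l)%R -> D `<=` hcube a l.
Proof.
elim=> {a l D} [a l|a l|a l D _ IH] l0 //.
move=> x [s _ /IH]; rewrite divr_gt0// => /(_ isT).
by move=> /in_childP-/(_ l0)[].
Qed.

Lemma hcube_split a l : (0 < l)%R ->
  hcube a l = \bigcup_(s in [set: bits]) hcube (child a l s) (l / 2).
Proof.
move=> l0; apply/seteqP; split => x.
  by move=> Hx; exists (child_bits a l x) => //; apply/in_childP.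
by move=> [s _ /in_childP-/(_ l0)[]].
Qed.

Lemma dyadicC a l D : dyadic a l D -> (0 < l)%R -> dyadic a l (hcube a l `\` D).
Proof.
elim=> {a l D} [a l|a l|a l D dD IH] l0.
- by rewrite setD0; exact: dyadicT.
- by rewrite setDv; exact: dyadic0.
rewrite (_ : _ `\` _ = \bigcup_(s in [set: bits]) (hcube (child a l s) (l / 2) `\` D s)).
  by apply: dyadicS => s; apply: IH; rewrite divr_gt0.
have l20 : (0 < l / 2)%R by rewrite divr_gt0.
apply/seteqP; split => x.
  move=> [Hx nD]; exists (child_bits a l x) => //; split; first by apply/in_childP.
  by move=> Dx; apply: nD; exists (child_bits a l x).
move=> [s _ [/in_childP-/(_ l0)[Hx sE] nD]]; split => // -[s' _ Ds'].
have /in_childP-/(_ l0)[_ s'E] := dyadic_sub (dD s') l20 Ds'.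
by apply: nD; rewrite sE -s'E.
Qed.

Lemma dyadicU a l D D' : dyadic a l D -> dyadic a l D' -> (0 < l)%R ->
  dyadic a l (D `|` D').
Proof.
move=> dD; elim: dD D' => {a l D} [a l D'|a l D'|a l D dD IH D' dD'] => //.
- by rewrite set0U.
- by move=> dD' l0; rewrite setUidl; [exact: dyadicT|exact: dyadic_sub].
move=> l0; have l20 : (0 < l / 2)%R by rewrite divr_gt0.
inversion dD' as [a1 l1|a1 l1|a1 l1 D1 dD1 aE lE DE]; subst.
- by rewrite setU0; exact: dyadicS.
- rewrite setUidr; first exact: dyadicT.
  by apply: dyadic_sub => //; exact: dyadicS.
- by rewrite -bigcupU; apply: dyadicS => s; exact: IH.
Qed.

(** Bisecting the cell replaces the threshold j / 2^(k+1) by j / 2^k in the lower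
    half and by (j - 2^k) / 2^k in the upper half. Any integer j is allowed, so
    that the induction applies to both halves. *)
Lemma dyadic_halfspace (i : 'I_n) k : forall (j : int) a l, (0 < l)%R ->
  dyadic a l (hcube a l `&` [set x | (coord x i < a i + l * (j%:~R / 2 ^+ k))%R]).
Proof.
elim: k => [|k IH] j a l l0.
  rewrite expr0 divr1; have [j0|j0] := leP j 0%R.
    rewrite (_ : _ `&` _ = set0); first exact: dyadic0.
    apply/seteqP; split => // x [/(_ i)/andP[h _] /=].
    have : (l * j%:~R <= 0)%R by rewrite mulr_ge0_le0 ?lerz0 ?(ltW l0).
    lra.
  rewrite (_ : _ `&` _ = hcube a l); first exact: dyadicT.
  apply/seteqP; split => [x []//|x Hx]; split => //=.
  have /andP[_ h] := Hx i; apply: (lt_le_trans h).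
  by rewrite lerD2l ler_peMr ?(ltW l0)// ler1z.
have l20 : (0 < l / 2)%R by rewrite divr_gt0.
rewrite (hcube_split _ l0) setI_bigcupl.
rewrite (_ : \bigcup_(s in _) _ = \bigcup_(s in [set: bits]) (hcube (child a l s) (l / 2) `&`
    [set x | (coord x i < child a l s i +
      (l / 2) * ((j - (s i)%:Z * 2 ^+ k)%:~R / 2 ^+ k))%R])).
  by apply: dyadicS => s; exact: IH.
apply: eq_bigcupr => s _; congr (_ `&` _); apply/funext => x /=.
congr (is_true (_ < _)%R).
rewrite /child rmorphB rmorphM rmorphXn/= exprS.
have k0 : (2 ^+ k != 0 :> R)%R by rewrite expf_neq0.
case: (s i) => /=.
  by rewrite mulr1z mul1r; field.
by rewrite mulr0z mul0r subr0; field.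
Qed.

Lemma bits_integral (D : bits -> set E) a l (f : E -> \bar R) : (0 < l)%R ->
  (forall s, measurable (D s)) -> (forall s, D s `<=` hcube (child a l s) (l / 2)) ->
  measurable_fun setT f -> (forall x, 0 <= f x) ->
  \int[mu]_(x in \bigcup_(s in [set: bits]) D s) f x =
  \sum_(s : bits) \int[mu]_(x in D s) f x.
Proof.
move=> l0 mD sD mf f0.
have -> : \bigcup_(s in [set: bits]) D s = \big[setU/set0]_(s <- enum bits) D s.
  rewrite -bigcup_seq; apply/seteqP; split => x [s _ Dx]; exists s => //=.
  by rewrite mem_enum.
rewrite ge0_integral_bigsetU//; last 3 first.
- exact: enum_uniq.
- move=> s s' _ _ [x [Dx Dx']].
  have /in_childP-/(_ l0)[_ ->] := sD _ _ Dx.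
  by have /in_childP-/(_ l0)[_ ->] := sD _ _ Dx'.
- exact: measurable_funTS.
by rewrite big_enum.
Qed.

Lemma bits_measure (D : bits -> set E) a l : (0 < l)%R ->
  (forall s, measurable (D s)) -> (forall s, D s `<=` hcube (child a l s) (l / 2)) ->
  mu (\bigcup_(s in [set: bits]) D s) = \sum_(s : bits) mu (D s).
Proof.
move=> l0 mD sD; have mUD : measurable (\bigcup_(s in [set: bits]) D s).
  exact: fin_bigcup_measurable.
rewrite -[LHS]mul1e -integral_cst// (bits_integral l0 mD sD)//.
by apply: eq_bigr => s _; rewrite integral_cst// mul1e.
Qed.

Section reverse.
Variables (K : R) (sg : E -> R).
Hypotheses (K1 : (1 <= K)%R) (msg : measurable_fun setT sg).
Hypothesis sg0 : forall x, (0 < sg x)%R.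
Hypothesis A1 : forall a l, (0 < l)%R -> {ae mu, forall x, hcube a l x ->
  \int[mu]_(y in hcube a l) (sg y)%:E <= (K * l ^+ n * sg x)%:E}.

Let nu (A : set E) : \bar R := \int[mu]_(x in A) (sg x)%:E.

Let msgE D : measurable_fun D (fun x => (sg x)%:E).
Proof. by apply: measurable_funTS; exact: measurableT_comp. Qed.

Let sgE0 x : 0 <= (sg x)%:E. Proof. by rewrite lee_fin ltW. Qed.

Let nu_ge0 A : 0 <= nu A. Proof. by apply: integral_ge0 => x _. Qed.

Let nu_le A B : measurable A -> measurable B -> A `<=` B -> nu A <= nu B.
Proof. by move=> mA mB AB; apply: ge0_subset_integral. Qed.

Let K0 : (0 < K)%R. Proof. exact: lt_le_trans K1. Qed.

Lemma A1_hcube_lty a l : (0 < l)%R -> nu (hcube a l) < +oo.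
Proof.
move=> l0; have H0 : 0 < mu (hcube a l) by rewrite mu_hcube// lte_fin exprn_gt0.
have [x Hx] := ae_gt0_meet (measurable_hcube a l) H0 (A1 a l0).
by move=> /(_ Hx)/le_lt_trans; apply; rewrite ltry.
Qed.

Let nuH a l : (0 < l)%R -> nu (hcube a l) = (fine (nu (hcube a l)))%:E.
Proof. by move=> l0; rewrite fineK// ge0_fin_numE// A1_hcube_lty. Qed.

Definition A1_beta : R := (1 - (2 * K)^-1)%R.

Lemma A1_beta_ge0 : (0 <= A1_beta)%R.
Proof.
rewrite subr_ge0 invf_le1 ?mulr_gt0//; apply: (le_trans K1).
by rewrite ler_peMl ?ler1n// ltW.
Qed.

Lemma A1_beta_lt1 : (A1_beta < 1)%R.
Proof. by rewrite gtrBl invr_gt0 mulr_gt0. Qed.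

(** Almost everywhere sg is at least its average over the cell divided by K.
    The complement of A, which fills half of the cell, therefore carries the
    fraction 1 / (2 K) of the weight. *)
Lemma A1_half a l A : (0 < l)%R -> measurable A -> A `<=` hcube a l ->
  mu A <= (l ^+ n / 2)%:E -> nu A <= A1_beta%:E * nu (hcube a l).
Proof.
move=> l0 mA AH A2; have mH := measurable_hcube a l.
have ln0 : (0 < l ^+ n)%R by rewrite exprn_gt0.
have mHA : measurable (hcube a l `\` A) by exact: measurableD.
set y := fine (nu (hcube a l)); have yE := nuH a l0; rewrite -/y in yE.
have y0 : (0 <= y)%R by rewrite -lee_fin -yE.
have HE : nu (hcube a l) = nu A + nu (hcube a l `\` A).
  rewrite /nu -ge0_integral_setU//; first by rewrite setDUK.
  by apply/disj_setPS => x [Ax []].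
have muE : (l ^+ n)%:E = mu A + mu (hcube a l `\` A).
  rewrite -(mu_hcube a l0) -measureU//; first by rewrite setDUK.
  by rewrite setDIK.
have Afin : mu A \is a fin_num by rewrite ge0_fin_numE// (le_lt_trans A2)// ltry.
have HA2 : (l ^+ n / 2)%:E <= mu (hcube a l `\` A).
  have Bfin : mu (hcube a l `\` A) \is a fin_num.
    rewrite ge0_fin_numE//; apply: (@le_lt_trans _ _ (l ^+ n)%:E); last exact: ltry.
    by rewrite muE leeDr.
  move: muE A2; rewrite -(fineK Afin) -(fineK Bfin) -EFinD => -[mE].
  by rewrite !lee_fin; lra.
have low : (y / (K * l ^+ n))%:E * mu (hcube a l `\` A) <= nu (hcube a l `\` A).
  rewrite -integral_cst//; apply: ae_ge0_le_integral => //.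
  - by move=> x _; rewrite lee_fin divr_ge0// mulr_ge0// ltW.
  - apply: filterS (A1 a l0) => x H [Hx _]; have := H Hx.
    rewrite -/(nu _) yE !lee_fin => h.
    by rewrite ler_pdivrMr ?mulr_gt0// mulrC.
have low2 : (y / (2 * K))%:E <= nu (hcube a l `\` A).
  apply: le_trans low; apply: (@le_trans _ _ ((y / (K * l ^+ n))%:E * (l ^+ n / 2)%:E)).
    rewrite -EFinM lee_fin le_eqVlt; apply/orP; left; apply/eqP.
    by field; rewrite !gt_eqF.
  apply: lee_wpmul2l => //; by rewrite lee_fin divr_ge0// mulr_ge0// ltW.
have fA : nu A \is a fin_num.
  by rewrite ge0_fin_numE// (le_lt_trans (nu_le mA mH AH))// A1_hcube_lty.
have fB : nu (hcube a l `\` A) \is a fin_num.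
  by rewrite ge0_fin_numE// (le_lt_trans (nu_le mHA mH _))// A1_hcube_lty.
move: HE low2; rewrite yE -(fineK fA) -(fineK fB) -EFinD => -[HE].
rewrite -EFinM !lee_fin /A1_beta mulrBl mul1r => low2.
by rewrite mulrC in low2; lra.
Qed.

(** A child cell has 2^n times less measure than its parent, so a density at most
    theta in the parent is a density at most 1/2 in the child. *)
Definition A1_theta : R := ((2 ^+ n)^-1 / 2)%R.

Lemma A1_theta_gt0 : (0 < A1_theta)%R.
Proof. by rewrite divr_gt0// invr_gt0 exprn_gt0. Qed.

Lemma A1_theta_lt1 : (A1_theta < 1)%R.
Proof.
rewrite ltr_pdivrMr// mul1r; apply: (@le_lt_trans _ _ 1%R); last by rewrite ltr1n.
by rewrite invf_le1 ?exprn_gt0// exprn_ege1// ler1n.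
Qed.

(** A Calderon-Zygmund decomposition: the maximal cells in which [D] has
    density more than theta make up [D1]; in each of them the density of [D]
    is at most 2^n theta = 1/2, because the parent cell was not selected. *)
Lemma dyadic_step a l D : dyadic a l D -> (0 < l)%R ->
  mu D <= (A1_theta * l ^+ n)%:E ->
  exists D1, [/\ dyadic a l D1, A1_theta%:E * mu D1 <= mu D &
    nu D <= A1_beta%:E * nu D1].
Proof.
have t0 := A1_theta_gt0.
elim=> {a l D} [a l|a l|a l D dD IH] l0.
- move=> _; exists set0; split; first exact: dyadic0.
    by rewrite measure0 mule0.
  by rewrite /nu integral_set0 mule0.
- move=> h; exfalso; move: h; rewrite mu_hcube// lee_fin leNgt.
  by rewrite -[ltRHS]mul1r ltr_pM2r ?A1_theta_lt1// exprn_gt0.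
move=> muD; have l20 : (0 < l / 2)%R by rewrite divr_gt0.
have mD s : measurable (D s) := dyadic_measurable (dD s).
have sD s : D s `<=` hcube (child a l s) (l / 2) := dyadic_sub (dD s) l20.
have /choice[D1 D1P] s : exists D1, [/\ dyadic (child a l s) (l / 2) D1,
    A1_theta%:E * mu D1 <= mu (D s) & nu (D s) <= A1_beta%:E * nu D1].
  have [h|h] := leP (mu (D s)) (A1_theta * (l / 2) ^+ n)%:E; first exact: IH.
  exists (hcube (child a l s) (l / 2)); split; first exact: dyadicT.
    by rewrite mu_hcube// -EFinM ltW.
  apply: A1_half => //; apply: (@le_trans _ _ (mu (\bigcup_(s in [set: bits]) D s))).
    apply: le_measure; rewrite ?inE//; last exact: bigcup_sup.
    exact: fin_bigcup_measurable.
  apply: (le_trans muD); rewrite lee_fin le_eqVlt; apply/orP; left; apply/eqP.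
  by rewrite /A1_theta expr_div_n; field; rewrite expf_neq0.
exists (\bigcup_(s in [set: bits]) D1 s).
have dD1 s : dyadic (child a l s) (l / 2) (D1 s) by have [] := D1P s.
have mD1 s : measurable (D1 s) := dyadic_measurable (dD1 s).
have sD1 s : D1 s `<=` hcube (child a l s) (l / 2) := dyadic_sub (dD1 s) l20.
split; first exact: dyadicS.
- rewrite (bits_measure l0 mD1 sD1) (bits_measure l0 mD sD) ge0_sume_distrr//.
  by apply: lee_sum => s _; have [] := D1P s.
- rewrite /nu (bits_integral l0 mD1 sD1)// (bits_integral l0 mD sD)// ge0_sume_distrr//; last first.
    by move=> s _; exact: nu_ge0.
  by apply: lee_sum => s _; have [] := D1P s.
Qed.

(** Each step of the decomposition enlarges the set by the factor 1 / theta in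
    measure at most, and by 1 / beta in weight at least; m steps are possible
    before the enlarged set outgrows the cell. *)
Lemma dyadic_decay a l D m : dyadic a l D -> (0 < l)%R ->
  mu D <= (A1_theta ^+ m * l ^+ n)%:E ->
  nu D <= (A1_beta ^+ m)%:E * nu (hcube a l).
Proof.
move=> dD l0; have t0 := A1_theta_gt0; have ln0 : (0 < l ^+ n)%R by rewrite exprn_gt0.
elim: m D dD => [|m IH] D dD muD.
  rewrite expr0 mul1e; apply: nu_le; last exact: dyadic_sub.
    exact: dyadic_measurable dD.
  exact: measurable_hcube.
have [|D1 [dD1 D1D D1nu]] := dyadic_step dD l0.
  apply: (le_trans muD); rewrite lee_fin ler_pM2r// exprS ler_piMr ?(ltW t0)//.
  by rewrite exprn_ile1 ?(ltW A1_theta_lt1) ?(ltW t0).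
apply: (le_trans D1nu); rewrite exprS EFinM -muleA.
apply: lee_wpmul2l; first by rewrite lee_fin A1_beta_ge0.
apply: IH => //; move: (le_trans D1D muD).
by rewrite exprS -mulrA [(A1_theta * _)%:E]EFinM lee_pmul2l.
Qed.

End reverse.

Section dyadic_approximation.
Variables (a : 'I_n -> R) (l : R) (om : E -> \bar R).
Hypotheses (l0 : (0 < l)%R) (mom : measurable_fun setT om).
Hypotheses (om0 : forall x, 0 <= om x).
Hypothesis omoo : \int[mu]_(x in hcube a l) om x < +oo.
Local Notation H := (hcube a l).

(** The symmetric difference inside the cell H, for D contained in H. *)
Definition symdiff (A D : set E) : set E := ((A `&` H) `\` D) `|` (D `\` A).

(** Approximation in L^1 of the density [om]. For [om] = 1 + sg it holds both for
    the Lebesgue measure and for the weight. *)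
Definition approximable (A : set E) : Prop := measurable A /\
  forall eta : R, (0 < eta)%R -> exists2 D, dyadic a l D &
    \int[mu]_(x in symdiff A D) om x <= eta%:E.

Let mH : measurable H := measurable_hcube a l.

Let momD D : measurable_fun D om. Proof. exact: measurable_funTS. Qed.

Lemma measurable_symdiff A D : measurable A -> measurable D -> measurable (symdiff A D).
Proof.
move=> mA mD; apply: measurableU; apply: measurableD => //.
exact: measurableI.
Qed.

Let int_le A B : measurable A -> measurable B -> A `<=` B ->
  \int[mu]_(x in A) om x <= \int[mu]_(x in B) om x.
Proof. by move=> mA mB AB; apply: ge0_subset_integral. Qed.

Let int_leU A B C : measurable A -> measurable B -> measurable C -> C `<=` A `|` B ->
  \int[mu]_(x in C) om x <= \int[mu]_(x in A) om x + \int[mu]_(x in B) om x.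
Proof.
move=> mA mB mC CAB; apply: (@le_trans _ _ (\int[mu]_(x in A `|` B) om x)).
  by apply: int_le => //; exact: measurableU.
exact: ge0_integral_setU_le.
Qed.

Lemma approximable_dyadic A : measurable A -> dyadic a l (H `&` A) -> approximable A.
Proof.
move=> mA dA; split => // eta eta0; exists (H `&` A) => //.
rewrite (_ : symdiff _ _ = set0) ?integral_set0 ?lee_fin ?ltW//.
by apply/seteqP; split => // x [[[Ax Hx]]|[[Hx Ax]]] => [[]|].
Qed.

Lemma approximable0 : approximable set0.
Proof. by apply: approximable_dyadic => //; rewrite setI0; exact: dyadic0. Qed.

Lemma approximableC A : approximable A -> approximable (~` A).
Proof.
move=> [mA aA]; split; first exact: measurableC.
move=> eta /aA[D dD De]; exists (H `\` D); first exact: dyadicC.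
have DH := dyadic_sub dD l0.
rewrite (_ : symdiff _ _ = symdiff A D)//; apply/seteqP; split => x.
  move=> [[[nAx Hx] nHD]|[[Hx nDx] /contrapT Ax]]; last by left.
  by right; split => //; apply: contrapT => nDx; apply: nHD.
move=> [[[Ax Hx] nDx]|[Dx nAx]]; first by right; split => //; move=> nAx; exact: nAx.
by left; split; [split => //; exact: DH|move=> [_]].
Qed.

Lemma approximableU A B : approximable A -> approximable B -> approximable (A `|` B).
Proof.
move=> [mA aA] [mB aB]; split; first exact: measurableU.
move=> eta eta0; have eta20 : (0 < eta / 2)%R by rewrite divr_gt0.
have [D dD De] := aA _ eta20; have [D' dD' De'] := aB _ eta20.
have mD := dyadic_measurable dD; have mD' := dyadic_measurable dD'.
exists (D `|` D'); first exact: dyadicU.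
apply: (@le_trans _ _ (\int[mu]_(x in symdiff A D) om x +
    \int[mu]_(x in symdiff B D') om x)).
  apply: int_leU; try exact: measurable_symdiff.
    by apply: measurable_symdiff; exact: measurableU.
  move=> x [[[[Ax|Bx] Hx] nD]|[[Dx|Dx] nAB]].
  - by left; left; split => // Dx; apply: nD; left.
  - by right; left; split => // Dx; apply: nD; right.
  - by left; right; split => // Ax; apply: nAB; left.
  - by right; right; split => // Bx; apply: nAB; right.
by rewrite [eta]splitr EFinD; exact: leeD.
Qed.

Lemma approximable_bigcup (F : (set E)^nat) : (forall i, approximable (F i)) ->
  approximable (\bigcup_i F i).
Proof.
move=> aF; have mF i : measurable (F i) by have [] := aF i.
have mUF : measurable (\bigcup_i F i) by exact: bigcupT_measurable.
split => // eta eta0.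
have eta20 : (0 < eta / 2)%R by rewrite divr_gt0.
pose B N := \big[setU/set0]_(i < N) F i.
have aB N : approximable (B N).
  elim: N => [|N IH]; first by rewrite /B big_ord0; exact: approximable0.
  by rewrite /B big_ord_recr; exact: approximableU.
have mB N : measurable (B N) by have [] := aB N.
have mBH N : measurable (B N `&` H) by exact: measurableI.
have mU : measurable ((\bigcup_i F i) `&` H) by exact: measurableI.
have ndB : nondecreasing_seq (fun N => B N `&` H).
  move=> m k mk; apply/subsetPset; apply: setSI.
  exact: subset_bigsetU.
have BU : \bigcup_N (B N `&` H) = (\bigcup_i F i) `&` H.
  rewrite -setI_bigcupl; congr (_ `&` _).
  by apply/seteqP; split => x [i _]; [rewrite /B -bigcup_mkord => -[j _ Fj]; exists j|
    move=> Fx; exists i.+1 => //; rewrite /B -bigcup_mkord; exists i => /=].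
have Uoo : \int[mu]_(x in (\bigcup_i F i) `&` H) om x < +oo.
  by apply: le_lt_trans omoo; apply: int_le => //; exact: subIsetr.
have U0 : 0 <= \int[mu]_(x in (\bigcup_i F i) `&` H) om x by exact: integral_ge0.
have [N HN] : exists N, \int[mu]_(x in (\bigcup_i F i) `&` H) om x - (eta / 2)%:E <
    \int[mu]_(x in B N `&` H) om x.
  apply: lt_sup_range.
  have cv := @ge0_nondecreasing_set_cvg_integral _ _ _ (fun N => B N `&` H) om mu
    ndB mBH (fun N => @momD _) (fun N x _ => om0 x).
  have nd := @ge0_nondecreasing_set_nondecreasing_integral _ _ _ (fun N => B N `&` H) om mu
    ndB mBH (fun N => @momD _) (fun N x _ => om0 x).
  rewrite BU in cv.
  rewrite -(cvg_unique _ cv (ereal_nondecreasing_cvgn nd))//.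
  rewrite lteBlDr// lteDl ?lte_fin//.
  by rewrite ge0_fin_numE.
have [_ /(_ _ eta20)[D dD De]] := aB N; exists D => //.
have mD := dyadic_measurable dD.
have mUB : measurable (((\bigcup_i F i) `&` H) `\` (B N `&` H)) by exact: measurableD.
apply: (@le_trans _ _ (\int[mu]_(x in ((\bigcup_i F i) `&` H) `\` (B N `&` H)) om x +
    \int[mu]_(x in symdiff (B N) D) om x)).
  apply: int_leU => //; try exact: measurable_symdiff.
  move=> x [[[Ux Hx] nD]|[Dx nU]].
    have [Bx|nBx] := pselect (B N x); first by right; left.
    by left; split => // -[].
  by right; right; split => // Bx; apply: nU; have : (\bigcup_N (B N `&` H)) x;
    [exists N => //; split => //; exact: dyadic_sub dD l0 _ Dx|rewrite BU => -[]].
rewrite [eta]splitr EFinD; apply: leeD => //.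
have BUs : B N `&` H `<=` (\bigcup_i F i) `&` H by rewrite -BU => x Bx; exists N.
have E1 : \int[mu]_(x in (\bigcup_i F i) `&` H) om x =
   \int[mu]_(x in B N `&` H) om x +
   \int[mu]_(x in ((\bigcup_i F i) `&` H) `\` (B N `&` H)) om x.
  rewrite -ge0_integral_setU//; first by rewrite setDUK.
  by apply/disj_setPS => x [Ax []].
have B0 : 0 <= \int[mu]_(x in B N `&` H) om x by exact: integral_ge0.
have R0 : 0 <= \int[mu]_(x in ((\bigcup_i F i) `&` H) `\` (B N `&` H)) om x.
  exact: integral_ge0.
move: HN E1 Uoo B0 R0.
set u := \int[mu]_(x in _ `&` H) om x; set p := \int[mu]_(x in B N `&` H) om x.
set r := \int[mu]_(x in _ `\` _) om x => HN E1 uoo p0 r0.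
have ufin : u \is a fin_num by rewrite ge0_fin_numE// E1 adde_ge0.
have pfin : p \is a fin_num.
  by rewrite ge0_fin_numE// (le_lt_trans _ uoo)// E1 leeDl.
have rfin : r \is a fin_num.
  by rewrite ge0_fin_numE// (le_lt_trans _ uoo)// E1 leeDr.
move: HN E1; rewrite -(fineK ufin) -(fineK pfin) -(fineK rfin) => + [E1].
by rewrite -EFinD lte_fin lee_fin => HN; lra.
Qed.

(** The ray below c is an increasing union of rays below dyadic fractions of the
    cell. *)
Lemma approximable_ray (i : 'I_n) (c : R) :
  approximable (@coord R n ^~ i @^-1` `]-oo, c[%classic).
Proof.
pose t k : int := Num.floor ((c - a i) / l * 2 ^+ k).
pose S k : set E := [set x | (coord x i < a i + l * ((t k)%:~R / 2 ^+ k))%R].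
have mS k : measurable (S k).
  rewrite (_ : S k = @coord R n ^~ i @^-1` `]-oo, (a i + l * ((t k)%:~R / 2 ^+ k))%R[%classic).
    rewrite -[X in measurable X]setTI; apply: measurable_coord => //.
  by apply/seteqP; split => x /=; rewrite in_itv.
rewrite (_ : _ @^-1` _ = \bigcup_k S k).
  apply: approximable_bigcup => k; apply: approximable_dyadic => //.
  exact: dyadic_halfspace.
have tk k : ((t k)%:~R / 2 ^+ k <= (c - a i) / l < (t k)%:~R / 2 ^+ k + 1 / 2 ^+ k)%R.
  have k0 : (0 < 2 ^+ k :> R)%R by rewrite exprn_gt0.
  rewrite -mulrDl ler_pdivrMr// ltr_pdivlMr//.
  by rewrite floor_le_tmp -[(_ + 1)%R](intrD1) lt_succ_floor.
apply/seteqP; split => x /=; rewrite in_itv/=.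
  move=> xc; have [k] := @lam_ge R 0 (l / (c - coord x i) + 1)%R.
  rewrite /lam expr0 divr1 => kP; exists k => //; rewrite /S /=.
  have k0 : (0 < 2 ^+ k :> R)%R by rewrite exprn_gt0.
  have /andP[_ h] := tk k.
  have h1 : (l / 2 ^+ k < c - coord x i)%R.
    rewrite ltr_pdivrMr// mulrC -ltr_pdivrMr ?subr_gt0//.
    by apply: lt_le_trans kP; rewrite ltrDl.
  move: h; rewrite ltr_pdivrMr// mulrDl => h.
  have -> : (l * ((t k)%:~R / 2 ^+ k) = (t k)%:~R / 2 ^+ k * l)%R by rewrite mulrC.
  have : (1 / 2 ^+ k * l = l / 2 ^+ k)%R by rewrite mulrAC mul1r.
  lra.
move=> [k _ /lt_le_trans]; apply; have /andP[+ _] := tk k.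
by rewrite ler_pdivlMr// mulrC => h; lra.
Qed.

Lemma approximable_coord (i : 'I_n) (B : set (measurableTypeR R)) :
  measurable B -> approximable (@coord R n ^~ i @^-1` B).
Proof.
move=> mB.
have : (@RGenInftyO.G R).-sigma.-measurable B by rewrite -RGenInftyO.measurableE.
move: B {mB}; apply: smallest_sub.
  split=> /=; first by rewrite preimage_set0; exact: approximable0.
    by move=> A aA; rewrite setTD preimage_setC; exact: approximableC.
  by move=> F aF; rewrite preimage_bigcup; exact: approximable_bigcup.
by move=> _ [c ->]; exact: approximable_ray.
Qed.

(** The approximable sets form a sigma-algebra that contains the rays of each
    coordinate, which generate the Borel sets. *)
Lemma approximable_borel (A : set (n.-tuple (measurableTypeR R))) :
  measurable A -> approximable A.
Proof.
move: A; apply: smallest_sub.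
  split=> /=; first exact: approximable0.
    by move=> A aA; rewrite setTD; exact: approximableC.
  by move=> F aF; exact: approximable_bigcup.
elim/big_ind: _ => //; first by move=> A B hA hB; rewrite subUset.
by move=> i _ _ [B mB <-]; rewrite setTI; exact: approximable_coord.
Qed.

End dyadic_approximation.

(** Covers by Borel sets compute the Caratheodory extension. *)
Lemma borel_outer (A : set E) (c : R) : mu A < c%:E ->
  exists B : set (n.-tuple (measurableTypeR R)),
    [/\ measurable B, A `<=` B & mu (B : set E) < c%:E].
Proof.
rewrite /euclidean_lebesgue/= /completed_measure_extension /mu_ext.
move=> /ereal_inf_lt[_ [F [mF AF] <-] Fc].
exists (\bigcup_k F k); split => //; first exact: bigcupT_measurable.
rewrite -[X in X < _]/(mu (\bigcup_k F k : set E)) euclidean_lebesgueE//; last exact: bigcupT_measurable.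
apply: le_lt_trans Fc; apply: measure_sigma_subadditive => //.
exact: bigcupT_measurable.
Qed.

(** The A_infty property of A_1 weights, with constants depending only on the
    dimension and on the A_1 constant. A measurable set is enclosed in a Borel
    set, which is close to a finite union of dyadic cells, where the stopping
    time argument of [dyadic_decay] applies. *)
Lemma A1_decay (K : R) (sg : E -> R) a l m (A : set E) : (1 <= K)%R ->
  measurable_fun setT sg -> (forall x, (0 < sg x)%R) ->
  (forall a l, (0 < l)%R -> {ae mu, forall x, hcube a l x ->
    \int[mu]_(y in hcube a l) (sg y)%:E <= (K * l ^+ n * sg x)%:E}) ->
  (0 < l)%R -> measurable A -> A `<=` hcube a l ->
  mu A < (A1_theta ^+ m * l ^+ n)%:E ->
  \int[mu]_(x in A) (sg x)%:E <=
    (A1_beta K ^+ m)%:E * \int[mu]_(x in hcube a l) (sg x)%:E.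
Proof.
move=> K1 msg sg0 A1 l0 mA AH /borel_outer[B [mB AB muB]].
have sgE0 x : 0 <= (sg x)%:E by rewrite lee_fin ltW.
have msgE D : measurable_fun D (fun x => (sg x)%:E).
  by apply: measurable_funTS; exact: measurableT_comp.
have mH := measurable_hcube a l.
have mB' : measurable (B : set E) := borel_measurable mB.
have mBH : measurable ((B : set E) `&` hcube a l) by exact: measurableI.
apply/lee_addgt0Pr => eta0 eta0_gt0.
pose c := (A1_theta ^+ m * l ^+ n)%R.
pose d := Num.min eta0 (c - fine (mu (B : set E)))%R.
have muBfin : mu (B : set E) \is a fin_num.
  by rewrite ge0_fin_numE// (lt_trans muB)// ltry.
have d0 : (0 < d)%R.
  by rewrite lt_min eta0_gt0 subr_gt0 -lte_fin fineK.
(* small for this density means small both in measure and in weight *)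
pose om x := 1 + (sg x)%:E.
have mom : measurable_fun setT om by exact: emeasurable_funD.
have om0 x : 0 <= om x by exact: adde_ge0.
have omoo : \int[mu]_(x in hcube a l) om x < +oo.
  rewrite ge0_integralD// integral_cst// mul1e mu_hcube//.
  by rewrite lte_add_pinfty ?ltry//; exact: (A1_hcube_lty A1 a l0).
have [_ /(_ _ d0)[D dD De]] := approximable_borel l0 mom om0 omoo mB.
have mD := dyadic_measurable dD.
have mS := measurable_symdiff a l mB' mD.
have muS : mu (symdiff a l B D) <= d%:E.
  apply: le_trans De; rewrite -[leLHS]mul1e -integral_cst//.
  by apply: le_integral_nng => //; [exact: measurable_funTS|move=> x _; rewrite leeDl].
have nuS : \int[mu]_(x in symdiff a l B D) (sg x)%:E <= d%:E.
  apply: le_trans De.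
  by apply: le_integral_nng => //; [exact: measurable_funTS|move=> x _; rewrite leeDr].
have muD : mu D <= c%:E.
  apply: (@le_trans _ _ (mu (B : set E) + mu (symdiff a l B D))).
    apply: le_trans (measureU2 _ mB' mS); apply: le_measure; rewrite ?inE//.
      exact: measurableU.
    by move=> x Dx; have [Bx|nBx] := pselect (B x); [left|right; right].
  apply: (@le_trans _ _ (mu (B : set E) + d%:E)); first exact: leeD.
  rewrite -(fineK muBfin) -EFinD lee_fin -lerBrDl /d ge_min.
  by rewrite lexx orbT.
apply: (@le_trans _ _ (\int[mu]_(x in (B : set E) `&` hcube a l) (sg x)%:E)).
  by apply: ge0_subset_integral => // x Ax; split; [exact: AB|exact: AH].
apply: (@le_trans _ _ (\int[mu]_(x in D `|` symdiff a l B D) (sg x)%:E)).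
  apply: ge0_subset_integral => //; first exact: measurableU.
  by move=> x [Bx Hx]; have [Dx|nDx] := pselect (D x); [left|right; left].
apply: (le_trans (ge0_integral_setU_le mu mD mS (msgE _) sgE0)).
apply: leeD; first exact: (dyadic_decay K1 msg sg0 A1 dD l0 muD).
by apply: (le_trans nuS); rewrite lee_fin ge_min lexx.
Qed.

End dyadic.

(** * Products of an A_1 weight and a small power of an A_p weight *)

Section level_sums.
Context {R : realType}.

(** Either z <= 1, or z is at most twice the largest level 2^k below it. *)
Lemma le_one_levels (z : R) : (0 <= z)%R ->
  z%:E <= 1 + \sum_(k <oo) (if (lam 0 k < z)%R then (2 * lam 0 k)%:E else 0).
Proof.
move=> z0; have l00 : lam 0 0 = 1%R :> R by rewrite /lam !expr0 divr1.
pose a (k : nat) : \bar R := if (lam 0 k < z)%R then (2 * lam 0 k)%R%:E else 0.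
rewrite -[leRHS]/(1 + \sum_(k <oo) a k).
have a0 k : 0 <= a k.
  by rewrite /a; case: ifP => // _; rewrite lee_fin mulr_ge0// ltW// lam_gt0.
have [z1|z1] := leP z 1%R.
  by apply: (@le_trans _ _ 1); [rewrite lee_fin|rewrite leeDl// nneseries_ge0].
have ak k : a k <= \sum_(k <oo) a k.
  apply: (le_trans _ (nneseries_lim_ge k.+1 _)) => //.
  by rewrite big_nat_recr//= leeDr// sume_ge0.
have ex : exists k, (z <= lam 0 k)%R by exact: lam_ge.
have [[|k] zk kmin] := ex_minnP ex; first by rewrite l00 leNgt z1 in zk.
have kz : (lam 0 k < z)%R by rewrite ltNge; apply/negP => /kmin; rewrite ltnn.
apply: (@le_trans _ _ (a k)); first by rewrite /a kz lee_fin -lamS.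
by apply: (le_trans (ak k)); rewrite leeDr.
Qed.

Lemma geometric_halves (c : R) : (0 <= c)%R ->
  \sum_(k <oo) (2 * (lam 0 k)^-1 * c)%:E <= (4 * c)%:E :> \bar R.
Proof.
move=> c0; apply: lime_le.
  apply: is_cvg_nneseries => k _ _.
  by rewrite lee_fin !mulr_ge0// invr_ge0 ltW// lam_gt0.
apply: nearW => m.
suff -> : \sum_(0 <= k < m) (2 * (lam 0 k)^-1 * c)%:E =
    ((4 - 4 * (lam 0 m)^-1) * c)%:E :> \bar R.
  by rewrite lee_fin ler_wpM2r// gerBl mulr_ge0// invr_ge0 ltW// lam_gt0.
elim: m => [|m IH].
  by rewrite big_geq// /lam !expr0 divr1 invr1 mulr1 subrr mul0r.
rewrite big_nat_recr//= IH -EFinD lamS; congr EFin.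
by field; rewrite gt_eqF// lam_gt0.
Qed.

End level_sums.

Section A1_power_core.
Context d (T : measurableType d) (R : realType).
Variable mu : {measure set T -> \bar R}.
Variables (e C K beta q : R) (M n : nat) (H : set T) (L s : R) (v sg : T -> R).
Hypotheses (e0 : (0 < e)%R) (C0 : (0 < C)%R) (K1 : (1 <= K)%R).
Hypotheses (beta0 : (0 <= beta)%R) (betaM : (beta ^+ M <= 4^-1)%R).
Hypotheses (q0 : (0 < q)%R) (qM : ((n.+1 * M)%:R <= q)%R).
Hypotheses (mH : measurable H) (HL : mu H = L%:E) (L0 : (0 < L)%R).
Hypotheses (mv : measurable_fun setT v) (v0 : forall x, (0 < v x)%R).
Hypotheses (msg : measurable_fun setT sg) (sg0 : forall x, (0 < sg x)%R).
Hypothesis nuoo : \int[mu]_(x in H) (sg x)%:E < +oo.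
Hypothesis A1 : {ae mu, forall x, H x ->
  \int[mu]_(y in H) (sg y)%:E <= (K * L * sg x)%:E}.
Hypothesis decay : forall m A, measurable A -> A `<=` H ->
  mu A < (((2 ^+ n.+1)^-1) ^+ m * L)%:E ->
  \int[mu]_(x in A) (sg x)%:E <= (beta ^+ m)%:E * \int[mu]_(x in H) (sg x)%:E.
Hypotheses (s0 : (0 < s)%R) (sv : \int[mu]_(x in H) (v x)%:E <= (C * s * L)%:E).
Hypothesis sve : \int[mu]_(x in H) (v x `^ (- e))%:E <= (C * s `^ (- e) * L)%:E.

Definition A1_power_const (e C K q : R) : R :=
  (K `^ (q * e) * C + 5 * (2 * C) `^ q^-1)%R.

Let K0 : (0 < K)%R. Proof. exact: lt_le_trans K1. Qed.

(** Let y and s be the scales of sg and v on the cube H. The negative power is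
    bounded through sg >= y / K. For the integral of sg v^(1/q), the level sets
    of v^(1/q) have measure at most 2^(-q k) by Chebyshev's inequality, hence for
    q large sg-measure at most 4^-k times that of the cube by the decay of A_1
    weights; the levels 2^k then sum up to a constant times y s^(1/q). *)
Lemma A1_power_cube : exists2 s' : R, (0 < s')%R &
  \int[mu]_(x in H) (sg x * v x `^ q^-1)%:E <= (A1_power_const e C K q * s' * L)%:E /\
  \int[mu]_(x in H) ((sg x * v x `^ q^-1) `^ (- (q * e)))%:E <=
    (A1_power_const e C K q * s' `^ (- (q * e)) * L)%:E.
Proof.
have qi0 : (0 < q^-1)%R by rewrite invr_gt0.
have mvq : measurable_fun setT (fun x => v x `^ q^-1)%R by exact: measurable_fun_powR.
have mw : measurable_fun setT (fun x => sg x * v x `^ q^-1)%R by exact: measurable_funM.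
have w0 x : (0 < sg x * v x `^ q^-1)%R by rewrite mulr_gt0// powR_gt0.
have mE (f : T -> R) D : measurable_fun setT f -> measurable_fun D (fun x => (f x)%:E).
  by move=> mf; apply: measurable_funTS; exact: measurableT_comp.
have mve : measurable_fun setT (fun x => v x `^ (- e))%R by exact: measurable_fun_powR.
have H0 : 0 < mu H by rewrite HL lte_fin.
have nu0 : 0 < \int[mu]_(x in H) (sg x)%:E.
  by apply: integral_gt0 => //; exact: mE.
pose N := fine (\int[mu]_(x in H) (sg x)%:E).
have NE : \int[mu]_(x in H) (sg x)%:E = N%:E.
  by rewrite fineK// ge0_fin_numE// ltW.
have N0 : (0 < N)%R by rewrite -lte_fin -NE.
pose y := (N / L)%R; have y0 : (0 < y)%R by rewrite divr_gt0.
have sgy : {ae mu, forall x, H x -> (y / K <= sg x)%R}.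
  apply: filterS A1 => x h /h; rewrite NE lee_fin => h'.
  rewrite /y ler_pdivrMr// ler_pdivrMr//; apply: (le_trans h').
  by rewrite le_eqVlt; apply/orP; left; apply/eqP; ring.
exists (y * s `^ q^-1)%R; first by rewrite mulr_gt0// powR_gt0.
split; last first.
  apply: (@le_trans _ _ (\int[mu]_(x in H) (((y / K) `^ (- (q * e)))%:E * (v x `^ (- e))%:E))).
    apply: ae_ge0_le_integral => //.
    - by move=> x _; rewrite lee_fin powR_ge0.
    - by apply: mE; exact: measurable_fun_powR.
    - by move=> x _; rewrite -EFinM lee_fin mulr_ge0// powR_ge0.
    - by apply: measurable_funeM; exact: mE.
    apply: filterS sgy => x h /h sgx; rewrite -EFinM lee_fin.
    rewrite powRM ?powR_ge0 ?(ltW (sg0 x))//.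
    have -> : ((v x `^ q^-1) `^ (- (q * e)) = v x `^ (- e))%R.
      by rewrite -powRrM mulrN mulrA mulVf ?mul1r// gt_eqF.
    rewrite ler_wpM2r ?powR_ge0// ler_powRN ?divr_gt0//.
    by rewrite mulr_ge0 ?(ltW q0) ?(ltW e0).
  rewrite ge0_integralZl//; last 3 first.
  - exact: mE.
  - by move=> x _; rewrite lee_fin powR_ge0.
  - by rewrite lee_fin powR_ge0.
  apply: (@le_trans _ _ (((y / K) `^ (- (q * e)))%:E * (C * s `^ (- e) * L)%:E)).
    by apply: lee_wpmul2l => //; rewrite lee_fin powR_ge0.
  rewrite -EFinM lee_fin powRM ?invr_ge0 ?(ltW y0) ?(ltW K0)//.
  rewrite [((y * _) `^ _)%R]powRM ?powR_ge0 ?(ltW y0)//.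
  have -> : ((s `^ q^-1) `^ (- (q * e)) = s `^ (- e))%R.
    by rewrite -powRrM mulrN mulrA mulVf ?mul1r// gt_eqF.
  have -> : (K^-1 `^ (- (q * e)) = K `^ (q * e))%R.
    by rewrite -(powR_inv1 (ltW K0)) -powRrM mulN1r opprK.
  have -> : (y `^ (- (q * e)) * K `^ (q * e) * (C * s `^ (- e) * L) =
     K `^ (q * e) * C * (y `^ (- (q * e)) * s `^ (- e) * L))%R by ring.
  rewrite -[leRHS]mulrA ler_wpM2r ?mulr_ge0 ?powR_ge0 ?(ltW L0)//.
  by rewrite lerDl mulr_ge0// powR_ge0.
(* the factor 2 leaves room for the strict inequality of [decay] *)
pose t := ((2 * C * s) `^ q^-1)%R.
have t0 : (0 < t)%R by rewrite powR_gt0// !mulr_gt0.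
pose z x := (v x `^ q^-1 / t)%R.
have z0 x : (0 <= z x)%R by rewrite divr_ge0 ?powR_ge0// ltW.
have mz : measurable_fun setT z.
  by apply: measurable_funM => //; exact: measurable_fun_powR.
pose A k := H `&` [set x | (lam 0 k)%:E < (z x)%:E].
have mA j : measurable (A j).
  by apply: measurableI => //; apply: measurable_superlevel; exact: mE.
pose theta : R := ((2 ^+ n.+1)^-1)%R.
(* [z > 2^j] means [v > 2 C s 2^(q j)], so this is Chebyshev's inequality *)
have muA j : mu (A j) < (theta ^+ (M * j) * L)%:E.
  pose c := (2 * C * s * lam 0 j `^ q)%R.
  have c0 : (0 < c)%R by rewrite !mulr_gt0// powR_gt0// lam_gt0.
  have cA : c%:E * mu (A j) <= (C * s * L)%:E.
    apply: le_trans sv; rewrite -integral_cst//.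
    apply: (@le_trans _ _ (\int[mu]_(x in A j) (v x)%:E)).
      apply: le_integral_nng => //; first exact: mE.
        by move=> x _; rewrite lee_fin ltW.
      move=> x [_ /=]; rewrite lte_fin => zx; rewrite lee_fin /c.
      rewrite /z ltr_pdivlMr// in zx.
      have -> : (v x = (v x `^ q^-1) `^ q)%R.
        by rewrite -powRrM mulVf ?gt_eqF// powRr1// ltW.
      apply: (@le_trans _ _ ((lam 0 j * t) `^ q)%R).
        rewrite powRM ?(ltW (lam_gt0 _ _)) ?(ltW t0)// /t -powRrM mulVf ?gt_eqF//.
        by rewrite powRr1 ?mulr_ge0 ?(ltW C0) ?(ltW s0)// mulrC.
      apply: (ge0_ler_powR (ltW q0)); rewrite ?nnegrE ?powR_ge0 ?(ltW zx)//.
      by rewrite mulr_ge0// ltW// lam_gt0.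
    apply: ge0_subset_integral => //; first exact: mE.
      by move=> x _; rewrite lee_fin ltW.
    exact: subIsetl.
  have mfin : mu (A j) \is a fin_num.
    rewrite ge0_fin_numE//; apply: (@le_lt_trans _ _ (mu H)).
      by apply: le_measure; rewrite ?inE//; exact: subIsetl.
    by rewrite HL ltry.
  rewrite -(fineK mfin) in cA *; rewrite -EFinM lee_fin in cA; rewrite lte_fin.
  have lq : (theta ^+ (M * j) * lam 0 j `^ q >= 1)%R.
    rewrite /theta exprVn -ler_pdivrMl ?invr_gt0 ?exprn_gt0// invrK mulr1.
    rewrite /lam expr0 divr1 -exprM mulnA exprM.
    have -> : ((2 ^+ (n.+1 * M)) ^+ j = (2 ^+ j) `^ (n.+1 * M)%:R :> R)%R.
      by rewrite powR_mulrn ?exprn_ge0// -!exprM mulnC.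
    by apply: ler_powR => //; rewrite exprn_ege1// ler1n.
  have c2 : (c * fine (mu (A j)) <= c * (L / (2 * lam 0 j `^ q)))%R.
    apply: (le_trans cA); rewrite /c le_eqVlt; apply/orP; left; apply/eqP.
    by field; rewrite gt_eqF// powR_gt0// lam_gt0.
  rewrite ler_pM2l// in c2; apply: (le_lt_trans c2).
  have lp : (0 < lam 0 j `^ q)%R by rewrite powR_gt0// lam_gt0.
  rewrite ltr_pdivrMr ?mulr_gt0//.
  have -> : (theta ^+ (M * j) * L * (2 * lam 0 j `^ q) =
     2 * L * (theta ^+ (M * j) * lam 0 j `^ q))%R by ring.
  apply: (@lt_le_trans _ _ (2 * L * 1)%R); first by rewrite mulr1 ltr_pMl// ltr1n.
  by rewrite ler_pM2l// mulr_gt0.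
have nuA j : \int[mu]_(x in A j) (sg x)%:E <= ((lam 0 j)^-1 * (lam 0 j)^-1 * N)%:E.
  apply: (le_trans (decay (mA j) (@subIsetl _ _ _) (muA j))).
  rewrite NE -EFinM lee_fin ler_pM2r// exprM.
  have -> : ((lam 0 j)^-1 * (lam 0 j)^-1 = 4^-1 ^+ j :> R)%R.
    rewrite /lam expr0 divr1 -invfM -exprMn -exprVn; congr (_^-1 ^+ _)%R; ring.
  by apply: lerXn2r; rewrite ?nnegrE ?exprn_ge0.
have sgz : \int[mu]_(x in H) (sg x * z x)%:E <= (5 * N)%:E.
  pose u j x := (sg x)%:E * (if (lam 0 j < z x)%R then (2 * lam 0 j)%:E else 0).
  have u0 j x : 0 <= u j x.
    by rewrite mule_ge0 ?lee_fin ?(ltW (sg0 _))//; case: ifP => // _;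
      rewrite lee_fin mulr_ge0// ltW// lam_gt0.
  have uE j x : u j x = if (lam 0 j)%:E < (z x)%:E then (2 * lam 0 j)%:E * (sg x)%:E else 0.
    by rewrite /u lte_fin; case: ifP => _; rewrite ?mule0// muleC.
  have mu_ j : measurable_fun setT (u j).
    rewrite (_ : u j = fun x => if (lam 0 j)%:E < (z x)%:E
        then (2 * lam 0 j)%:E * (sg x)%:E else 0); last exact/funext.
    apply: measurable_if_superlevel; first exact: mE.
    by apply: measurable_funeM; exact: mE.
  apply: (@le_trans _ _ (\int[mu]_(x in H) ((sg x)%:E + \sum_(j <oo) u j x))).
    apply: le_integral_nng => //.
    - by apply: mE; exact: measurable_funM.
    - apply: emeasurable_funD; first exact: mE.
      by apply: ge0_emeasurable_sum => [j x _ _|j _]; [exact: u0|exact: measurable_funTS].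
    - by move=> x _; rewrite lee_fin mulr_ge0// ltW.
    move=> x _; rewrite EFinM nneseriesZl; last first.
      by move=> j _; case: ifP => // _; rewrite lee_fin mulr_ge0// ltW// lam_gt0.
    rewrite -[X in _ <= X + _]mule1 -ge0_muleDr//; last first.
      apply: nneseries_ge0 => j _ _; case: ifP => // _.
      by rewrite lee_fin mulr_ge0// ltW// lam_gt0.
    by apply: lee_wpmul2l; [rewrite lee_fin ltW|exact: le_one_levels].
  rewrite ge0_integralD//; last 4 first.
  - by move=> x _; rewrite lee_fin ltW.
  - exact: mE.
  - by move=> x _; exact: nneseries_ge0.
  - by apply: ge0_emeasurable_sum => [j x _ _|j _]; [exact: u0|exact: measurable_funTS].
  rewrite NE integral_nneseries//; last by move=> j; exact: measurable_funTS.
  have -> : (5 * N = N + 4 * N)%R by ring.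
  rewrite EFinD; apply: leeD => //.
  apply: le_trans (geometric_halves (ltW N0)); apply: lee_nneseries => j _.
    by move=> _; exact: integral_ge0.
  have -> : \int[mu]_(x in H) u j x = (2 * lam 0 j)%:E * \int[mu]_(x in A j) (sg x)%:E.
    rewrite -ge0_integralZl//; last 3 first.
    - exact: mE.
    - by move=> x _; rewrite lee_fin ltW.
    - by rewrite lee_fin mulr_ge0// ltW// lam_gt0.
    rewrite /A integral_mkcondr; apply: eq_integral => x _; rewrite patchE uE.
    by case: ifPn => [h|h]; [rewrite mem_set|rewrite memNset//; exact/negP].
  apply: (@le_trans _ _ ((2 * lam 0 j)%:E * ((lam 0 j)^-1 * (lam 0 j)^-1 * N)%:E)).
    by apply: lee_wpmul2l => //; rewrite lee_fin mulr_ge0// ltW// lam_gt0.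
  rewrite -EFinM lee_fin le_eqVlt; apply/orP; left; apply/eqP.
  by field; rewrite gt_eqF// lam_gt0.
have -> : \int[mu]_(x in H) (sg x * v x `^ q^-1)%:E =
    t%:E * \int[mu]_(x in H) (sg x * z x)%:E.
  rewrite -ge0_integralZl//; last 3 first.
  - by apply: mE; exact: measurable_funM.
  - by move=> x _; rewrite lee_fin mulr_ge0// ltW.
  - by rewrite lee_fin ltW.
  apply: eq_integral => x _; rewrite -EFinM; congr EFin.
  by rewrite /z; field; rewrite gt_eqF.
apply: (@le_trans _ _ (t%:E * (5 * N)%:E)).
  by apply: lee_wpmul2l => //; rewrite lee_fin ltW.
rewrite -EFinM lee_fin /t powRM ?mulr_ge0 ?(ltW C0) ?(ltW s0)//.
have -> : (A1_power_const e C K q * (y * s `^ q^-1) * L = A1_power_const e C K q * (s `^ q^-1 * N))%R.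
  by rewrite /y; field; rewrite gt_eqF.
have -> : ((2 * C) `^ q^-1 * s `^ q^-1 * (5 * N) =
    5 * (2 * C) `^ q^-1 * (s `^ q^-1 * N))%R by ring.
rewrite ler_wpM2r ?mulr_ge0 ?powR_ge0 ?(ltW N0)//.
by rewrite lerDr mulr_ge0 ?powR_ge0 ?(ltW C0).
Qed.

End A1_power_core.

Lemma A1_power_const_gt0 (R : realType) (e C K q : R) : (0 < C)%R -> (1 <= K)%R ->
  (0 < A1_power_const e C K q)%R.
Proof.
move=> C0 K1; have K0 : (0 < K)%R := lt_le_trans ltr01 K1.
by rewrite addr_gt0// mulr_gt0// powR_gt0// mulr_gt0.
Qed.

Section A1_times_power.
Variables (R : realType) (n : nat).
Local Notation E := (euclidean R n).
Local Notation mu := (euclidean_lebesgue R n).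
Local Notation b := (cube_basis R n).

(** The boundary of a cube is negligible. *)
Lemma integral_cube_hcube a l (f : E -> \bar R) : (0 < l)%R ->
  measurable_fun setT f -> (forall x, 0 <= f x) ->
  \int[mu]_(x in cube a l) f x = \int[mu]_(x in hcube a l) f x.
Proof.
move=> l0 mf f0; have mC := measurable_cube a l; have mH := measurable_hcube a l.
have HC := @hcube_sub R n a l.
rewrite -[in LHS](setDUK HC) ge0_integral_setU//; last 3 first.
- exact: measurableD.
- exact: measurable_funTS.
- by apply/disj_setPS => x [Ax []].
have D0 : mu (cube a l `\` hcube a l) = 0.
  have muC := mu_cube a l0; have muH := mu_hcube a l0.
  rewrite measureD//; last by rewrite [X in X < _]muC ltry.
  rewrite setIidr//; apply: (@etrans _ _ ((l ^+ n)%:E - (l ^+ n)%:E)).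
    by congr (_ - _).
  by rewrite -EFinB subrr.
rewrite [X in _ + X](_ : _ = 0) ?adde0//.
under eq_integral do rewrite -(gee0_abs (f0 _)).
by apply: integral_abs_eq0 => //; [exact: measurableD|exact: measurable_funTS].
Qed.

Variables (e C K : R) (v : E -> R) (M : nat) (q : R).
Hypotheses (e0 : (0 < e)%R) (C0 : (0 < C)%R) (K1 : (1 <= K)%R).
Hypothesis Av : Acond b e C v.
Hypothesis betaM : (A1_beta K ^+ M <= 4^-1)%R.
Hypotheses (q0 : (0 < q)%R) (qM : ((n.+1 * M)%:R <= q)%R).

Lemma Acond_A1_power (sg : E -> R) :
  measurable_fun setT sg -> (forall x, (0 < sg x)%R) ->
  (forall a l, (0 < l)%R -> {ae mu, forall x, hcube a l x ->
    \int[mu]_(y in hcube a l) (sg y)%:E <= (K * l ^+ n * sg x)%:E}) ->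
  Acond b (q * e) (A1_power_const e C K q) (fun x => sg x * v x `^ q^-1)%R.
Proof.
move=> msg sg0 A1; have [mv v0 vQ] := Av.
have mvq := @measurable_fun_powR R _ _ v q^-1 setT mv.
have mve := @measurable_fun_powR R _ _ v (- e) setT mv.
have mw := measurable_funM msg mvq.
have w0 x : (0 < sg x * v x `^ q^-1)%R by rewrite mulr_gt0// powR_gt0.
have mwe := @measurable_fun_powR R _ _ _ (- (q * e)) setT mw.
split; [exact: mw|exact: w0|move=> k].
have [s s0 [sv sve]] := vQ k.
have l0 : (0 < rside R n k)%R := rside_gt0 R n k.
have L0 : (0 < rside R n k ^+ n)%R by rewrite exprn_gt0.
have LE : bvol b k = (rside R n k ^+ n)%R.
  by rewrite /bvol (mu_cube (@rcorner R n k) l0).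
have CH (f : E -> R) : measurable_fun setT f -> (forall x, (0 <= f x)%R) ->
    \int[mu]_(x in bset b k) (f x)%:E =
    \int[mu]_(x in hcube (@rcorner R n k) (rside R n k)) (f x)%:E.
  move=> mf f0; apply: (@integral_cube_hcube _ _ (EFin \o f) l0).
    by apply: measurableT_comp => //; exact: mf.
  by move=> x; rewrite lee_fin; exact: f0.
rewrite LE (CH _ mw (fun x => ltW (w0 x))) (CH _ mwe (fun x => powR_ge0 _ _)).
rewrite LE (CH _ mv (fun x => ltW (v0 x))) in sv.
rewrite LE (CH _ mve (fun x => powR_ge0 _ _)) in sve.
have thE : A1_theta R n = (2 ^+ n.+1)^-1%R by rewrite /A1_theta exprS invfM mulrC.
apply: (@A1_power_cube _ _ _ mu e C K (A1_beta K) q M n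
  (hcube (@rcorner R n k) (rside R n k)) (rside R n k ^+ n)%R s v sg) => //.
- exact: (A1_beta_ge0 K1).
- exact: measurable_hcube.
- exact: (mu_hcube _ l0).
- exact: (A1_hcube_lty A1 _ l0).
- exact: (A1 _ _ l0).
- move=> m A mA AH; rewrite -thE => muA.
  exact: (A1_decay K1 msg sg0 A1 l0 mA AH muA).
Qed.

End A1_times_power.

(** * The bipolar theorem *)

Section bipolar.
Context d (T : measurableType d) (R : realType).
Variable mu : {measure set T -> \bar R}.
Variable rho : T -> R.
Hypotheses (mrho : measurable_fun setT rho) (rho0 : forall x, (0 < rho x)%R).

Definition rint (f : T -> R) : \bar R := \int[mu]_x (f x * rho x)%:E.

Implicit Types f g h : T -> R.

Let mrE f : measurable_fun setT f -> measurable_fun setT (fun x => (f x * rho x)%:E).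
Proof. by move=> mf; apply: measurableT_comp => //; exact: measurable_funM. Qed.

Let rE0 (t : R) x : (0 <= t)%R -> 0 <= (t * rho x)%:E.
Proof. by move=> t0; rewrite lee_fin mulr_ge0// ltW. Qed.

Lemma rint_ge0 f : (forall x, (0 <= f x)%R) -> 0 <= rint f.
Proof. by move=> f0; apply: integral_ge0 => x _; exact: rE0. Qed.

Lemma rintD f g : measurable_fun setT f -> measurable_fun setT g ->
  (forall x, (0 <= f x)%R) -> (forall x, (0 <= g x)%R) ->
  rint (fun x => f x + g x)%R = rint f + rint g.
Proof.
move=> mf mg f0 g0; rewrite /rint -ge0_integralD//.
- by apply: eq_integral => x _; rewrite mulrDl EFinD.
- by move=> x _; exact: rE0.
- exact: mrE.
- by move=> x _; exact: rE0.
- exact: mrE.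
Qed.

Lemma rintZ (c : R) f : (0 <= c)%R -> measurable_fun setT f ->
  (forall x, (0 <= f x)%R) -> rint (fun x => c * f x)%R = c%:E * rint f.
Proof.
move=> c0 mf f0; rewrite /rint -ge0_integralZl//.
- by apply: eq_integral => x _; rewrite -mulrA EFinM.
- exact: mrE.
- by move=> x _; exact: rE0.
Qed.

Lemma rint_le f g : measurable_fun setT f -> measurable_fun setT g ->
  (forall x, (0 <= f x)%R) -> (forall x, (f x <= g x)%R) -> rint f <= rint g.
Proof.
move=> mf mg f0 fg; apply: le_integral_nng => //; try exact: mrE.
- by move=> x _; exact: rE0.
- by move=> x _; rewrite lee_fin ler_wpM2r// ltW.
Qed.

Variable P : (T -> \bar R) -> Prop.
Hypothesis P_le : forall u v : T -> \bar R,
  measurable_fun setT u -> measurable_fun setT v -> (forall x, 0 <= u x) ->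
  {ae mu, forall x, u x <= v x} -> P v -> P u.
Hypothesis P_convex : forall f g (t : R),
  measurable_fun setT f -> measurable_fun setT g ->
  (forall x, (0 <= f x)%R) -> (forall x, (0 <= g x)%R) -> (0 <= t <= 1)%R ->
  P (EFin \o f) -> P (EFin \o g) -> P (fun x => ((1 - t) * f x + t * g x)%:E).
Hypothesis P_sup : forall u : nat -> T -> \bar R,
  (forall k, measurable_fun setT (u k)) -> (forall k x, 0 <= u k x) ->
  (forall x, nondecreasing_seq (u ^~ x)) -> (forall k, P (u k)) ->
  P (fun x => ereal_sup (range (u ^~ x))).

Section bounded.
Variables (A : set T) (N c : R) (F : T -> R).
Hypotheses (mA : measurable A) (Aoo : \int[mu]_(x in A) (rho x)%:E < +oo).
Hypotheses (c0 : (0 < c)%R) (PA : P (fun x => (c * \1_A x)%:E)).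
Hypotheses (N0 : (0 <= N)%R) (mF : measurable_fun setT F).
Hypotheses (F0 : forall x, (0 <= F x)%R) (FN : forall x, (F x <= N * \1_A x)%R).
Hypothesis PF : ~ P (EFin \o F).

Let m1A : measurable_fun setT (\1_A : T -> R).
Proof. exact: measurable_indic. Qed.

Let rint1A : rint (\1_A : T -> R) < +oo.
Proof.
rewrite (_ : rint _ = \int[mu]_(x in A) (rho x)%:E)//.
rewrite [RHS]integral_mkcond; apply: eq_integral => x _.
by rewrite patchE indicE; case: ifP => _; rewrite ?mul1r ?mul0r.
Qed.

Let rint_bounded f (B : R) : (0 <= B)%R -> measurable_fun setT f ->
  (forall x, (0 <= f x)%R) -> (forall x, (f x <= B * \1_A x)%R) ->
  rint f <= B%:E * rint (\1_A : T -> R) /\ rint f < +oo.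
Proof.
move=> B0 mf f0 fB.
have H : rint f <= B%:E * rint (\1_A : T -> R).
  by rewrite -rintZ//; apply: rint_le => //; exact: measurable_funM.
by split => //; apply: (le_lt_trans H); rewrite lte_mul_pinfty.
Qed.

(** Elements of the convex set below F. They are bounded and supported in A, so
    that everything takes place in the square integrable functions. *)
Let admissible g := [/\ measurable_fun setT g, (forall x, (0 <= g x <= F x)%R) &
  P (EFin \o g)].

Let J g : R := fine (rint (fun x => (F x - g x) ^+ 2)%R).

Let msq g : measurable_fun setT g -> measurable_fun setT (fun x => (F x - g x) ^+ 2)%R.
Proof. by move=> mg; apply: measurable_funX; exact: measurable_funB. Qed.

Let JE g : measurable_fun setT g -> (forall x, (0 <= g x <= F x)%R) ->
  rint (fun x => (F x - g x) ^+ 2)%R = (J g)%:E.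
Proof.
move=> mg gF; rewrite fineK// ge0_fin_numE; last by apply: rint_ge0 => x; exact: sqr_ge0.
apply: (rint_bounded (B := (N * N)%R) _ _ _ _).2 => //.
- exact: mulr_ge0.
- exact: msq.
- by move=> x; exact: sqr_ge0.
- move=> x; have /andP[g0 gx] := gF x; have := FN x; rewrite indicE.
  case: (x \in A) => /= h; last by have := F0 x; nra.
  by have := F0 x; nra.
Qed.

Let adm0 : admissible (fun=> 0%R).
Proof.
split=> //; first by move=> x; rewrite lexx F0.
apply: P_le PA => //=.
- exact: measurable_cst.
- by apply: measurableT_comp => //; exact: measurable_funM.
- by apply: aeW => x; rewrite lee_fin mulr_ge0// ltW.
Qed.

Let dJ : R := inf [set J g | g in admissible].

Let dJ_le g : admissible g -> (dJ <= J g)%R.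
Proof.
move=> ag; apply: ge_inf; last by exists g.
exists 0%R => _ [h [mh hF _] <-]; rewrite -lee_fin -JE//.
by apply: rint_ge0 => x; exact: sqr_ge0.
Qed.

Let min_seq : exists g_ : nat -> T -> R,
  forall k, admissible (g_ k) /\ (J (g_ k) < dJ + 4^-1 ^+ k)%R.
Proof.
suff /choice[g_ gP] : forall k, exists g, admissible g /\ (J g < dJ + 4^-1 ^+ k)%R.
  by exists g_.
move=> k.
have [_ [g ag <-] Jg] : exists2 y, [set J g | g in admissible] y & (y < dJ + 4^-1 ^+ k)%R.
  apply: inf_lt; last by rewrite ltrDl exprn_gt0.
  by exists (J (fun=> 0%R)); exists (fun=> 0%R).
by exists g.
Qed.

(** A minimizer of the distance to [F]: by the parallelogram identity a
    minimizing sequence satisfies sum_k 2^k ||g_(k+1) - g_k||^2 < oo, hence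
    converges almost everywhere. *)
Let minimizer : exists2 g, admissible g & J g = dJ.
Proof.
have [g_ gP] := min_seq.
have ag k : admissible (g_ k) by have [] := gP k.
have mg k : measurable_fun setT (g_ k) by have [] := ag k.
have gF k x : (0 <= g_ k x <= F x)%R by have [] := ag k.
have Pg k : P (EFin \o g_ k) by have [] := ag k.
pose D k x := ((g_ k.+1 x - g_ k x) ^+ 2)%R.
have mD k : measurable_fun setT (D k) by apply: measurable_funX; exact: measurable_funB.
have D0 k x : (0 <= D k x)%R by exact: sqr_ge0.
(* the parallelogram identity for g_k and g_(k+1), whose midpoint is again
   admissible and so not closer to F than the infimum *)
have DI k : rint (D k) <= (4 * 4^-1 ^+ k)%:E.
  pose h x := ((1 - 2^-1) * g_ k x + 2^-1 * g_ k.+1 x)%R.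
  have ah : admissible h.
    split.
    - by apply: measurable_funD; exact: measurable_funM.
    - by move=> x; have /andP[? ?] := gF k x; have /andP[? ?] := gF k.+1 x;
        rewrite /h; apply/andP; split; lra.
    - apply: P_convex => //; [by move=> x; have /andP[] := gF k x|
        by move=> x; have /andP[] := gF k.+1 x|by apply/andP; split; lra].
  have [mh hF _] := ah.
  have E1 : 2%:E * (J h)%:E + (2^-1)%:E * rint (D k) = (J (g_ k))%:E + (J (g_ k.+1))%:E.
    rewrite -!JE// -!rintZ//; last 2 first.
    - exact: msq.
    - by move=> x; exact: sqr_ge0.
    rewrite -!rintD//; try (by move=> x; exact: sqr_ge0); try exact: msq.
    - by congr rint; apply/funext => x; rewrite /h /D; field.
    - by apply: measurable_funM => //; exact: msq.
    - exact: measurable_funM.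
    - by move=> x; rewrite mulr_ge0// sqr_ge0.
    - by move=> x; rewrite mulr_ge0.
  have I0 := rint_ge0 (D0 k).
  have Ioo : rint (D k) < +oo.
    rewrite ltey; apply/eqP => Ey; move: E1; rewrite Ey.
    have -> : (2^-1)%:E * +oo = +oo :> \bar R by rewrite gt0_muley// lte_fin.
    by rewrite addey.
  have Ifin : rint (D k) \is a fin_num by rewrite ge0_fin_numE.
  rewrite -(fineK Ifin) lee_fin; move: E1; rewrite -(fineK Ifin) -!EFinM -!EFinD => -[E1].
  have dh := dJ_le ah; have [_ J1] := gP k; have [_ J2] := gP k.+1.
  have k0 : (0 < 4^-1 ^+ k :> R)%R by rewrite exprn_gt0.
  by rewrite exprS in J2; rewrite /=; lra.
have t0 k x : 0 <= (2 ^+ k * D k x * rho x)%:E.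
  by apply: rE0; apply: mulr_ge0 => //; exact: exprn_ge0.
have cvgae : {ae mu, forall x, cvgn (g_ ^~ x)}.
  have mS : measurable_fun setT (fun x => \sum_(k <oo) (2 ^+ k * D k x * rho x)%:E).
    apply: ge0_emeasurable_sum => k.
      by move=> x _ _; exact: t0.
    by move=> _; apply: measurableT_comp => //; apply: measurable_funM => //; exact: measurable_funM.
  have : {ae mu, forall x, \sum_(k <oo) (2 ^+ k * D k x * rho x)%:E < +oo}.
    apply: ae_lty_integral => //.
      by move=> x; apply: nneseries_ge0 => k _ _; exact: t0.
    rewrite integral_nneseries//; last first.
    - by move=> k; apply: measurableT_comp => //; apply: measurable_funM => //; exact: measurable_funM.
    apply: (@le_lt_trans _ _ (4 * 2)%:E); last exact: ltry.
    apply: (@le_trans _ _ (\sum_(k <oo) (2 * (lam 0 k)^-1 * 2)%:E)); last first.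
      by apply: geometric_halves.
    apply: lee_nneseries => k _.
      by move=> _; apply: integral_ge0 => x _; exact: t0.
    rewrite -[leLHS]/(rint (fun x => 2 ^+ k * D k x)%R) rintZ//.
    apply: (@le_trans _ _ ((2 ^+ k)%:E * (4 * 4^-1 ^+ k)%:E)).
      by apply: lee_wpmul2l => //; rewrite lee_fin exprn_ge0.
    rewrite -EFinM lee_fin /lam expr0 divr1 le_eqVlt; apply/orP; left; apply/eqP.
    have -> : (4^-1 ^+ k = (2 ^+ k)^-1 * (2 ^+ k)^-1 :> R)%R.
      by rewrite -invfM -exprMn -exprVn; congr (_^-1 ^+ _)%R; ring.
    by field; rewrite expf_neq0.
  apply: filterS => x Sx.
  suff : cvgn (series (fun k => g_ k.+1 x - g_ k x)%R).
    move=> cs.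
    rewrite (_ : g_ ^~ x =
        fun k => g_ 0%N x + series (fun k => g_ k.+1 x - g_ k x)%R k)%R.
      by apply: is_cvgD => //; exact: is_cvg_cst.
    by apply/funext => k; rewrite /series/= telescope_sumr// addrC subrK.
  suff nc : cvgn [normed series (fun k => g_ k.+1 x - g_ k x)%R].
    exact: (normed_cvg nc).
  apply: nondecreasing_is_cvgn.
    by apply: nondecreasing_series => k _ _; exact: normr_ge0.
  pose s := fine (\sum_(k <oo) (2 ^+ k * D k x * rho x)%:E).
  have sE : \sum_(k <oo) (2 ^+ k * D k x * rho x)%:E = s%:E.
    rewrite fineK// ge0_fin_numE//.
    by apply: nneseries_ge0 => k _ _; exact: t0.
  exists (2 + s / rho x)%R => _ [m _ <-].
  rewrite /series/=.
  have H1 : (\sum_(0 <= k < m) 2 ^+ k * D k x * rho x <= s)%R.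
    rewrite -lee_fin -sE -sumEFin; apply: nneseries_lim_ge => k _ _.
    exact: t0.
  have H2 : (\sum_(0 <= k < m) (2 ^+ k)^-1 <= 2 :> R)%R.
    suff -> : (\sum_(0 <= k < m) (2 ^+ k)^-1 = 2 - 2 * (2 ^+ m)^-1 :> R)%R.
      by rewrite gerBl mulr_ge0// invr_ge0 exprn_ge0.
    elim: m {H1} => [|m IH]; first by rewrite big_geq// expr0 invr1 mulr1 subrr.
    by rewrite big_nat_recr//= IH exprS; field; rewrite expf_neq0.
  apply: (@le_trans _ _ (\sum_(0 <= k < m) ((2 ^+ k)^-1 + 2 ^+ k * D k x)))%R.
    apply: ler_sum => k _; rewrite /D -real_normK ?num_real//
    ; set y := `|_|%R; have k0 : (0 < 2 ^+ k :> R)%R by rewrite exprn_gt0.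
    have [y1|y1] := leP y (2 ^+ k)^-1%R.
      by rewrite (le_trans y1)// lerDl mulr_ge0 ?sqr_ge0// ltW.
    apply: (@le_trans _ _ (2 ^+ k * y ^+ 2)%R); last by rewrite lerDr invr_ge0 ltW.
    rewrite expr2 mulrA ler_peMl ?normr_ge0//.
    by rewrite -ler_pdivrMl// mulr1 ltW.
  rewrite big_split/=; apply: lerD => //.
  by rewrite ler_pdivlMr// mulr_suml.
(* the limit is taken as a lower limit, that is an increasing limit of infima,
   since [P] is stable under smaller functions and increasing limits *)
pose g0E x : \bar R := ereal_sup (range (einfs (fun k => (g_ k x)%:E))).
have einfs_le x k : einfs (fun k => (g_ k x)%:E) k <= (g_ k x)%:E.
  by apply: ereal_inf_lbound; exists k => /=.
have einfs_ge0 x k : 0 <= einfs (fun k => (g_ k x)%:E) k.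
  by apply: le_ereal_inf_tmp => _ [j _ <-]; rewrite lee_fin; have /andP[] := gF j x.
have g0E_ge0 x : 0 <= g0E x by exact: ge0_sup_range.
have g0E_le x : g0E x <= (F x)%:E.
  apply: sup_range_le => k; apply: (le_trans (einfs_le x k)).
  by rewrite lee_fin; have /andP[] := gF k x.
pose g0 x := fine (g0E x).
have g0E_fin x : (g0 x)%:E = g0E x.
  by rewrite fineK// ge0_fin_numE// (le_lt_trans (g0E_le x))// ltry.
have meinfs k : measurable_fun setT (fun x => einfs (fun k => (g_ k x)%:E) k).
  by apply: (measurable_fun_einfs (f := fun k x => (g_ k x)%:E)) => j; exact: measurableT_comp.
have mg0E : measurable_fun setT g0E.
  exact: (@measurable_sup_range _ _ _ setT (fun k x => einfs (fun k => (g_ k x)%:E) k)).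
have mg0 : measurable_fun setT g0 by exact: measurableT_comp.
have Pg0 : P (EFin \o g0).
  rewrite (_ : EFin \o g0 = g0E); last by apply/funext => x /=.
  apply: (P_sup (u := fun k x => einfs (fun k => (g_ k x)%:E) k)) => //.
    by move=> x; exact: nondecreasing_einfs.
  move=> k; apply: P_le (Pg k) => //; first exact: measurableT_comp.
  by apply: aeW => x; exact: einfs_le.
have g0F x : (0 <= g0 x <= F x)%R by rewrite -!lee_fin g0E_fin g0E_ge0 g0E_le.
have ag0 : admissible g0 by [].
exists g0 => //; apply/eqP; rewrite eq_le dJ_le// andbT.
have cv : rint (fun x => (F x - g_ k x) ^+ 2)%R @[k --> \oo] -->
    rint (fun x => (F x - g0 x) ^+ 2)%R.
  have /= [] // := @dominated_convergence _ _ _ mu setT measurableT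
    (fun k x => ((F x - g_ k x) ^+ 2 * rho x)%:E) (fun x => ((F x - g0 x) ^+ 2 * rho x)%:E)
    (fun x => (N * N * \1_A x * rho x)%:E).
  - by move=> k; apply: mrE; exact: msq.
  - by apply: mrE; exact: msq.
  - apply: filterS cvgae => x /cvg_ex[/= l gl] _.
    have g0l : g0 x = l.
      have glE : EFin \o g_ ^~ x @ \oo --> l%:E by apply: cvg_EFin => //; exact: nearW.
      apply: EFin_inj; rewrite g0E_fin.
      rewrite /g0E -(cvg_lim _ (@cvg_einfs_sup _ (fun k => (g_ k x)%:E)))//.
      by apply/cvg_lim => //; exact: cvg_einfs.
    apply: cvg_EFin; first exact: nearW.
    rewrite g0l; apply: cvgM; last exact: cvg_cst.
    have cB : (F x - g_ k x)%R @[k --> \oo] --> (F x - l)%R.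
      by apply: cvgB => //; exact: cvg_cst.
    by rewrite expr2; under eq_fun do rewrite expr2; exact: cvgM.
  - apply/integrableP; split.
      by apply: mrE; exact: measurable_funM.
    under eq_integral do rewrite gee0_abs ?lee_fin ?mulr_ge0 ?(ltW (rho0 _))//.
    rewrite -[X in X < _]/(rint (fun x => N * N * \1_A x)%R) rintZ ?mulr_ge0//.
    by rewrite lte_mul_pinfty// ?lee_fin ?mulr_ge0// rint_ge0.
  - apply: aeW => x k _; rewrite lee_fin ger0_norm; last first.
      by apply: mulr_ge0; [exact: sqr_ge0|exact: ltW].
    rewrite ler_wpM2r ?(ltW (rho0 x))//.
    have /andP[h1 h2] := gF k x; have := FN x; rewrite indicE.
    by case: (x \in A) => /= h; have := F0 x; nra.
rewrite -lee_fin -JE//; apply/lee_addgt0Pr => eps eps0.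
have [k0 k0P] := @lam_ge R 0 (eps^-1 + 1)%R.
rewrite -(cvg_lim _ cv)//; apply: lime_le; first by apply/cvg_ex; eexists; exact: cv.
near=> k; rewrite JE//; have [_ /ltW Jk] := gP k.
rewrite -EFinD lee_fin (le_trans Jk)// lerD2l.
have k0k : (k0 <= k)%N by near: k; exact: nbhs_infty_ge.
apply: (@le_trans _ _ ((lam 0 k0)^-1)%R).
  rewrite /lam expr0 divr1 exprVn lef_pV2 ?posrE ?exprn_gt0//.
  apply: (@le_trans _ _ (4 ^+ k0)%R); first by apply: lerXn2r; rewrite ?nnegrE// ler_nat.
  by rewrite ler_weXn2l// ler1n.
rewrite invf_ple ?posrE ?lam_gt0//; apply: le_trans k0P.
by rewrite lerDl.
Unshelve. all: by end_near. Qed.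

(** The minimizer [g] yields the separating functional [F - g], since moving
    from [g] towards any other admissible function cannot decrease the
    distance to [F]. *)
Lemma separation_bounded : exists h : T -> R, [/\ measurable_fun setT h,
  (forall x, (0 <= h x)%R),
  (forall u : T -> \bar R, measurable_fun setT u -> (forall x, 0 <= u x) -> P u ->
    \int[mu]_x (u x * (h x * rho x)%:E) <= 1) &
  1 < rint (fun x => F x * h x)%R].
Proof.
have [g ag Jg] := minimizer; have [mg gF Pg] := ag.
have g0 x : (0 <= g x)%R by have /andP[] := gF x.
have gF' x : (g x <= F x)%R by have /andP[] := gF x.
pose phi x := (F x - g x)%R.
have mphi : measurable_fun setT phi by exact: measurable_funB.
have phi0 x : (0 <= phi x)%R by rewrite subr_ge0.
have phiN x : (phi x <= N * \1_A x)%R by apply: (le_trans _ (FN x)); rewrite gerBl.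
have gN x : (g x <= N * \1_A x)%R by apply: (le_trans (gF' x)).
have phig0 : 0 <= rint (fun x => phi x * g x)%R.
  by apply: rint_ge0 => x; exact: mulr_ge0.
have mpg : measurable_fun setT (fun x => phi x * g x)%R by exact: measurable_funM.
have [_ phigoo] : rint (fun x => phi x * g x)%R <= (N * N)%:E * rint (\1_A : T -> R) /\
    rint (fun x => phi x * g x)%R < +oo.
  apply: rint_bounded => //; first exact: mulr_ge0.
    by move=> x; exact: mulr_ge0.
  move=> x; have := phiN x; have := gN x; rewrite indicE.
  by case: (x \in A) => /=; have := g0 x; have := phi0 x; nra.
(* the value of the functional at g, which turns out to be its maximum over
   [P]; the function h is phi / gam *)
pose gam := fine (rint (fun x => phi x * g x)%R).
have gamE : rint (fun x => phi x * g x)%R = gam%:E by rewrite fineK// ge0_fin_numE.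
have var (u : T -> R) (B : R) : (0 <= B)%R -> measurable_fun setT u ->
    (forall x, (0 <= u x)%R) -> (forall x, (u x <= B * \1_A x)%R) -> P (EFin \o u) ->
    rint (fun x => phi x * u x)%R <= gam%:E.
  move=> B0 mu' u0 uB Pu.
  have mpu : measurable_fun setT (fun x => phi x * u x)%R by exact: measurable_funM.
  have mug : measurable_fun setT (fun x => (u x - g x) ^+ 2)%R.
    by apply: measurable_funX; exact: measurable_funB.
  have BN0 : (0 <= (B + N) ^+ 2)%R by exact: sqr_ge0.
  have [_ ugoo] : rint (fun x => (u x - g x) ^+ 2)%R <=
      ((B + N) ^+ 2)%:E * rint (\1_A : T -> R) /\
      rint (fun x => (u x - g x) ^+ 2)%R < +oo.
    apply: rint_bounded => //; first by move=> x; exact: sqr_ge0.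
    move=> x; have := uB x; have := gN x; rewrite indicE.
    by case: (x \in A) => /=; have := g0 x; have := u0 x; nra.
  have [_ puoo] : rint (fun x => phi x * u x)%R <= (N * B)%:E * rint (\1_A : T -> R) /\
      rint (fun x => phi x * u x)%R < +oo.
    apply: rint_bounded => //; first exact: mulr_ge0.
      by move=> x; exact: mulr_ge0.
    move=> x; have := phiN x; have := uB x; rewrite indicE.
    by case: (x \in A) => /=; have := u0 x; have := phi0 x; nra.
  pose U := fine (rint (fun x => (u x - g x) ^+ 2)%R).
  have UE : rint (fun x => (u x - g x) ^+ 2)%R = U%:E.
    by rewrite fineK// ge0_fin_numE// rint_ge0// => x; exact: sqr_ge0.
  have U0 : (0 <= U)%R by rewrite -lee_fin -UE rint_ge0// => x; exact: sqr_ge0.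
  pose V := fine (rint (fun x => phi x * u x)%R).
  have VE : rint (fun x => phi x * u x)%R = V%:E.
    by rewrite fineK// ge0_fin_numE// rint_ge0// => x; exact: mulr_ge0.
  (* first variation at g in the direction of u; the convex combination may
     exceed F, and cutting it at F makes it admissible and closer to F *)
  have key (t : R) : (0 < t <= 1)%R -> (2 * V <= 2 * gam + t * U)%R.
    move=> /andP[t0 t1].
    pose gt x := ((1 - t) * g x + t * u x)%R.
    have mgt : measurable_fun setT gt by apply: measurable_funD; exact: measurable_funM.
    have gt0 x : (0 <= gt x)%R by rewrite addr_ge0// mulr_ge0// ?subr_ge0// ltW.
    pose gm x := Num.min (gt x) (F x).
    have mgm : measurable_fun setT gm by exact: measurable_minr.
    have agm : admissible gm.
      split => //.
        by move=> x; rewrite /gm le_min gt0 F0 ge_min lexx orbT.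
      apply: (P_le (v := EFin \o gt)).
      - exact: measurableT_comp.
      - exact: measurableT_comp.
      - by move=> x; rewrite /= lee_fin /gm le_min gt0 F0.
      - by apply: aeW => x; rewrite /= lee_fin /gm ge_min lexx.
      - by apply: P_convex => //; rewrite (ltW t0).
    have gmF x : (0 <= gm x <= F x)%R by have [_ + _] := agm; apply.
    have Jgm := dJ_le agm; rewrite -Jg -lee_fin -!JE// in Jgm.
    have mgt2 := msq mgt.
    have Jgt : rint (fun x => (F x - gm x) ^+ 2)%R <= rint (fun x => (F x - gt x) ^+ 2)%R.
      apply: rint_le => //; first exact: msq.
        by move=> x; exact: sqr_ge0.
      move=> x; rewrite /gm; case: (leP (gt x) (F x)) => // h.
      by rewrite subrr expr0n/=; exact: sqr_ge0.
    have E1 : rint (fun x => (F x - gt x) ^+ 2)%R + (2 * t)%:E * V%:E =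
        rint (fun x => (F x - g x) ^+ 2)%R + ((2 * t)%:E * gam%:E + (t ^+ 2)%:E * U%:E).
      have t2 : (0 <= 2 * t)%R by rewrite mulr_ge0// ltW.
      have tt : (0 <= t ^+ 2)%R by exact: sqr_ge0.
      have mpu2 : measurable_fun setT (fun x => 2 * t * (phi x * u x))%R.
        exact: measurable_funM.
      have mpg2 : measurable_fun setT (fun x => 2 * t * (phi x * g x))%R.
        exact: measurable_funM.
      have mug2 : measurable_fun setT (fun x => t ^+ 2 * (u x - g x) ^+ 2)%R.
        exact: measurable_funM.
      have pu0 x : (0 <= phi x * u x)%R by exact: mulr_ge0.
      have pg0 x : (0 <= phi x * g x)%R by exact: mulr_ge0.
      have ug0 x : (0 <= (u x - g x) ^+ 2)%R by exact: sqr_ge0.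
      have pu2 x : (0 <= 2 * t * (phi x * u x))%R by exact: mulr_ge0.
      have pg2 x : (0 <= 2 * t * (phi x * g x))%R by exact: mulr_ge0.
      have ug2 x : (0 <= t ^+ 2 * (u x - g x) ^+ 2)%R by exact: mulr_ge0.
      rewrite -VE -gamE -UE -(rintZ t2 mpu pu0) -(rintZ t2 mpg pg0) -(rintZ tt mug ug0).
      rewrite -(rintD mpg2 mug2 pg2 ug2) -(rintD mgt2 mpu2 (fun x => sqr_ge0 _) pu2).
      rewrite -rintD.
      - by congr rint; apply/funext => x; rewrite /gt /phi; ring.
      - exact: msq.
      - exact: measurable_funD.
      - by move=> x; exact: sqr_ge0.
      - by move=> x; exact: addr_ge0.
    have : (J g)%:E + (2 * t)%:E * V%:E <= (J g)%:E + ((2 * t)%:E * gam%:E + (t ^+ 2)%:E * U%:E).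
      rewrite -[X in _ <= X + _]JE// -E1; apply: leeD => //.
      by rewrite -JE//; exact: (le_trans Jgm).
    rewrite -!EFinM -!EFinD lee_fin lerD2l => h.
    have : (t * (2 * V) <= t * (2 * gam + t * U))%R by nra.
    by rewrite ler_pM2l.
  rewrite VE lee_fin; apply/ler_addgt0Pr => eps eps0.
  pose t := (Num.min 1 (eps / (U + 1)))%R.
  have U1 : (0 < U + 1)%R by rewrite ltr_wpDl.
  have t0 : (0 < t)%R by rewrite /t lt_min ltr01 divr_gt0.
  have t1 : (t <= 1)%R by rewrite /t ge_min lexx.
  have tU : (t * U <= eps)%R.
    apply: (@le_trans _ _ (eps / (U + 1) * U)%R).
      by rewrite ler_wpM2r// /t ge_min lexx orbT.
    by rewrite mulrAC ler_pdivrMr// ler_pM2l// lerDl.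
  by have := key t; rewrite t0 t1 => /(_ isT); lra.
have vare (u : T -> \bar R) : measurable_fun setT u -> (forall x, 0 <= u x) -> P u ->
    \int[mu]_x (u x * (phi x * rho x)%:E) <= gam%:E.
  move=> mu' u0 Pu.
  pose un (j : nat) x : R := fine (mine (u x) (j%:R * \1_A x)%:E).
  have unE j x : (un j x)%:E = mine (u x) (j%:R * \1_A x)%:E.
    rewrite fineK// ge0_fin_numE ?le_min ?u0 ?lee_fin ?mulr_ge0//.
    by rewrite gt_min ltry orbT.
  have mun j : measurable_fun setT (un j).
    apply: measurableT_comp => //; apply: measurable_mine => //.
    by apply: measurableT_comp => //; exact: measurable_funM.
  have un0 j x : (0 <= un j x)%R.
    by rewrite -lee_fin unE le_min u0 lee_fin mulr_ge0.
  rewrite (_ : \int[mu]_x _ = ereal_sup (range (fun j => rint (fun x => phi x * un j x)%R))).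
    apply: sup_range_le => j; apply: (var _ j%:R) => //.
      by move=> x; rewrite -lee_fin unE ge_min lexx orbT.
    apply: P_le Pu => //; first exact: measurableT_comp.
      by move=> x; rewrite /= lee_fin.
    by apply: aeW => x; rewrite /= unE ge_min lexx.
  rewrite /rint -integral_sup_range//; last 3 first.
  - by move=> j; apply: mrE; exact: measurable_funM.
  - by move=> j x; apply: rE0; exact: mulr_ge0.
  - move=> x i j ij; rewrite lee_fin ler_wpM2r ?(ltW (rho0 x))// ler_wpM2l//.
    rewrite -lee_fin !unE le_min !ge_min lexx/= lee_fin ler_wpM2r ?ler_nat// ?ij ?orbT//.
  apply: eq_integral => x _.
  have -> : (fun j => (phi x * un j x * rho x)%:E) =
      (fun j => mine (u x) (j%:R * \1_A x)%:E * (phi x * rho x)%:E).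
    by apply/funext => j; rewrite -unE -EFinM; congr EFin; ring.
  have [p0|p0] := eqVneq (phi x) 0%R.
    rewrite p0 mul0r mule0; apply/eqP; rewrite eq_le ge0_sup_range/=; last first.
      by move=> j; rewrite mule0.
    by apply: sup_range_le => j; rewrite mule0.
  have pp : (0 < phi x)%R by rewrite lt_neqAle eq_sym p0 phi0.
  have xA : \1_A x = 1%R :> R.
    rewrite indicE; case: (boolP (x \in A)) => // xA.
    by have := phiN x; rewrite indicE (negbTE xA) mulr0 leNgt pp.
  rewrite sup_range_pZr ?mulr_gt0//; congr (_ * _).
  apply/eqP; rewrite eq_le; apply/andP; split; last first.
    by apply: sup_range_le => j; rewrite ge_min lexx.
  have [ux|] := eqVneq (u x) +oo.
    rewrite ux leye_eq; apply/eqP/eqyP => B B0.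
    apply: (le_trans _ (le_sup_range _ (Num.truncn B).+1)).
    by rewrite minye xA mulr1 lee_fin ltW// truncnS_gt.
  rewrite -ltey => ux.
  apply: (le_trans _ (le_sup_range _ (Num.truncn (fine (u x))).+1)).
  rewrite le_min lexx xA mulr1 /= -{1}(@fineK _ (u x)) ?ge0_fin_numE// lee_fin.
  exact/ltW/truncnS_gt.
have phi_n0 : 0 < rint (fun x => phi x * \1_A x)%R.
  rewrite lt_neqAle rint_ge0 ?andbT; last by move=> x; rewrite mulr_ge0.
  apply/eqP => /esym I0; apply: PF.
  have : {ae mu, forall x, (phi x * \1_A x * rho x)%:E = 0}.
    apply: integral_eq0_ae => //; first by apply: mrE; exact: measurable_funM.
    by move=> x; apply: rE0; rewrite mulr_ge0.
  move=> pae; apply: P_le Pg.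
  - exact: measurableT_comp.
  - exact: measurableT_comp.
  - by move=> x; rewrite lee_fin.
  apply: filterS pae => x [] /eqP; rewrite mulf_eq0 [rho x == 0%R]gt_eqF// orbF.
  rewrite /= lee_fin indicE; case: (boolP (x \in A)) => [xA|xA _].
    by rewrite mulr1 /phi subr_eq0 => /eqP ->.
  by have := FN x; rewrite indicE (negbTE xA) mulr0 => /le_trans; apply.
(* the function c on A lies in [P] and phi is not 0 almost everywhere on A *)
have gam0 : (0 < gam)%R.
  have := vare _ _ _ PA.
  have m1 : measurable_fun setT (fun x => (c * \1_A x)%:E).
    by apply: measurableT_comp => //; exact: measurable_funM.
  move=> /(_ m1) H; rewrite -lte_fin; apply: lt_le_trans (H _); last first.
    by move=> x; rewrite lee_fin mulr_ge0// ltW.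
  have -> : \int[mu]_x ((c * \1_A x)%:E * (phi x * rho x)%:E) =
      c%:E * rint (fun x => phi x * \1_A x)%R.
    rewrite -rintZ ?ltW//; last 2 first.
    - exact: measurable_funM.
    - by move=> x; rewrite mulr_ge0.
    by apply: eq_integral => x _; rewrite -EFinM; congr EFin; ring.
  by rewrite mule_gt0.
have gi0 : (0 < gam^-1)%R by rewrite invr_gt0.
have Jg0 : 0 < rint (fun x => phi x ^+ 2)%R.
  rewrite lt_neqAle rint_ge0 ?andbT; last by move=> x; exact: sqr_ge0.
  apply/eqP => /esym I0; move: phi_n0.
  rewrite /rint ae_eq0_integral ?ltxx//.
  - by apply: mrE; exact: measurable_funM.
  - by move=> x; apply: rE0; rewrite mulr_ge0.
  have : {ae mu, forall x, (phi x ^+ 2 * rho x)%:E = 0}.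
    apply: integral_eq0_ae => //; first by apply: mrE; exact: measurable_funX.
    by move=> x; apply: rE0; exact: sqr_ge0.
  apply: filterS => x [] /eqP; rewrite mulf_eq0 [rho x == 0%R]gt_eqF// orbF sqrf_eq0.
  by move=> /eqP ->; rewrite !mul0r.
exists (fun x => gam^-1 * phi x)%R; split.
- exact: measurable_funM.
- by move=> x; rewrite mulr_ge0// ltW.
- move=> u mu' u0 Pu.
  have -> : \int[mu]_x (u x * (gam^-1 * phi x * rho x)%:E) =
      gam^-1%:E * \int[mu]_x (u x * (phi x * rho x)%:E).
    rewrite -ge0_integralZl//; last 3 first.
    - by apply: emeasurable_funM => //; exact: mrE.
    - by move=> x _; rewrite mule_ge0// rE0.
    - by rewrite lee_fin ltW.
    by apply: eq_integral => x _; rewrite muleCA -EFinM mulrA.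
  by rewrite lee_pdivrMl// mule1; exact: vare.
- have -> : rint (fun x => F x * (gam^-1 * phi x))%R =
      gam^-1%:E * (rint (fun x => phi x * g x)%R + rint (fun x => phi x ^+ 2)%R).
    rewrite -rintD//; last 3 first.
    - exact: measurable_funX.
    - by move=> x; exact: mulr_ge0.
    - by move=> x; exact: sqr_ge0.
    rewrite -rintZ ?ltW//; last 2 first.
    - by apply: measurable_funD => //; exact: measurable_funX.
    - by move=> x; rewrite addr_ge0 ?mulr_ge0 ?sqr_ge0.
    by congr rint; apply/funext => x; rewrite /phi; ring.
  by rewrite lte_pdivlMl// mule1 gamE lteDl.
Qed.

End bounded.

Variable A_ : nat -> set T.
Hypotheses (mA_ : forall k, measurable (A_ k)) (ndA : nondecreasing_seq A_).
Hypothesis A_cover : forall x, exists k, A_ k x.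
Hypothesis A_oo : forall k, \int[mu]_(x in A_ k) (rho x)%:E < +oo.
Hypothesis PA_ : forall k, exists2 c : R, (0 < c)%R & P (fun x => (c * \1_(A_ k) x)%:E).

(** The bipolar theorem for a solid convex set of nonnegative functions that
    is closed under increasing limits. Being an increasing limit of bounded
    functions supported in the sets [A_ k], the function f has one of them
    outside [P], which is separated from [P] as in a Hilbert space. *)
Lemma bipolar (f : T -> \bar R) : measurable_fun setT f -> (forall x, 0 <= f x) ->
  ~ P f -> exists h : T -> R, [/\ measurable_fun setT h,
  (forall x, (0 <= h x)%R),
  (forall u : T -> \bar R, measurable_fun setT u -> (forall x, 0 <= u x) -> P u ->
    \int[mu]_x (u x * (h x * rho x)%:E) <= 1) &
  1 < \int[mu]_x (f x * (h x * rho x)%:E)].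
Proof.
move=> mf f0 Pf.
pose F (k : nat) x : R := fine (mine (f x) (k%:R * \1_(A_ k) x)%:E).
have FE k x : (F k x)%:E = mine (f x) (k%:R * \1_(A_ k) x)%:E.
  rewrite fineK// ge0_fin_numE ?le_min ?f0 ?lee_fin ?mulr_ge0//.
  by rewrite gt_min ltry orbT.
have mF k : measurable_fun setT (F k).
  apply: measurableT_comp => //; apply: measurable_mine => //.
  by apply: measurableT_comp => //; apply: measurable_funM => //; exact: measurable_indic.
have F0 k x : (0 <= F k x)%R by rewrite -lee_fin FE le_min f0 lee_fin mulr_ge0.
have Ff k x : (F k x)%:E <= f x by rewrite FE ge_min lexx.
have ind_le i j x : (i <= j)%N -> (\1_(A_ i) x <= \1_(A_ j) x :> R)%R.
  move=> ij; rewrite !indicE; case: (boolP (x \in A_ i)) => // xi.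
  rewrite inE in xi; rewrite [x \in A_ j]mem_set//.
  by have /subsetPset := ndA ij; apply.
have ndF x : nondecreasing_seq (fun k => (F k x)%:E).
  move=> i j ij; rewrite !FE le_min !ge_min lexx/= lee_fin.
  apply/orP; right; apply: ler_pM; [exact: ler0n|by rewrite indicE ler0n|
    by rewrite ler_nat|exact: ind_le].
have supF : (fun x => ereal_sup (range (fun k => (F k x)%:E))) = f.
  apply/funext => x; apply/eqP; rewrite eq_le; apply/andP; split; first exact: sup_range_le.
  have [k Ak] := A_cover x.
  have FkE j : (k <= j)%N -> (F j x)%:E = mine (f x) j%:R%:E.
    move=> kj; rewrite FE indicE mem_set ?mulr1//.
    by have /subsetPset := ndA kj; apply.
  have [fx|] := eqVneq (f x) +oo.
    rewrite fx leye_eq; apply/eqP/eqyP => B B0.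
    pose j := maxn k (Num.truncn B).+1.
    apply: (le_trans _ (le_sup_range _ j)).
    rewrite FkE ?leq_maxl// fx minye lee_fin.
    apply: (@le_trans _ _ (Num.truncn B).+1%:R); first exact/ltW/truncnS_gt.
    by rewrite ler_nat leq_maxr.
  rewrite -ltey => fx.
  pose j := maxn k (Num.truncn (fine (f x))).+1.
  apply: (le_trans _ (le_sup_range _ j)).
  rewrite FkE ?leq_maxl// le_min lexx/= -{1}(@fineK _ (f x)) ?ge0_fin_numE// lee_fin.
  apply: (@le_trans _ _ (Num.truncn (fine (f x))).+1%:R); first exact/ltW/truncnS_gt.
  by rewrite ler_nat leq_maxr.
have [k PFk] : exists k, ~ P (EFin \o F k).
  apply/existsNP => H; apply: Pf; rewrite -supF; apply: P_sup => //.
  by move=> k; exact: measurableT_comp.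
have [c c0 PA] := PA_ k.
have FN x : (F k x <= k%:R * \1_(A_ k) x)%R by rewrite -lee_fin FE ge_min lexx orbT.
have [h [mh h0 hP h1]] := separation_bounded (mA_ k) (A_oo k) c0 PA (ler0n _ k) (mF k)
  (F0 k) FN PFk.
exists h; split => //; apply: (lt_le_trans h1); apply: le_integral_nng => //.
- by apply: mrE; exact: measurable_funM.
- by apply: emeasurable_funM => //; exact: mrE.
- by move=> x _; apply: rE0; rewrite mulr_ge0.
- move=> x _; rewrite -mulrA EFinM; apply: lee_wpmul2r => //.
  by rewrite lee_fin mulr_ge0// ltW.
Qed.

End bipolar.

(** * The maximal function and A_p constants *)

Section Ap_core.
Context d (T : measurableType d) (R : realType).
Variable mu : {measure set T -> \bar R}.

(** The scale is the average a / L of v: an A_p product at most K says that the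
    average of v^-e is at most K^e times the (-e)-th power of that of v. *)
Lemma Ap_scale (Q : set T) (v : T -> R) (e L K : R) : measurable Q ->
  measurable_fun setT v -> (forall x, (0 < v x)%R) -> (0 < e)%R -> (0 < K)%R ->
  (0 < L)%R -> mu Q = L%:E ->
  (L^-1%:E * \int[mu]_(x in Q) (v x)%:E) *
    (L^-1%:E * \int[mu]_(x in Q) (v x `^ (- e))%:E) `^ e^-1 <= K%:E ->
  exists2 s : R, (0 < s)%R &
    \int[mu]_(x in Q) (v x)%:E <= ((1 + K `^ e) * s * L)%:E /\
    \int[mu]_(x in Q) (v x `^ (- e))%:E <= ((1 + K `^ e) * s `^ (- e) * L)%:E.
Proof.
move=> mQ mv v0 e0 K0 L0 QL H.
have muQ0 : 0 < mu Q by rewrite QL lte_fin.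
have Li0 : (0 < L^-1)%R by rewrite invr_gt0.
have ei0 : (0 < e^-1)%R by rewrite invr_gt0.
have I1 : 0 < \int[mu]_(x in Q) (v x)%:E.
  by apply: integral_gt0 => //; exact: measurableT_comp.
have I2 : 0 < \int[mu]_(x in Q) (v x `^ (- e))%:E.
  apply: integral_gt0 => //.
    by apply: measurableT_comp => //; exact: measurable_fun_powR.
  by move=> x; rewrite lte_fin powR_gt0.
move: I1 I2 H; set i1 := \int[mu]_(x in Q) (v x)%:E.
set i2 := \int[mu]_(x in Q) (v x `^ (- e))%:E => I1 I2 H.
have P1 : 0 < L^-1%:E * i1 by rewrite mule_gt0.
have P2 : 0 < L^-1%:E * i2 by rewrite mule_gt0.
have F1 : i1 < +oo.
  rewrite ltey; apply/eqP => E1; move: H; rewrite E1 gt0_muley ?lte_fin//.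
  by rewrite gt0_mulye ?poweR_gt0// leye_eq.
have F2 : i2 < +oo.
  rewrite ltey; apply/eqP => E2; move: H; rewrite E2 [_ * +oo]gt0_muley ?lte_fin//.
  by rewrite poweRyr ?gt_eqF// gt0_muley// leye_eq.
have E1 : i1 = (fine i1)%:E by rewrite fineK// ge0_fin_numE// ltW.
have E2 : i2 = (fine i2)%:E by rewrite fineK// ge0_fin_numE// ltW.
move: I1 I2 H; rewrite E1 E2 !lte_fin; set a := fine i1; set c := fine i2 => a0 c0.
rewrite -[L^-1%:E * c%:E]EFinM poweR_EFin -!EFinM lee_fin => H.
pose s := (L^-1 * a)%R; have s0 : (0 < s)%R by rewrite mulr_gt0.
have Ke : (0 < K `^ e)%R by rewrite powR_gt0.
exists s => //; rewrite !lee_fin; split.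
  have -> : ((1 + K `^ e) * s * L = a + K `^ e * a)%R.
    by rewrite /s; field; rewrite gt_eqF.
  by rewrite lerDl mulr_ge0// ltW.
have H2 : (L^-1 * c <= K `^ e * s `^ (- e))%R.
  have -> : (L^-1 * c = ((L^-1 * c) `^ e^-1) `^ e)%R.
    by rewrite -powRrM mulVf ?gt_eqF// powRr1// mulr_ge0// ltW.
  have h3 : ((L^-1 * c) `^ e^-1 <= K / s)%R by rewrite ler_pdivlMr// mulrC.
  have -> : (K `^ e * s `^ (- e) = (K / s) `^ e)%R.
    rewrite powRM ?invr_ge0 ?(ltW K0) ?(ltW s0)//.
    by rewrite -(powR_inv1 (ltW s0)) -powRrM mulN1r.
  apply: (ge0_ler_powR (ltW e0)); rewrite ?nnegrE ?powR_ge0//.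
  by rewrite divr_ge0// ltW.
rewrite ler_pdivrMl// in H2; apply: (le_trans H2).
have -> : (L * (K `^ e * s `^ (- e)) = K `^ e * s `^ (- e) * L)%R by ring.
rewrite ler_pM2r// ler_wpM2r ?powR_ge0//.
by rewrite lerDr.
Qed.

(** The average of v bounds v from below up to the factor K, hence 1 / v from
    above. *)
Lemma A1_scale (Q : set T) (v : T -> R) (L K : R) : measurable Q ->
  measurable_fun setT v -> (forall x, (0 < v x)%R) -> (0 < K)%R ->
  (0 < L)%R -> mu Q = L%:E ->
  {ae mu, forall x, Q x -> \int[mu]_(y in Q) (v y)%:E <= (K * L * v x)%:E} ->
  exists2 s : R, (0 < s)%R &
    \int[mu]_(x in Q) (v x)%:E <= ((1 + K) * s * L)%:E /\
    \int[mu]_(x in Q) (v x `^ (- 1))%:E <= ((1 + K) * s `^ (- 1) * L)%:E.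
Proof.
move=> mQ mv v0 K0 L0 QL H.
have muQ0 : 0 < mu Q by rewrite QL lte_fin.
have [x Qx /(_ Qx) vx] := ae_gt0_meet mQ muQ0 H.
have I1 : 0 < \int[mu]_(x in Q) (v x)%:E.
  by apply: integral_gt0 => //; exact: measurableT_comp.
have E1 : \int[mu]_(x in Q) (v x)%:E = (fine (\int[mu]_(x in Q) (v x)%:E))%:E.
  by rewrite fineK// ge0_fin_numE ?ltW// (le_lt_trans vx)// ltry.
set a := fine _ in E1; have a0 : (0 < a)%R by rewrite -lte_fin -E1.
pose s := (a / L)%R; have s0 : (0 < s)%R by rewrite divr_gt0.
exists s => //; split.
  rewrite E1 lee_fin.
  have -> : ((1 + K) * s * L = a + K * a)%R by rewrite /s; field; rewrite gt_eqF.
  by rewrite lerDl mulr_ge0// ltW.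
apply: (@le_trans _ _ (\int[mu]_(x in Q) (K * s^-1)%:E)).
  apply: ae_ge0_le_integral => //.
  - by move=> z _; rewrite lee_fin powR_ge0.
  - by apply: measurableT_comp => //; exact: measurable_fun_powR.
  - by move=> z _; rewrite lee_fin mulr_ge0 ?invr_ge0// ltW.
  apply: (filterS _ H) => z h /h; rewrite E1 !lee_fin => {}h.
  rewrite powR_inv1 ?(ltW (v0 z))// invf_ple ?posrE ?mulr_gt0 ?invr_gt0//.
  by rewrite invf_div /s -mulrA -invfM ler_pdivrMr ?mulr_gt0// mulrC [(L * K)%R]mulrC.
rewrite integral_cst// QL -EFinM lee_fin ler_pM2r// powR_inv1 ?(ltW s0)//.
by rewrite ler_pM2r ?invr_gt0// lerDr.
Qed.

Lemma ae_eq_integral_on (A : set T) (f g : T -> \bar R) : measurable A ->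
  measurable_fun setT f -> measurable_fun setT g ->
  {ae mu, forall x, f x = g x} ->
  \int[mu]_(x in A) f x = \int[mu]_(x in A) g x.
Proof.
move=> mA mf mg fg; apply: ae_eq_integral => //; try exact: measurable_funTS.
by apply: (filterS _ fg) => x fgx _.
Qed.

Lemma weight_posfin (v : T -> \bar R) : {ae mu, forall x, 0 < v x < +oo} ->
  {ae mu, forall x, v x = (posfin v x)%:E}.
Proof. by apply: filterS => x vx; rewrite posfinE. Qed.

End Ap_core.

Section maximal_euclidean.
Variables (R : realType) (n : nat).
Local Notation E := (euclidean R n).
Local Notation mu := (euclidean_lebesgue R n).
Local Notation b := (cube_basis R n).

Lemma average_cube (f : E -> \bar R) a l : (0 < l)%R ->
  average f (cube a l) = ((l ^+ n)^-1)%:E * \int[mu]_(x in cube a l) f x.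
Proof.
move=> l0; rewrite /average (mu_cube a l0) inver gt_eqF ?exprn_gt0//.
by rewrite muleC.
Qed.

Lemma wavg_cst1 (f : E -> \bar R) k :
  wavg mu (bset b) (fun=> 1%R) f k = average f (bset b k).
Proof.
rewrite (average_cube _ _ (rside_gt0 R n k)) /wavg; congr (_ * _).
  congr (_^-1%:E)%R; rewrite /wvol.
  have := @integral_cst _ _ _ mu (bset b k) (measurable_cube _ _) 1.
  rewrite /cst => ->; rewrite mul1e.
  by have -> := mu_cube (@rcorner R n k) (rside_gt0 R n k).
by apply: eq_integral => x _; rewrite mule1.
Qed.

Lemma le_maximal (f : E -> \bar R) a l x : (0 < l)%R -> cube a l x ->
  average (fun y => `|f y|) (cube a l) <= maximal f x.
Proof.
by move=> l0 Qx; apply: ereal_sup_ubound; exists (cube a l) => //; split => //; exists a, l.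
Qed.

(** Since every cube lies in rational cubes of nearly the same measure, the
    supremum over all cubes is a countable one. In particular the maximal
    function is measurable. *)
Lemma maximalE (f : E -> \bar R) : measurable_fun setT f -> (forall x, 0 <= f x) ->
  forall x, maximal f x = wmax mu (bset b) (fun=> 1%R) f x.
Proof.
move=> mf f0 x.
have fE : (fun y => `|f y|) = f by apply/funext => y; rewrite gee0_abs.
apply/eqP; rewrite eq_le; apply/andP; split; last first.
  apply: wmax_le.
    have [k Qx] := basis_cover b x.
    apply: (le_trans _ (le_maximal f (rside_gt0 R n k) Qx)); rewrite fE.
    rewrite (average_cube _ _ (rside_gt0 R n k)) mule_ge0//.
      by rewrite lee_fin invr_ge0 exprn_ge0// ltW// rside_gt0.
    exact: integral_ge0.
  move=> k Qx; rewrite wavg_cst1.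
  by have := le_maximal f (rside_gt0 R n k) Qx; rewrite fE.
apply: ge_ereal_sup => _ [_ [[a [l [l0 ->]] Qx] <-]]; rewrite fE.
set W := wmax _ _ _ _ _.
have W0 : 0 <= W.
  apply: ge0_sup_range => k; rewrite wavg_cst1 mule_ge0 ?lee_fin//.
  rewrite (average_cube _ _ (rside_gt0 R n k)) mule_ge0//.
    by rewrite lee_fin invr_ge0 exprn_ge0// ltW// rside_gt0.
  exact: integral_ge0.
have [->|Woo] := eqVneq W +oo; first by rewrite leey.
have Wfin : W \is a fin_num by rewrite ge0_fin_numE// ltey.
have ln0 : (0 < l ^+ n)%R by rewrite exprn_gt0.
(* the rational cube may have side t l, where t^n <= d *)
have key (d : R) : (1 < d)%R -> \int[mu]_(y in cube a l) f y <= (d * l ^+ n)%:E * W.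
  move=> d1; have d0 := lt_trans ltr01 d1.
  pose t := (d `^ (n.+1%:R)^-1)%R.
  have t1 : (1 < t)%R.
    have := @gt0_ltr_powR R (n.+1%:R)^-1 _ 1%R d; rewrite powR1; apply; rewrite ?nnegrE//.
    exact: ltW.
  have t0 := lt_trans ltr01 t1.
  have tn : (t ^+ n <= d)%R.
    have -> : d = (t ^+ n.+1)%R.
      by rewrite -powR_mulrn ?powR_ge0// /t -powRrM mulVf ?pnatr_eq0// powRr1// ltW.
    by rewrite exprS ler_peMl ?exprn_ge0// ltW.
  have [k kQ kl] := @rcube_above R n a l (t * l)%R l0 ltac:(by rewrite ltr_pMl).
  have s0 := rside_gt0 R n k.
  have sn0 : (0 < rside R n k ^+ n)%R by rewrite exprn_gt0.
  have mf' D : measurable_fun D f by exact: measurable_funTS.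
  apply: (@le_trans _ _ (\int[mu]_(y in bset b k) f y)).
    by apply: ge0_subset_integral => //; exact: measurable_cube.
  have : wavg mu (bset b) (fun=> 1%R) f k <= W by apply: wmax_ge; exact: kQ.
  rewrite wavg_cst1 (average_cube _ _ s0) lee_pdivrMl// => /le_trans; apply.
  apply: lee_wpmul2r => //; rewrite lee_fin.
  apply: (@le_trans _ _ ((t * l) ^+ n)%R); first by apply: lerXn2r; rewrite ?nnegrE ?mulr_ge0 ?(ltW s0) ?(ltW t0) ?(ltW l0).
  by rewrite exprMn ler_pM2r.
rewrite average_cube// lee_pdivrMl//.
rewrite -(fineK Wfin) -EFinM; set r := fine W in key *.
have r0 : (0 <= r)%R by rewrite -lee_fin /r fineK.
apply/lee_addgt0Pr => eps eps0.
pose d := (1 + eps / (l ^+ n * r + 1))%R.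
have q0 : (0 < l ^+ n * r + 1)%R by rewrite ltr_wpDl// mulr_ge0// ltW.
have d1 : (1 < d)%R by rewrite ltrDl divr_gt0.
apply: (le_trans (key d d1)); rewrite -(fineK Wfin) -/r -EFinM -EFinD lee_fin.
rewrite /d -mulrA mulrDl mul1r lerD2l mulrAC ler_pdivrMr//.
by rewrite ler_pM2l// lerDl.
Qed.

Lemma maximal_iterable : iterable (@maximal R n).
Proof.
have vol k : 0 < \int[mu]_(x in bset b k) (cst 1%R x)%:E < +oo.
  have := integral_cst mu (measurable_cube (@rcorner R n k) (rside R n k)) 1.
  rewrite /cst => ->; rewrite mul1e.
  exact: (basis_vol b k).
have it := @wmax_iterable _ _ _ mu (bset b) (cst 1%R) (basis_meas b)
  (measurable_cst _) (fun=> ltr01) vol.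
split.
- move=> f mf f0; have := iterable_meas it mf f0.
  by rewrite (_ : maximal f = wmax mu (bset b) (cst 1%R) f)//; apply/funext => x;
    exact: maximalE.
- move=> f x f0; have [k Qx] := basis_cover b x.
  apply: (le_trans _ (le_maximal f (rside_gt0 R n k) Qx)).
  rewrite (average_cube _ _ (rside_gt0 R n k)) mule_ge0//.
    by rewrite lee_fin invr_ge0 exprn_ge0// ltW// rside_gt0.
  exact: integral_ge0.
- move=> f g mf mg f0 fg x.
  have g0 y : 0 <= g y by exact: le_trans (fg y).
  by rewrite !maximalE//; exact: (iterable_le it mf mg f0 fg).
- move=> f_ mf f0 nd x; rewrite maximalE; last 2 first.
  + exact: measurable_sup_range.
  + by move=> y; exact: ge0_sup_range.
  apply: (le_trans (iterable_sup it mf f0 nd x)); apply: sup_range_le => k.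
  apply: (le_trans _ (le_sup_range _ k)).
  by rewrite /= maximalE.
Qed.

End maximal_euclidean.

Section Ap_conversion.
Variables (R : realType) (n : nat).
Local Notation E := (euclidean R n).
Local Notation mu := (euclidean_lebesgue R n).
Local Notation b := (cube_basis R n).

Lemma bvol_cube k : bvol b k = (rside R n k ^+ n)%R.
Proof. by rewrite /bvol (mu_cube (@rcorner R n k) (rside_gt0 R n k)). Qed.

Lemma Ap_Acond (p : R) (v : E -> \bar R) : (1 <= p)%R -> Ap p v ->
  exists e C : R, [/\ (0 < e)%R, (0 < C)%R & Acond b e C (posfin v)].
Proof.
move=> p1 [[mv v0] vp].
have mw := measurable_posfin mv.
have w0 := posfin_gt0 v.
have vae := weight_posfin v0.
have Q0 k := rside_gt0 R n k.
have L0 k : (0 < rside R n k ^+ n)%R by rewrite exprn_gt0.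
have mQ k : measurable (bset b k) := measurable_cube _ _.
have mw' : measurable_fun setT (fun x => (posfin v x)%:E).
  exact: measurableT_comp.
have vint k : \int[mu]_(x in bset b k) v x = \int[mu]_(x in bset b k) (posfin v x)%:E.
  exact: (ae_eq_integral_on (mQ k) mv mw' vae).
have muE k : mu (bset b k) = (rside R n k ^+ n)%:E.
  exact: (mu_cube (@rcorner R n k) (rside_gt0 R n k)).
have [K K0 vK] : exists2 K : R, (0 < K)%R & Ap_constant p v <= K%:E.
  case: (Ap_constant p v) vp => [r _|//|_]; last by exists 1%R; rewrite ?leNye.
  by exists (`|r| + 1)%R; rewrite ?ltr_wpDl// lee_fin (le_trans (ler_norm r))// lerDl.
move: vK; rewrite /Ap_constant; case: eqVneq => [_|pn1].
  move=> /ess_supP H; exists 1%R, (1 + K)%R; split; [by []|by rewrite addr_gt0|].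
  split => // k; rewrite bvol_cube.
  apply: (A1_scale (mQ k) mw w0 K0 (L0 k) (muE k)).
  apply: (filterS _ (filterI H vae)) => x [/= Hx vx] Qx.
  rewrite vx inver gt_eqF// lee_pdivrMr// -EFinM in Hx.
  have := le_trans (le_maximal v (Q0 k) Qx) Hx.
  rewrite (average_cube _ _ (Q0 k)) lee_pdivrMl// -EFinM.
  rewrite (_ : \int[mu]_(x in _) `|v x| = \int[mu]_(x in bset b k) (posfin v x)%:E).
    by move=> /le_trans; apply; rewrite lee_fin mulrCA mulrA.
  rewrite -vint; apply: (ae_eq_integral_on (mQ k) _ mv).
    exact: measurableT_comp.
  by apply: (filterS _ vae) => y ->; rewrite gee0_abs// lee_fin ltW.
have p1' : (0 < p - 1)%R by rewrite subr_gt0 lt_neqAle eq_sym pn1.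
have p0 : (0 < p)%R by apply: lt_le_trans p1.
have mwe : measurable_fun setT (fun x => (posfin v x `^ (- (p - 1)^-1))%:E).
  by apply/measurable_EFinP; exact: (measurable_fun_powR _ mw).
move=> H; exists (p - 1)^-1%R, (1 + K `^ (p - 1)^-1)%R; split.
- by rewrite invr_gt0.
- by rewrite addr_gt0// powR_gt0.
split => // k; rewrite bvol_cube.
have e0 : (0 < (p - 1)^-1)%R by rewrite invr_gt0.
apply: (Ap_scale (mQ k) mw w0 e0 K0 (L0 k) (muE k)); rewrite invrK.
apply: (le_trans _ H).
have -> : (1 - conj_exponent p = - (p - 1)^-1)%R.
  by rewrite /conj_exponent; field; rewrite !gt_eqF//= subr_gt0 invf_lt1.
apply: (@le_trans _ _ (average v (bset b k) *
    average (fun x => v x `^ (- (p - 1)^-1)) (bset b k) `^ (p - 1))).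
  rewrite !(average_cube _ _ (Q0 k)) -vint.
  suff -> : \int[mu]_(x in bset b k) (posfin v x `^ (- (p - 1)^-1))%:E =
      \int[mu]_(x in bset b k) (v x `^ (- (p - 1)^-1)) by exact: lexx.
  apply: (ae_eq_integral_on (mQ k)).
  - exact: mwe.
  - exact: measurable_fun_poweR.
  - by apply: (filterS _ vae) => x ->; rewrite poweR_EFin.
apply: ereal_sup_ubound; exists (bset b k) => //.
by exists (@rcorner R n k), (rside R n k).
Qed.

(** An arbitrary cube is contained in a cube of the basis of at most twice its
    side, which costs a factor 2^n in each of the two averages. *)
Lemma Acond_Ap (e C : R) (w : E -> R) : (0 < e)%R -> (0 < C)%R ->
  Acond b e C w -> weight (EFin \o w) /\
  Ap_constant (1 + e^-1) (EFin \o w) <=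
    ((C * 2 ^+ n) * (C * 2 ^+ n) `^ e^-1)%:E.
Proof.
move=> e0 C0 [mw w0 wQ]; split.
  split; first exact: measurableT_comp.
  by apply: aeW => x; rewrite lte_fin w0 ltry.
have ei0 : (0 < e^-1)%R by rewrite invr_gt0.
rewrite /Ap_constant gt_eqF ?ltrDl//.
have -> : (1 - conj_exponent (1 + e^-1) = - e)%R.
  rewrite /conj_exponent; field.
  by rewrite addrAC subrr add0r oner_eq0 !gt_eqF// addr_gt0.
have -> : (1 + e^-1 - 1 = e^-1)%R by ring.
apply: ge_ereal_sup => _ [Q [a [l [l0 ->]]] <-].
have [k Qk kl] := @rcube_above R n a l (2 * l)%R l0 ltac:(lra).
have [s s0 [sw swe]] := wQ k.
have ln0 : (0 < l ^+ n)%R by rewrite exprn_gt0.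
have kn : (rside R n k ^+ n <= 2 ^+ n * l ^+ n)%R.
  by rewrite -exprMn; apply: (lerXn2r _ _ _ kl); rewrite nnegrE ltW// ?rside_gt0// mulr_gt0.
have avg (f : E -> R) (t : R) : measurable_fun setT f -> (forall x, (0 <= f x)%R) ->
    (0 < t)%R -> \int[mu]_(x in bset b k) (f x)%:E <= (C * t * bvol b k)%:E ->
    average (EFin \o f) (cube a l) <= (C * 2 ^+ n * t)%:E.
  move=> mf f0 t0 H; rewrite average_cube// lee_pdivrMl// -EFinM.
  apply: (@le_trans _ _ (\int[mu]_(x in bset b k) (f x)%:E)).
    apply: ge0_subset_integral => //.
    - exact: measurable_cube.
    - exact: measurable_cube.
    - by apply: measurable_funTS; exact: measurableT_comp.
    - by move=> x _; rewrite lee_fin.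
  apply: (le_trans H); rewrite lee_fin bvol_cube.
  have -> : (l ^+ n * (C * 2 ^+ n * t) = C * t * (2 ^+ n * l ^+ n))%R by ring.
  by rewrite ler_pM2l// mulr_gt0.
have A1 := avg _ _ mw (fun x => ltW (w0 x)) s0 sw.
have A2 := avg _ _ (measurable_fun_powR (- e) mw) (fun x => powR_ge0 _ _)
  (powR_gt0 (- e) s0) swe.
have C2 : (0 < C * 2 ^+ n)%R by rewrite mulr_gt0// exprn_gt0.
have avg0 (f : E -> \bar R) : (forall x, 0 <= f x) -> 0 <= average f (cube a l).
  move=> f0; rewrite average_cube// mule_ge0 ?lee_fin ?invr_ge0 ?(ltW ln0)//.
  by apply: integral_ge0 => x _; exact: f0.
apply: (@le_trans _ _ ((C * 2 ^+ n * s)%:E * (C * 2 ^+ n * s `^ (- e))%:E `^ e^-1)).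
  apply: lee_pmul => //.
  - by apply: avg0 => x; rewrite lee_fin ltW.
  - exact: poweR_ge0.
  apply: gt0_ler_poweR A2; rewrite ?(ltW ei0)// in_itv/= leey andbT; last first.
    by rewrite lee_fin mulr_ge0 ?powR_ge0// ltW.
  by apply: avg0 => x; rewrite lee_fin powR_ge0.
rewrite poweR_EFin -EFinM lee_fin powRM ?powR_ge0 ?(ltW C2)//.
rewrite -powRrM mulNr divff ?gt_eqF// powR_inv1 ?(ltW s0)//.
rewrite le_eqVlt; apply/orP; left; apply/eqP.
by field; rewrite gt_eqF.
Qed.

Lemma Ainfty_bound_hyp (F : set ((E -> \bar R) * (E -> \bar R))) (p : R) :
  (0 < p)%R -> extrapolation_family F ->
  for_all_Ainfty (fun (C : R) (w : E -> \bar R) =>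
      forall f g, F (f, g) -> weighted_Lnorm p w f <= C%:E * weighted_Lnorm p w g) ->
  Ainfty_bound b F p.
Proof.
move=> p0 F_pairs H e C e0 C0.
pose K := Num.max 1%R ((C * 2 ^+ n) * (C * 2 ^+ n) `^ e^-1)%R.
have [B B0 HB] := H (1 + e^-1)%R K ltac:(by rewrite lerDl invr_ge0 ltW)
  ltac:(by rewrite le_max lexx).
exists (B `^ p)%R; first by rewrite powR_gt0.
move=> w Aw f g Ffg; have [mf mg f0 g0] := F_pairs _ _ Ffg.
have [ww wK] := Acond_Ap e0 C0 Aw.
have {}wK : Ap_constant (1 + e^-1) (EFin \o w) <= K%:E.
  by apply: (le_trans wK); rewrite lee_fin le_max lexx orbT.
have := HB _ ww wK f g Ffg; rewrite /weighted_Lnorm.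
have [_ w0 _] := Aw.
have E1 (h : E -> \bar R) : (forall x, 0 <= h x) ->
    \int[mu]_x (`|h x| `^ p * (EFin \o w) x) = \int[mu]_x (h x `^ p * (w x)%:E).
  by move=> h0; apply: eq_integral => x _; rewrite gee0_abs.
rewrite !E1//.
have I0 (h : E -> \bar R) : 0 <= \int[mu]_x (h x `^ p * (w x)%:E).
  by apply: integral_ge0 => x _; rewrite mule_ge0 ?poweR_ge0// lee_fin ltW.
move: (I0 f) (I0 g); set i := integral _ _ _; set j := integral _ _ _ => i0 j0 ij.
have := @gt0_ler_poweR R p (ltW p0) _ _ _ _ ij; rewrite !in_itv/= !leey !andbT.
rewrite poweRM ?poweR_ge0 ?lee_fin ?(ltW B0)// -!poweRrM mulVf ?gt_eqF//.
rewrite !poweRe1// poweR_EFin; apply => //.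
by rewrite mule_ge0 ?poweR_ge0// lee_fin ltW.
Qed.

End Ap_conversion.

(** * Dual majorants *)

Lemma sup_range_gZl (R : realType) (u : nat -> \bar R) (a : \bar R) :
  0 <= a -> (forall k, 0 <= u k) ->
  ereal_sup (range (fun k => a * u k)) = a * ereal_sup (range u).
Proof.
move=> a0 u0; have [->|an0] := eqVneq a 0.
  rewrite mul0e; apply/eqP; rewrite eq_le; apply/andP; split.
    by apply: sup_range_le => k; rewrite mul0e.
  by apply: ge0_sup_range => k; rewrite mul0e.
have {an0}a0 : 0 < a by rewrite lt_neqAle eq_sym an0.
case: a a0 => [r r0|_|//]; first by rewrite sup_range_pZl// -lte_fin.
have [S0|Sn0] := eqVneq (ereal_sup (range u)) 0.
  have uk k : u k = 0.
    by apply/eqP; rewrite eq_le u0 andbT -S0; exact: le_sup_range.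
  rewrite S0 mule0; apply/eqP; rewrite eq_le; apply/andP; split.
    by apply: sup_range_le => k; rewrite uk mule0.
  by apply: ge0_sup_range => k; rewrite uk mule0.
have S0 : 0 < ereal_sup (range u) by rewrite lt_neqAle eq_sym Sn0 ge0_sup_range.
rewrite gt0_mulye//; have [k uk] := lt_sup_range S0.
apply/eqP; rewrite -leye_eq -[leLHS](gt0_mulye uk).
exact: (le_sup_range (fun k => +oo * u k)).
Qed.

Section dual_majorant.
Context d (T : measurableType d) (R : realType).
Variable mu : {measure set T -> \bar R}.
Variable rho : T -> R.
Hypotheses (mrho : measurable_fun setT rho) (rho0 : forall x, (0 < rho x)%R).
Variable P : (T -> \bar R) -> Prop.
Hypothesis P_le : forall u v, measurable_fun setT u -> measurable_fun setT v ->
  (forall x, 0 <= u x) -> {ae mu, forall x, u x <= v x} -> P v -> P u.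
Hypothesis P_convex : forall (f g : T -> R) (t : R), measurable_fun setT f ->
  measurable_fun setT g -> (forall x, (0 <= f x)%R) -> (forall x, (0 <= g x)%R) ->
  (0 <= t <= 1)%R -> P (EFin \o f) -> P (EFin \o g) ->
  P (fun x => ((1 - t) * f x + t * g x)%:E).
Hypothesis P_sup : forall u : nat -> T -> \bar R,
  (forall k, measurable_fun setT (u k)) -> (forall k x, 0 <= u k x) ->
  (forall x, nondecreasing_seq (u ^~ x)) -> (forall k, P (u k)) ->
  P (fun x => ereal_sup (range (u ^~ x))).
Variable A_ : nat -> set T.
Hypotheses (mA_ : forall k, measurable (A_ k)) (ndA : nondecreasing_seq A_).
Hypothesis A_cover : forall x, exists k, A_ k x.
Hypothesis A_oo : forall k, \int[mu]_(x in A_ k) (rho x)%:E < +oo.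
Hypothesis PA_ : forall k, exists2 c : R, (0 < c)%R & P (fun x => (c * \1_(A_ k) x)%:E).

(** [polar_le f m] says that the associate norm of [f] is at most [m]. *)
Definition polar_le (f : T -> \bar R) (m : R) : Prop :=
  forall g, measurable_fun setT g -> (forall x, 0 <= g x) -> P g ->
    \int[mu]_x (g x * (f x * (rho x)%:E)) <= m%:E.

Variable S : (T -> \bar R) -> T -> \bar R.
Hypothesis itS : iterable S.
Variable K : R.
Hypothesis K0 : (0 < K)%R.
(** S is bounded by K in the associate norm. *)
Hypothesis S_polar : forall f m, measurable_fun setT f -> (forall x, 0 <= f x) ->
  (0 < m)%R -> polar_le f m -> polar_le (S f) (K * m).
Hypothesis S_gt0 : forall f, measurable_fun setT f -> (forall x, 0 <= f x) ->
  ~ {ae mu, forall x, f x = 0} -> forall x, 0 < S f x.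
Hypothesis S_ae : forall f g, measurable_fun setT f -> measurable_fun setT g ->
  {ae mu, forall x, f x = g x} -> S f = S g.

Let rhoE0 x : 0 <= (rho x)%:E. Proof. by rewrite lee_fin ltW. Qed.

Let mrhoE : measurable_fun setT (EFin \o rho).
Proof. exact: measurableT_comp. Qed.

(** If the associate norm of g is at most 2, that of h + S g / (2 K) is at most
    1 + K 2 / (2 K) = 2. *)
Lemma polar_majorant (h : T -> \bar R) : measurable_fun setT h ->
  (forall x, 0 <= h x) -> polar_le h 1 -> polar_le (majorant S (2 * K) h) 2.
Proof.
move=> mh h0 ph; have c0 : (0 < 2 * K)%R by rewrite mulr_gt0.
have mm := measurable_majorant_seq itS c0 mh h0.
have m0 := majorant_seq_ge0 itS c0 h0.
have seqP k : polar_le (majorant_seq S (2 * K) h k) 2.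
  elim: k => [|k IH] g mg g0 Pg; first by apply: (le_trans (ph g mg g0 Pg)); rewrite lee_fin ler1n.
  have mS := iterable_meas itS (mm k) (m0 k).
  have S0 x := iterable_ge0 itS x (m0 k).
  have k0 : (0 <= (2 * K)^-1)%R by rewrite invr_ge0 ltW.
  have mgh : measurable_fun setT (fun x => g x * (h x * (rho x)%:E)).
    by apply: emeasurable_funM => //; exact: emeasurable_funM.
  have mgS : measurable_fun setT
      (fun x => g x * (S (majorant_seq S (2 * K) h k) x * (rho x)%:E)).
    by apply: emeasurable_funM => //; exact: emeasurable_funM.
  have -> : \int[mu]_x (g x * (majorant_seq S (2 * K) h k.+1 x * (rho x)%:E)) =
      \int[mu]_x (g x * (h x * (rho x)%:E)) + ((2 * K)^-1)%:E *
      \int[mu]_x (g x * (S (majorant_seq S (2 * K) h k) x * (rho x)%:E)).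
    rewrite -ge0_integralZl//; last first.
      by move=> x _; rewrite !mule_ge0.
    rewrite -ge0_integralD//; last 3 first.
    - by move=> x _; rewrite !mule_ge0.
    - by move=> x _; rewrite !mule_ge0.
    - exact: measurable_funeM.
    apply: eq_integral => x _ /=; rewrite ge0_muleDl ?mule_ge0//.
    rewrite ge0_muleDr ?mule_ge0//; congr (_ + _).
    by rewrite -!muleA muleCA.
  apply: (@le_trans _ _ (1%:E + ((2 * K)^-1)%:E * (K * 2)%:E)).
    apply: leeD; first exact: ph.
    by apply: lee_wpmul2l => //; apply: (S_polar (mm k) (m0 k) _ IH).
  by rewrite -EFinM -EFinD lee_fin [(K * 2)%R]mulrC mulVf ?gt_eqF.
move=> g mg g0 Pg.
have -> : \int[mu]_x (g x * (majorant S (2 * K) h x * (rho x)%:E)) =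
    \int[mu]_x ereal_sup (range (fun k =>
      g x * (majorant_seq S (2 * K) h k x * (rho x)%:E))).
  apply: eq_integral => x _; rewrite /majorant -sup_range_pZr//.
  by rewrite sup_range_gZl// => k; rewrite mule_ge0.
rewrite integral_sup_range//.
- by apply: sup_range_le => k; exact: seqP.
- by move=> k; apply: emeasurable_funM => //; exact: emeasurable_funM.
- by move=> k x; rewrite !mule_ge0.
- move=> x i j ij; apply: lee_wpmul2l => //; apply: lee_wpmul2r => //.
  exact: (nondecreasing_majorant_seq itS c0 mh h0).
Qed.

(** The dual function provided by the bipolar theorem is replaced by its
    majorant for S, which doubles the polar bound at most. The majorant is
    positive everywhere and finite almost everywhere, hence a weight. *)
Lemma dual_majorant (phi : T -> \bar R) : measurable_fun setT phi ->
  (forall x, 0 <= phi x) -> ~ P phi -> exists gam : T -> R,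
  [/\ measurable_fun setT gam, (forall x, (0 < gam x)%R),
    polar_le (EFin \o gam) 2, 1 < \int[mu]_x (phi x * (gam x * rho x)%:E) &
    {ae mu, forall x, S (EFin \o gam) x <= (2 * K * gam x)%:E}].
Proof.
move=> mphi phi0 Pphi.
have [h [mh h0 ph h1]] :=
  bipolar mrho rho0 P_le P_convex P_sup mA_ ndA A_cover A_oo PA_ mphi phi0 Pphi.
have mhE : measurable_fun setT (EFin \o h) by exact: measurableT_comp.
have hE0 x : 0 <= (EFin \o h) x by rewrite lee_fin.
have c0 : (0 < 2 * K)%R by rewrite mulr_gt0.
set G := majorant S (2 * K) (EFin \o h).
have mG : measurable_fun setT G := measurable_majorant itS c0 mhE hE0.
have hp : polar_le (EFin \o h) 1 by move=> g mg g0 Pg; exact: ph.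
have Gp : polar_le G 2 := polar_majorant mhE hE0 hp.
(* one step of the iteration already makes h positive *)
have G0 x : 0 < G x.
  apply: (lt_le_trans _ (le_sup_range _ 1%N)) => /=.
  apply: (@lt_le_trans _ _ (((2 * K)^-1)%:E * S (EFin \o h) x)); last by rewrite leeDr// lee_fin.
  rewrite mule_gt0 ?lte_fin ?invr_gt0//; apply: S_gt0 => // hae.
  move: h1; rewrite ae_eq0_integral ?ltNge ?lee_fin ?ler01//.
  - by apply: emeasurable_funM => //; apply/measurable_EFinP; exact: measurable_funM.
  - by move=> x'; rewrite mule_ge0// lee_fin mulr_ge0// ltW.
  - by apply: (filterS _ hae) => x' /= [->]; rewrite mul0r mule0.
(* on A_k, because G has a finite pairing with a multiple of the indicator *)
have Goo : {ae mu, forall x, G x < +oo}.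
  have : {ae mu, forall x, forall k, A_ k x -> G x < +oo}.
    apply: ae_foralln => k; have [c c1 Pc] := PA_ k.
    have mc : measurable_fun setT (fun x => (c * \1_(A_ k) x)%:E).
      by apply/measurable_EFinP; apply: measurable_funM => //; exact: measurable_indic.
    have cc0 x : 0 <= (c * \1_(A_ k) x)%:E by rewrite lee_fin mulr_ge0// ltW.
    have := Gp _ mc cc0 Pc => /le_lt_trans/(_ (ltry _)) Ioo.
    have := ae_lty_integral _ _ Ioo.
    rewrite /= => H; apply: (filterS _ (H _ _)) => [x + Ax||].
    - rewrite indicE mem_set// mulr1 => {}H; rewrite ltey; apply/eqP => Gx.
      by move: H; rewrite Gx gt0_mulye ?lte_fin// gt0_muley ?lte_fin.
    - by apply: emeasurable_funM => //; exact: emeasurable_funM.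
    - by move=> x; rewrite mule_ge0// mule_ge0// ltW.
  by apply: filterS => x H; have [k] := A_cover x; exact: H.
have GE : {ae mu, forall x, G x = (posfin G x)%:E}.
  by apply: (filterS _ Goo) => x Gx; rewrite posfinE// G0.
have mg := measurable_posfin mG.
have intE (f : T -> \bar R) : measurable_fun setT f -> (forall x, 0 <= f x) ->
    \int[mu]_x (f x * (posfin G x * rho x)%:E) = \int[mu]_x (f x * (G x * (rho x)%:E)).
  move=> mf f0; apply: ae_eq_integral => //.
  - apply: emeasurable_funM => //; apply/measurable_EFinP; exact: measurable_funM.
  - by apply: emeasurable_funM => //; exact: emeasurable_funM.
  - by apply: (filterS _ GE) => x -> _; rewrite EFinM.
exists (posfin G); split => //.
- exact: posfin_gt0.
- by move=> g mg' g0 Pg; under eq_integral do rewrite /= -EFinM; rewrite intE//; exact: Gp.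
- rewrite intE//; apply: (lt_le_trans h1); apply: le_integral_nng => //.
  + by apply: emeasurable_funM => //; apply/measurable_EFinP; exact: measurable_funM.
  + by apply: emeasurable_funM => //; exact: emeasurable_funM.
  + by move=> x _; rewrite mule_ge0// lee_fin mulr_ge0// ltW.
  + move=> x _; apply: lee_wpmul2l => //; rewrite EFinM; apply: lee_wpmul2r => //.
    exact: le_majorant.
- have -> : S (EFin \o posfin G) = S G.
    apply: S_ae => //; first by apply/measurable_EFinP.
    by apply: (filterS _ GE) => x ->.
  apply: (filterS _ GE) => x Gx; rewrite EFinM -Gx.
  exact: iter_majorant_le.
Qed.

End dual_majorant.

(** * The unit ball of a power of a Banach function space *)

Section unit_ball.
Context {R : realType}.

Lemma powR_convex (s a b t : R) : (1 <= s)%R -> (0 <= a)%R -> (0 <= b)%R ->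
  (0 <= t <= 1)%R ->
  (((1 - t) * a + t * b) `^ s <= (1 - t) * a `^ s + t * b `^ s)%R.
Proof.
move=> s1 a0 b0 /andP[t0 t1].
rewrite addrC [leRHS]addrC.
have := @convex_powR R s s1 (Itv01 t0 t1) b a.
by apply; rewrite inE/= in_itv/= ?a0 ?b0.
Qed.

Lemma lee_poweR (r : R) (x y : \bar R) :
  (0 <= r)%R -> 0 <= x -> x <= y -> x `^ r <= y `^ r.
Proof.
move=> r0 x0 xy; apply: gt0_ler_poweR => //; rewrite in_itv/= leey andbT//.
exact: le_trans xy.
Qed.

Lemma sup_range_poweR (u : nat -> \bar R) (s : R) : (0 < s)%R ->
  (forall k, 0 <= u k) ->
  ereal_sup (range (fun k => u k `^ s)) = ereal_sup (range u) `^ s.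
Proof.
move=> s0 u0; have Su0 := ge0_sup_range u0.
apply/eqP; rewrite eq_le; apply/andP; split.
  by apply: sup_range_le => k; apply: lee_poweR; rewrite ?(ltW s0)//; exact: le_sup_range.
have M0 : 0 <= ereal_sup (range (fun k => u k `^ s)).
  by apply: ge0_sup_range => k; exact: poweR_ge0.
set M := ereal_sup _ in M0 *.
rewrite -[M]poweRe1// -(mulVf (lt0r_neq0 s0)) poweRrM; apply: (@lee_poweR s); rewrite ?(ltW s0)//.
apply: sup_range_le => k; rewrite -[u k]poweRe1// -(mulfV (lt0r_neq0 s0)) poweRrM.
apply: (@lee_poweR s^-1%R); rewrite ?invr_ge0 ?(ltW s0) ?poweR_ge0//.
exact: (le_sup_range (fun k => u k `^ s)).
Qed.

End unit_ball.

Section BFS_ball.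
Variables (R : realType) (n : nat).
Local Notation E := (euclidean R n).
Local Notation fct := (E -> \bar R).
Local Notation mu := (euclidean_lebesgue R n).
Variables (om : fct) (X : fct -> \bar R) (X_BFS : is_BFS om X).
Variables (s : R) (s1 : (1 <= s)%R).

Let s0 : (0 < s)%R. Proof. exact: lt_le_trans s1. Qed.

(** The unit ball of [power_norm X s], to which its exponent 1/s is immaterial. *)
Definition power_ball (f : fct) : Prop := X (fun x => `|f x| `^ s) <= 1.

Let mpow (f : fct) : measurable_fun setT f -> measurable_fun setT (fun x => `|f x| `^ s).
Proof. by move=> mf; apply: measurable_fun_poweR; exact: measurableT_comp. Qed.

Lemma power_norm_le1 f : measurable_fun setT f ->
  (power_norm X s f <= 1) <-> power_ball f.
Proof.
move=> mf; have N0 := BFS_ge0 X_BFS (mpow mf); rewrite /power_norm /power_ball.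
move: N0; set N := X _ => N0.
have p1 r : 1 `^ r = 1 :> \bar R by rewrite (poweR_EFin 1 r) powR1.
split => N1.
  have := lee_poweR (ltW s0) (poweR_ge0 _ _) N1.
  by rewrite -poweRrM mulVf ?gt_eqF// poweRe1// p1.
by have := @lee_poweR _ s^-1%R _ _ ltac:(by rewrite invr_ge0 ltW) N0 N1; rewrite p1.
Qed.

Lemma power_ball_le f g : measurable_fun setT f -> measurable_fun setT g ->
  (forall x, 0 <= f x) -> {ae mu, forall x, f x <= g x} ->
  power_ball g -> power_ball f.
Proof.
move=> mf mg f0 fg; apply: le_trans.
apply: (BFS_le X_BFS (mpow mf) (mpow mg)).
apply: (filterS _ fg) => x fgx; have gx0 := le_trans (f0 x) fgx.
rewrite !gee0_abs ?poweR_ge0//.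
by apply: gt0_ler_poweR => //; rewrite ?(ltW s0)// in_itv/= leey andbT.
Qed.

Lemma power_ball_convex (f g : E -> R) (t : R) : measurable_fun setT f ->
  measurable_fun setT g -> (forall x, (0 <= f x)%R) -> (forall x, (0 <= g x)%R) ->
  (0 <= t <= 1)%R -> power_ball (EFin \o f) -> power_ball (EFin \o g) ->
  power_ball (fun x => ((1 - t) * f x + t * g x)%:E).
Proof.
move=> mf mg f0 g0 t01 Bf Bg; have /andP[t0 t1] := t01.
have mE (h : E -> R) : measurable_fun setT h -> measurable_fun setT (EFin \o h).
  by move=> mh; exact/measurable_EFinP.
have mfs := mpow (mE _ mf); have mgs := mpow (mE _ mg).
have t'0 : (0 <= 1 - t)%R by rewrite subr_ge0.
have mm : measurable_fun setT (fun x => ((1 - t) * f x + t * g x)%:E).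
  apply: mE; apply: measurable_funD; exact: measurable_funM.
have ma := measurable_funeM (1 - t)%:E mfs.
have mb := measurable_funeM t%:E mgs.
apply: (@le_trans _ _ (X (fun x => (1 - t)%:E * `|(EFin \o f) x| `^ s +
    t%:E * `|(EFin \o g) x| `^ s))).
  apply: (BFS_le X_BFS (mpow mm) (emeasurable_funD ma mb)).
  apply: aeW => x /=; rewrite !ger0_norm ?addr_ge0 ?mulr_ge0 ?powR_ge0//.
  exact: powR_convex.
apply: (le_trans (BFS_triangle X_BFS ma mb)).
rewrite (BFS_scale X_BFS _ mfs) (BFS_scale X_BFS _ mgs) !ger0_norm//.
apply: (@le_trans _ _ ((1 - t)%:E * 1 + t%:E * 1)).
  by apply: leeD; apply: lee_wpmul2l => //; rewrite lee_fin.
by rewrite !mule1 -EFinD subrK.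
Qed.

Lemma power_ball_sup (u : nat -> fct) : (forall k, measurable_fun setT (u k)) ->
  (forall k x, 0 <= u k x) -> (forall x, nondecreasing_seq (u ^~ x)) ->
  (forall k, power_ball (u k)) -> power_ball (fun x => ereal_sup (range (u ^~ x))).
Proof.
move=> mu_ u0 ndu Bu; set U := fun x => _.
have mU : measurable_fun setT U by exact: measurable_sup_range.
have U0 x : 0 <= U x by exact: ge0_sup_range.
have ndp x : nondecreasing_seq (fun j => `| `|u j x| `^ s|).
  move=> i j ij; rewrite !(gee0_abs (poweR_ge0 _ _)) !gee0_abs//.
  apply: gt0_ler_poweR; rewrite ?(ltW s0) ?in_itv/= ?leey ?andbT//.
  exact: ndu.
have cvp : {ae mu, forall x, nondecreasing_seq (fun j => `| `|u j x| `^ s|) /\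
    `| `|u j x| `^ s| @[j --> \oo] --> `| `|U x| `^ s|}.
  apply: aeW => x; split; first exact: ndp.
  rewrite (gee0_abs (poweR_ge0 _ _)) gee0_abs// /U -sup_range_poweR//.
  have -> : (fun k => u k x `^ s) = (fun j => `| `|u j x| `^ s|).
    by apply/funext => k; rewrite (gee0_abs (poweR_ge0 _ _)) gee0_abs.
  exact: ereal_nondecreasing_cvgn.
have [_ cv] := BFS_Fatou X_BFS (fun j => mpow (mu_ j)) (mpow mU) cvp.
rewrite /power_ball -(cvg_lim _ cv)//; apply: lime_le.
  by apply/cvg_ex; exists (X (fun x => `|U x| `^ s)).
by apply: nearW => j; exact: Bu.
Qed.

(** X(1_A) is finite, so small multiples of 1_A are in the ball. *)
Lemma power_ball_indic (A : set E) : measurable A ->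
  \int[mu]_(x in A) om x < +oo ->
  exists2 c : R, (0 < c)%R & power_ball (fun x => (c * \1_A x)%:E).
Proof.
move=> mA Aoo; have Noo := BFS_indic X_BFS mA Aoo.
have m1 : measurable_fun setT (fun x => (\1_A x)%:E : \bar R).
  by apply/measurable_EFinP; exact: measurable_indic.
have N0 := BFS_ge0 X_BFS m1.
have NE : X (fun x => (\1_A x)%:E) = (fine (X (fun x => (\1_A x)%:E)))%:E.
  by rewrite fineK// ge0_fin_numE.
set N := fine _ in NE; have {}N0 : (0 <= N)%R by rewrite -lee_fin -NE.
have N1 : (0 < N + 1)%R by rewrite ltr_wpDl.
exists ((N + 1)^-1 `^ s^-1)%R; first by rewrite powR_gt0// invr_gt0.
rewrite /power_ball.
have -> : (fun x => `|((N + 1)^-1 `^ s^-1 * \1_A x)%:E| `^ s) =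
    (fun x => ((N + 1)^-1)%:E * (\1_A x)%:E).
  apply/funext => x; rewrite gee0_abs ?lee_fin ?mulr_ge0 ?powR_ge0//.
  rewrite poweR_EFin -EFinM powRM ?powR_ge0// -powRrM mulVf ?gt_eqF//.
  rewrite powRr1 ?invr_ge0 ?(ltW N1)// indicE.
  by case: (x \in A); rewrite ?powR1// powR0 ?gt_eqF.
rewrite (BFS_scale X_BFS _ m1) NE ger0_norm ?invr_ge0 ?(ltW N1)// -EFinM lee_fin.
by rewrite mulrC ler_pdivrMr// mul1r lerDl.
Qed.

End BFS_ball.

(** * The weighted maximal operator *)

Section weighted_operator.
Variables (R : realType) (n : nat).
Local Notation E := (euclidean R n).
Local Notation mu := (euclidean_lebesgue R n).
Local Notation b := (cube_basis R n).

Lemma euclidean_lebesgue_complete : measure_is_complete mu.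
Proof. exact: measure_is_complete_caratheodory. Qed.

Lemma maximal_ae (f g : E -> \bar R) : measurable_fun setT f ->
  measurable_fun setT g -> {ae mu, forall x, f x = g x} -> maximal f = maximal g.
Proof.
move=> mf mg fg; apply/funext => x; rewrite /maximal; congr ereal_sup.
apply: eq_imagel => Q [[a [l [l0 ->]]] _]; rewrite /average; congr (_ * _).
apply: (ae_eq_integral_on (measurable_cube a l)).
- exact: measurableT_comp.
- exact: measurableT_comp.
- by apply: (filterS _ fg) => y ->.
Qed.

(** The operator M'_u for a weight that is positive and finite everywhere. *)
Definition conj_maximal (u : E -> R) (f : E -> \bar R) (x : E) : \bar R :=
  maximal (fun y => f y * (u y)%:E) x * ((u x)^-1)%:E.

Lemma measurable_mulwE (u : E -> R) (f : E -> \bar R) : measurable_fun setT u ->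
  measurable_fun setT f -> measurable_fun setT (fun y => f y * (u y)%:E).
Proof. by move=> mw mf; apply: (emeasurable_funM mf); apply/measurable_EFinP. Qed.

Section conj.
Variables (u : E -> R) (mw : measurable_fun setT u) (u0 : forall x, (0 < u x)%R).

Lemma conj_maximal_iterable : iterable (conj_maximal u).
Proof. exact: (iterable_conj (maximal_iterable R n) mw u0). Qed.

Lemma conj_maximal_ae (f g : E -> \bar R) : measurable_fun setT f ->
  measurable_fun setT g -> {ae mu, forall x, f x = g x} ->
  conj_maximal u f = conj_maximal u g.
Proof.
move=> mf mg fg; apply/funext => x; rewrite /conj_maximal.
congr (_ x * _).
apply: (maximal_ae (measurable_mulwE mw mf) (measurable_mulwE mw mg)).
by apply: (filterS _ fg) => y ->.
Qed.

Lemma conj_maximal_gt0 (f : E -> \bar R) : measurable_fun setT f ->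
  (forall x, 0 <= f x) -> ~ {ae mu, forall x, f x = 0} ->
  forall x, 0 < conj_maximal u f x.
Proof.
move=> mf f0 fn0 x; rewrite /conj_maximal mule_gt0 ?lte_fin ?invr_gt0//.
have mfu := measurable_mulwE mw mf.
have fu0 y : 0 <= f y * (u y)%:E by rewrite mule_ge0// lee_fin ltW.
rewrite maximalE//; apply: (wmax_gt0 (b := b)) => //.
  move=> k.
  have := integral_cst mu (measurable_cube (@rcorner R n k) (rside R n k)) 1.
  rewrite /cst => ->; rewrite mul1e; exact: (basis_vol b k).
move=> H; apply: fn0; apply: (filterS _ H) => y /eqP.
by rewrite mule_eq0 eqe [u y == 0%R]gt_eqF// orbF => /eqP.
Qed.

(** The A_1 condition on the half-open cubes, extracted from the iteration
    inequality of the majorant. *)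
Lemma conj_maximal_A1 (gam : E -> R) (c : R) : measurable_fun setT gam ->
  (forall x, (0 < gam x)%R) ->
  {ae mu, forall x, conj_maximal u (EFin \o gam) x <= (c * gam x)%:E} ->
  forall a l, (0 < l)%R -> {ae mu, forall x, hcube a l x ->
    \int[mu]_(y in hcube a l) (gam y * u y)%:E <= (c * l ^+ n * (gam x * u x))%:E}.
Proof.
move=> mg g0 H a l l0; apply: (filterS _ H) => x; rewrite /conj_maximal => Hx Qx.
have ln0 : (0 < l ^+ n)%R by rewrite exprn_gt0.
rewrite lee_pdivrMr// -EFinM in Hx.
have := le_trans (le_maximal (fun y => (EFin \o gam) y * (u y)%:E) l0 (hcube_sub Qx)) Hx.
rewrite average_cube// lee_pdivrMl// -EFinM => {}Hx.
have mgu : measurable_fun setT (fun y => (gam y * u y)%:E).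
  by apply/measurable_EFinP; exact: measurable_funM.
have -> : (c * l ^+ n * (gam x * u x) = l ^+ n * (c * gam x * u x))%R by ring.
apply: le_trans Hx.
have -> : \int[mu]_(y in cube a l) `|(EFin \o gam) y * (u y)%:E| =
    \int[mu]_(y in cube a l) (gam y * u y)%:E.
  by apply: eq_integral => y _ /=; rewrite ger0_norm// mulr_ge0// ltW.
apply: (@ge0_subset_integral _ _ _ mu _ _ (measurable_hcube a l) (measurable_cube a l) _
  (measurable_funTS mgu) _ (@hcube_sub R n a l)).
by move=> y _; rewrite lee_fin mulr_ge0// ltW.
Qed.

End conj.

Lemma weighted_maximal_ae (u f : E -> \bar R) : weight u -> measurable_fun setT f ->
  {ae mu, forall x, weighted_maximal u f x = conj_maximal (posfin u) f x}.
Proof.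
move=> [mw u0] mf; have uE := weight_posfin u0.
have mpu := measurable_posfin mw.
apply: (filterS _ (filterI u0 uE)) => x [/andP[ux0 _] ux].
rewrite /weighted_maximal gt_eqF// /conj_maximal.
rewrite (@maximal_ae _ (fun y => f y * (posfin u y)%:E)); last first.
- by apply: (filterS _ uE) => y ->.
- exact: measurable_mulwE.
- exact: (emeasurable_funM mf mw).
by rewrite {1}ux inver gt_eqF// posfin_gt0.
Qed.

(** Being equal almost everywhere to a measurable function is enough, as the
    Lebesgue measure is complete. *)
Lemma measurable_weighted_maximal (u f : E -> \bar R) : weight u ->
  measurable_fun setT f -> (forall x, 0 <= f x) ->
  measurable_fun setT (weighted_maximal u f).
Proof.
move=> wu mf f0; have [mw _] := wu.
have mS := iterable_meas
  (conj_maximal_iterable (measurable_posfin mw) (posfin_gt0 u)) mf f0.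
apply: (ae_measurable_fun euclidean_lebesgue_complete _ mS).
by apply: (filterS _ (weighted_maximal_ae wu mf)) => x <-.
Qed.

(** Compact sets covering R^n, on which u v is integrable. *)
Definition exhaustion (k : nat) : set E := cube (fun=> - k%:R)%R (2 * k%:R)%R.

Lemma exhaustionE k : exhaustion k = [set x | forall i, (`|coord x i| <= k%:R)%R].
Proof.
by apply/seteqP; split => x H i; have := H i; rewrite ler_norml; lra.
Qed.

Lemma nondecreasing_exhaustion : nondecreasing_seq exhaustion.
Proof.
move=> j k jk; apply/subsetPset; rewrite !exhaustionE => x H i.
by apply: (le_trans (H i)); rewrite ler_nat.
Qed.

Lemma exhaustion_cover x : exists k, exhaustion k x.
Proof.
exists (Num.truncn (\sum_i `|coord x i|)).+1; rewrite exhaustionE => i.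
apply: (@le_trans _ _ (\sum_i `|coord x i|)%R); last exact/ltW/truncnS_gt.
by rewrite (bigD1 i)//= lerDl sumr_ge0.
Qed.

Lemma exhaustion_compact k :
  compact [set (\row_i coord x i : 'rV[R]_n) | x in exhaustion k].
Proof.
have := @rV_compact R n (fun=> `[- k%:R, k%:R]%classic)%R
  (fun=> @segment_compact _ _ _).
congr compact; rewrite exhaustionE; apply/seteqP; split => [v Hv|_ [x Hx <-] i].
  exists ([tuple v ord0 i | i < n] : E).
    by move=> i; rewrite /coord tnth_mktuple ler_norml; have := Hv i; rewrite /= in_itv.
  by apply/rowP => i; rewrite mxE /coord tnth_mktuple.
by rewrite /= in_itv/= mxE -ler_norml.
Qed.

Lemma exhaustion_lty (om : E -> \bar R) k : L1loc om ->
  \int[mu]_(x in exhaustion k) `|om x| < +oo.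
Proof. by move=> [_]; apply; exact: exhaustion_compact. Qed.

End weighted_operator.

(** * The extrapolation step *)

Section measurable_products.
Context d (T : measurableType d) (R : realType).
Variables (f g w : T -> \bar R).
Hypotheses (mf : measurable_fun setT f) (mg : measurable_fun setT g).
Hypothesis mw : measurable_fun setT w.

Lemma measurable_mul3 : measurable_fun setT (fun x => g x * (f x * w x)).
Proof. by apply: emeasurable_funM => //; exact: emeasurable_funM. Qed.

Lemma measurable_abs_mul : measurable_fun setT (fun x => `|f x * g x| * w x).
Proof.
apply: emeasurable_funM => //; apply: measurableT_comp => //.
exact: emeasurable_funM.
Qed.

End measurable_products.

Section pairing.
Context d (T : measurableType d) (R : realType).
Variable mu : {measure set T -> \bar R}.
Variables (gam u v : T -> R) (q : R).
Hypotheses (mgam : measurable_fun setT gam) (gam0 : forall x, (0 < gam x)%R).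
Hypotheses (mu_ : measurable_fun setT u) (u0 : forall x, (0 < u x)%R).
Hypotheses (mv : measurable_fun setT v) (v0 : forall x, (0 < v x)%R).

(** The weight gam u v^(1/q) is designed for this identity: a factor
    v = v^(1 - 1/q) v^(1/q) of the density u v is shared between f / v and the
    weight. *)
Lemma pairing_weight (f : T -> \bar R) (a : R) : measurable_fun setT f ->
  (forall x, 0 <= f x) -> (0 < a)%R ->
  \int[mu]_x (f x `^ (1 - q^-1) * (gam x * u x * v x `^ q^-1)%:E) =
  a%:E * \int[mu]_x ((f x * ((v x)^-1)%:E) `^ (1 - q^-1) * (a^-1)%:E *
    (gam x * (u x * v x))%:E).
Proof.
move=> mf f0 a0.
have vi0 x : (0 <= (v x)^-1)%R by rewrite invr_ge0 ltW.
have w0 x : (0 <= gam x * (u x * v x))%R by rewrite ltW// !mulr_gt0.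
have mvi := measurable_fun_invr mv v0.
rewrite -ge0_integralZl//.
- apply: eq_integral => x _; rewrite poweRM ?lee_fin// poweR_EFin.
  rewrite -!muleA -!EFinM muleCA -EFinM; congr (_ * _%:E).
  have -> : (v x `^ q^-1 = v x * (v x)^-1 `^ (1 - q^-1))%R.
    rewrite -(powR_inv1 (ltW (v0 x))) -powRrM mulN1r.
    rewrite -[X in (_ = X * _)%R]powRr1 ?(ltW (v0 x))// -powRD; last first.
      by apply/implyP => _; rewrite gt_eqF.
    by congr powR; ring.
  by field; rewrite gt_eqF.
- apply: emeasurable_funM; last first.
    by apply/measurable_EFinP; do 2 apply: measurable_funM => //.
  apply: emeasurable_funM => //; apply: measurable_fun_poweR.
  by apply: emeasurable_funM => //; exact/measurable_EFinP.
- by move=> x _; rewrite !mule_ge0 ?poweR_ge0 ?lee_fin ?invr_ge0 ?w0 ?(ltW a0).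
- by rewrite lee_fin ltW.
Qed.
End pairing.

Section core.
Variables (R : realType) (n : nat).
Local Notation E := (euclidean R n).
Local Notation mu := (euclidean_lebesgue R n).
Local Notation b := (cube_basis R n).
Variables (u v : E -> \bar R) (weight_u : weight u) (weight_v : weight v).
Hypothesis uv_loc : L1loc (fun x => u x * v x).
Variables (X : (E -> \bar R) -> \bar R) (X_BFS : is_BFS (fun x => u x * v x) X).

Local Notation om := (fun x => u x * v x).
Local Notation rho := (fun x => posfin u x * posfin v x)%R.

Let mu' : measurable_fun setT (posfin u).
Proof. by have [mw _] := weight_u; exact: measurable_posfin. Qed.

Let mv' : measurable_fun setT (posfin v).
Proof. by have [mw _] := weight_v; exact: measurable_posfin. Qed.

Let mrho : measurable_fun setT rho. Proof. exact: measurable_funM mu' mv'. Qed.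

Let rho0 x : (0 < rho x)%R. Proof. by rewrite mulr_gt0// posfin_gt0. Qed.

Let uE : {ae mu, forall x, u x = (posfin u x)%:E}.
Proof. by have [_ u0] := weight_u; exact: weight_posfin. Qed.

Let vE : {ae mu, forall x, v x = (posfin v x)%:E}.
Proof. by have [_ v0] := weight_v; exact: weight_posfin. Qed.

Let omE : {ae mu, forall x, om x = (rho x)%:E}.
Proof. by apply: (filterS _ (filterI uE vE)) => x [-> ->]. Qed.

Let mom : measurable_fun setT om. Proof. by have [] := uv_loc. Qed.

Let mrhoE : measurable_fun setT (EFin \o rho).
Proof. exact/measurable_EFinP. Qed.

Lemma exhaustion_rho k : \int[mu]_(x in @exhaustion R n k) (rho x)%:E < +oo.
Proof.
apply: le_lt_trans (exhaustion_lty k uv_loc); rewrite le_eqVlt; apply/orP; left.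
apply/eqP; apply: (ae_eq_integral_on (measurable_cube _ _) mrhoE).
  by apply: measurableT_comp => //; exact: mom.
by apply: (filterS _ omE) => x ->; rewrite gee0_abs// lee_fin ltW.
Qed.

Lemma exhaustion_om k : \int[mu]_(x in @exhaustion R n k) om x < +oo.
Proof.
rewrite (ae_eq_integral_on (measurable_cube _ _) mom mrhoE omE).
exact: exhaustion_rho.
Qed.

Section polar.
Variables (s : R) (s1 : (1 <= s)%R).
Local Notation ball := (power_ball X s).

Lemma polar_associate (f : E -> \bar R) (m : R) : measurable_fun setT f ->
  (forall x, 0 <= f x) -> polar_le mu rho ball f m ->
  associate_norm om (power_norm X s) f <= m%:E.
Proof.
move=> mf f0 fm; apply: ge_ereal_sup => _ [g [mg Ng] <-].
have mag : measurable_fun setT (fun x => `|g x|) by exact: measurableT_comp.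
have Bg : ball (fun x => `|g x|).
  rewrite /power_ball; under eq_fun do rewrite abse_id.
  exact/(power_norm_le1 X_BFS s1 mg).
apply: (le_trans _ (fm _ mag (fun x => abse_ge0 (g x)) Bg)).
rewrite le_eqVlt; apply/orP; left; apply/eqP.
apply: (ae_eq_integral_on measurableT).
- exact: (measurable_abs_mul mf mg mom).
- exact: (measurable_mul3 mf mag mrhoE).
- apply: (filterS _ omE) => x ->; rewrite abseM (gee0_abs (f0 x)).
  by rewrite muleAC muleC.
Qed.

Lemma conj_maximal_polar (K : R) : (0 < K)%R ->
  (forall f : E -> \bar R, measurable_fun setT f ->
    associate_norm om (power_norm X s) (weighted_maximal u f) <=
    K%:E * associate_norm om (power_norm X s) f) ->
  forall f m, measurable_fun setT f -> (forall x, 0 <= f x) -> (0 < m)%R ->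
    polar_le mu rho ball f m ->
    polar_le mu rho ball (conj_maximal (posfin u) f) (K * m).
Proof.
move=> K0 H f m mf f0 m0 fm g mg g0 Bg.
have it := conj_maximal_iterable mu' (posfin_gt0 u).
have mS := iterable_meas it mf f0.
have S0 x := iterable_ge0 it x f0.
have mW := measurable_weighted_maximal weight_u mf f0.
have WE := weighted_maximal_ae weight_u mf.
apply: (@le_trans _ _ (K%:E * m%:E)); last by rewrite -EFinM.
apply: (le_trans _ (lee_wpmul2l _ (polar_associate mf f0 fm))); last first.
  by rewrite lee_fin ltW.
apply: (le_trans _ (H f mf)).
apply: (@le_trans _ _ (\int[mu]_x (`|weighted_maximal u f x * g x| * om x))); last first.
  apply: ereal_sup_ubound; exists g => //; split => //.
  exact/(power_norm_le1 X_BFS s1 mg).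
rewrite le_eqVlt; apply/orP; left; apply/eqP.
apply: (ae_eq_integral_on measurableT).
- exact: (measurable_mul3 mS mg mrhoE).
- exact: (measurable_abs_mul mW mg mom).
- apply: (filterS _ (filterI omE WE)) => x [-> ->].
  by rewrite abseM (gee0_abs (S0 x)) (gee0_abs (g0 x)) muleA (muleC (g x)).
Qed.

End polar.

(** For r s = 1 the power r undoes the power s of the ball, and the norm of X
    becomes visible. *)
Lemma power_ball_root (s r a : R) (h : E -> \bar R) : (0 < s)%R -> (r * s = 1)%R ->
  (0 < a)%R -> measurable_fun setT h -> (forall x, 0 <= h x) ->
  power_ball X s (fun x => h x `^ r * a%:E) <-> (a `^ s)%:E * X h <= 1.
Proof.
move=> s0 rs a0 mh h0; rewrite /power_ball.
have -> : (fun x => `|h x `^ r * a%:E| `^ s) = (fun x => (a `^ s)%:E * h x).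
  apply/funext => x; rewrite gee0_abs ?mule_ge0 ?poweR_ge0 ?lee_fin ?(ltW a0)//.
  rewrite poweRM ?poweR_ge0 ?lee_fin ?(ltW a0)// -poweRrM rs poweRe1//.
  by rewrite poweR_EFin muleC.
by rewrite (BFS_scale X_BFS _ mh) ger0_norm ?powR_ge0.
Qed.

(** Otherwise (f/v)^r / (t H^r) would lie outside the unit ball, where r is the
    inverse of the conjugate exponent of q and t = 2 B. A dual function gam would
    detect it, with gam u an A_1 weight, and the inequality between f and g for
    the weight gam u v^(1/q) would bound the pairing with gam by
    B H^r 2 = t H^r. *)
Lemma extrapolation_step (q K e C B H : R) (M : nat) (f g : E -> \bar R) :
  (1 < q)%R -> (0 < K)%R -> (0 < e)%R -> (0 < C)%R -> (0 < B)%R -> (0 < H)%R ->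
  (forall f : E -> \bar R, measurable_fun setT f ->
    associate_norm om (power_norm X (conj_exponent q)) (weighted_maximal u f) <=
    K%:E * associate_norm om (power_norm X (conj_exponent q)) f) ->
  Acond b e C (posfin v) ->
  (A1_beta (2 * K + 1) ^+ M <= 4^-1)%R -> ((n.+1 * M)%:R <= q)%R ->
  (forall w, Acond b (q * e) (A1_power_const e C (2 * K + 1) q) w ->
    \int[mu]_x (f x `^ (1 - q^-1) * (w x)%:E) <=
    B%:E * \int[mu]_x (g x `^ (1 - q^-1) * (w x)%:E)) ->
  measurable_fun setT f -> (forall x, 0 <= f x) ->
  measurable_fun setT g -> (forall x, 0 <= g x) ->
  X (fun x => g x * ((posfin v x)^-1)%:E) <= H%:E ->
  X (fun x => f x * ((posfin v x)^-1)%:E) <= ((2 * B) `^ conj_exponent q * H)%:E.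
Proof.
move=> q1 K0 e0 C0 B0 H0 M' Av hM nM HB mf f0 mg g0 gH.
set r := (1 - q^-1)%R in HB *; set s := conj_exponent q in M' *.
have q0 : (0 < q)%R by apply: lt_trans q1.
have r0 : (0 < r)%R by rewrite subr_gt0 invf_lt1.
have r1 : (r <= 1)%R by rewrite gerBl invr_ge0 ltW.
have s1 : (1 <= s)%R by rewrite /s /conj_exponent -/r invf_ge1.
have s0 : (0 < s)%R by apply: lt_le_trans s1.
have rs : (r * s = 1)%R by rewrite /s /conj_exponent -/r mulfV ?gt_eqF.
have pv0 := posfin_gt0 v; have pu0 := posfin_gt0 u.
have pvi0 x : 0 <= ((posfin v x)^-1)%:E by rewrite lee_fin invr_ge0 ltW.
have mpvi : measurable_fun setT (fun x => ((posfin v x)^-1)%:E).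
  by apply/measurable_EFinP; exact: measurable_fun_invr mv' pv0.
pose fv x := f x * ((posfin v x)^-1)%:E; pose gv x := g x * ((posfin v x)^-1)%:E.
have mfv : measurable_fun setT fv := emeasurable_funM mf mpvi.
have mgv : measurable_fun setT gv := emeasurable_funM mg mpvi.
have fv0 x : 0 <= fv x by rewrite mule_ge0.
have gv0 x : 0 <= gv x by rewrite mule_ge0.
pose lamb := (H `^ r)%R; have l0 : (0 < lamb)%R by rewrite powR_gt0.
have ls : (lamb `^ s = H)%R by rewrite /lamb -powRrM rs powRr1// ltW.
pose t := (2 * B)%R; have t0 : (0 < t)%R by rewrite mulr_gt0.
have tl0 : (0 < t * lamb)%R by rewrite mulr_gt0.
have inv_pow (a : R) : (0 < a)%R -> (a^-1 `^ s = (a `^ s)^-1)%R.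
  by move=> a0; rewrite -(powR_inv1 (ltW a0)) -powRrM mulN1r powRN.
have tls : ((t * lamb) `^ s = t `^ s * H)%R by rewrite powRM ?ltW// ls.
have tH0 : (0 < t `^ s * H)%R by rewrite mulr_gt0// powR_gt0.
pose phi x := fv x `^ r * ((t * lamb)^-1)%:E.
pose psi x := gv x `^ r * (lamb^-1)%:E.
have mroot (h : E -> \bar R) (a : R) : measurable_fun setT h ->
    measurable_fun setT (fun x => h x `^ r * a%:E).
  move=> mh; apply: (emeasurable_funM (measurable_fun_poweR _ mh)).
  exact: measurable_cst.
have mphi : measurable_fun setT phi by exact: mroot.
have mpsi : measurable_fun setT psi by exact: mroot.
have phi0 x : 0 <= phi x by rewrite mule_ge0 ?poweR_ge0// lee_fin invr_ge0 ltW.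
have psi0 x : 0 <= psi x by rewrite mule_ge0 ?poweR_ge0// lee_fin invr_ge0 ltW.
have Bpsi : power_ball X s psi.
  apply/(power_ball_root s0 rs _ mgv gv0); first by rewrite invr_gt0.
  rewrite inv_pow// ls lee_pdivrMl// mule1; exact: gH.
have [Bphi|nBphi] := pselect (power_ball X s phi).
  move/(power_ball_root s0 rs _ mfv fv0): Bphi => /(_ ltac:(by rewrite invr_gt0)).
  by rewrite inv_pow// tls lee_pdivrMl// mule1.
exfalso.
have [gam [mgam gam0 gam2 gam1 gamS]] := dual_majorant mrho rho0
  (power_ball_le X_BFS s1) (power_ball_convex X_BFS s1) (power_ball_sup X_BFS s1)
  (fun k => measurable_cube _ _) (@nondecreasing_exhaustion R n)
  (@exhaustion_cover R n) exhaustion_rho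
  (fun k => power_ball_indic X_BFS s1 (measurable_cube _ _) (exhaustion_om k))
  (conj_maximal_iterable mu' pu0) K0 (conj_maximal_polar s1 K0 M')
  (conj_maximal_gt0 mu' pu0) (conj_maximal_ae mu') mphi phi0 nBphi.
have msg : measurable_fun setT (fun x => gam x * posfin u x)%R.
  exact: measurable_funM mgam mu'.
have sg0 x : (0 < gam x * posfin u x)%R by rewrite mulr_gt0.
have K1 : (1 <= 2 * K + 1)%R by rewrite lerDr mulr_ge0// ltW.
have A1 a l : (0 < l)%R -> {ae mu, forall x, hcube a l x ->
    \int[mu]_(y in hcube a l) (gam y * posfin u y)%:E <=
    ((2 * K + 1) * l ^+ n * (gam x * posfin u x))%:E}.
  move=> ll0; have := conj_maximal_A1 mu' pu0 mgam gam0 gamS a ll0.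
  move=> A1; apply: (filterS _ A1) => x h Qx; apply: (le_trans (h Qx)).
  rewrite lee_fin ler_pM2r// ler_pM2r ?exprn_gt0//.
  by rewrite lerDl.
have AW := Acond_A1_power e0 C0 K1 Av hM q0 nM msg sg0 A1.
have := HB _ AW.
rewrite (pairing_weight mu q mgam gam0 mu' pu0 mv' pv0 mf f0 tl0).
rewrite (pairing_weight mu q mgam gam0 mu' pu0 mv' pv0 mg g0 l0).
have psi2 : \int[mu]_x (psi x * (gam x * rho x)%:E) <= 2%:E by exact: (gam2 _ mpsi psi0 Bpsi).
move=> Hc.
have : (t * lamb)%:E < (B * (lamb * 2))%:E.
  apply: (@lt_le_trans _ _ ((t * lamb)%:E * \int[mu]_x (phi x * (gam x * rho x)%:E))).
    by rewrite lte_pmulr.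
  apply: (le_trans Hc); rewrite EFinM EFinM.
  apply: lee_wpmul2l; first by rewrite lee_fin ltW.
  by apply: lee_wpmul2l => //; rewrite lee_fin ltW.
have -> : (B * (lamb * 2) = t * lamb)%R by rewrite /t; ring.
by rewrite ltxx.
Qed.

End core.

Theorem theorem1p8 (R : realType) (n : nat) (n_gt0 : (0 < n)%N)
  (F : set ((euclidean R n -> \bar R) * (euclidean R n -> \bar R)))
  (F_pairs : extrapolation_family F)
  (u v : euclidean R n -> \bar R) (weight_u : weight u) (weight_v : weight v)
  (v_Ainfty : Ainfty v)
  (uv_loc : L1loc (fun x => u x * v x))
  (X : (euclidean R n -> \bar R) -> \bar R)
  (X_BFS : is_BFS (fun x => u x * v x) X)
  (M'_bounded : exists q0 K0 : R, [/\ (1 < q0)%R, (0 < K0)%R &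
    forall (f : euclidean R n -> \bar R) (q : R),
      measurable_fun setT f -> (q0 <= q)%R ->
      associate_norm (fun x => u x * v x) (power_norm X (conj_exponent q))
        (weighted_maximal u f) <=
      K0%:E * associate_norm (fun x => u x * v x)
        (power_norm X (conj_exponent q)) f])
  (weighted_bound : exists2 p0 : R, (0 < p0)%R &
    for_all_Ainfty (fun (C : R) (w : euclidean R n -> \bar R) =>
      forall f g, F (f, g) ->
        weighted_Lnorm p0 w f <= C%:E * weighted_Lnorm p0 w g)) :
  exists2 C : R, (0 < C)%R & forall f g, F (f, g) ->
    X (fun x => f x / v x) <= C%:E * X (fun x => g x / v x).

Proof.
have [q0 [K [q01 K0 M']]] := M'_bounded.
have [p p1 Av] := v_Ainfty; have [_ v0] := weight_v.
have [e [C [e0 C0 Aposv]]] := Ap_Acond p1 Av.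
have [p0 p00 HF] := weighted_bound.
have bound0 := Ainfty_bound_hyp p00 F_pairs HF.
have K1 : (1 <= 2 * K + 1)%R by rewrite lerDr mulr_ge0// ltW.
have [M hM] : exists M, (A1_beta (2 * K + 1) ^+ M <= 4^-1)%R.
  have : (fun k => (A1_beta (2 * K + 1) ^+ k)%R) @ \oo --> (0%R : R).
    by apply: cvg_expr; rewrite ger0_norm ?A1_beta_ge0 ?A1_beta_lt1.
  move=> /cvgrPdist_le/(_ 4^-1%R ltac:(by rewrite invr_gt0)) [M _ /(_ M (leqnn M))].
  by rewrite /= sub0r normrN ger0_norm ?exprn_ge0 ?A1_beta_ge0//; exists M.
(* q is chosen after the A_1 constant 2 K + 1, which bounds the dual weights
   uniformly in q *)
pose q := Num.max q0 (n.+1 * M)%:R.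
have q0q : (q0 <= q)%R by rewrite le_max lexx.
have q1 : (1 < q)%R by exact: lt_le_trans q0q.
have nM : ((n.+1 * M)%:R <= q)%R by rewrite le_max lexx orbT.
have qq0 : (0 < q)%R by exact: lt_trans q1.
have r0 : (0 < 1 - q^-1)%R by rewrite subr_gt0 invf_lt1.
have [B B0 HB] := Ainfty_bound_any F_pairs p00 r0 bound0 (mulr_gt0 qq0 e0)
  (A1_power_const_gt0 e q C0 K1).
have t0 : (0 < (2 * B) `^ conj_exponent q)%R by rewrite powR_gt0// mulr_gt0.
exists ((2 * B) `^ conj_exponent q)%R => // f g Ffg.
have [mf mg f0 g0] := F_pairs _ _ Ffg.
have vE := weight_posfin v0.
have divE (h : euclidean R n -> \bar R) : {ae euclidean_lebesgue R n, forall x,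
    h x / v x = h x * ((posfin v x)^-1)%:E}.
  by apply: (filterS _ vE) => x ->; rewrite inver gt_eqF// posfin_gt0.
have div_meas (h : euclidean R n -> \bar R) : measurable_fun setT h ->
    measurable_fun setT (fun x => h x * ((posfin v x)^-1)%:E).
  move=> mh; apply: (emeasurable_funM mh); apply/measurable_EFinP.
  apply: measurable_fun_invr (posfin_gt0 v).
  by apply: measurable_posfin; have [] := weight_v.
have XE (h : euclidean R n -> \bar R) : measurable_fun setT h ->
    X (fun x => h x / v x) = X (fun x => h x * ((posfin v x)^-1)%:E).
  move=> mh; have m1 := div_meas h mh.
  have m2 : measurable_fun setT (fun x => h x / v x).
    apply: (ae_measurable_fun (@euclidean_lebesgue_complete R n) _ m1).
    by apply: (filterS _ (divE h)) => x <-.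
  apply/eqP; rewrite eq_le; apply/andP; split.
    by apply: (BFS_le X_BFS m2 m1); apply: (filterS _ (divE h)) => x ->.
  by apply: (BFS_le X_BFS m1 m2); apply: (filterS _ (divE h)) => x ->.
rewrite (XE f mf) (XE g mg).
have G0 := BFS_ge0 X_BFS (div_meas g mg).
have [Goo|Gfin] := eqVneq (X (fun x => g x * ((posfin v x)^-1)%:E)) +oo.
  by rewrite Goo gt0_muley ?lte_fin// leey.
move: G0 Gfin; set N := X _ => N0 Nfin.
have NE : N = (fine N)%:E by rewrite fineK// ge0_fin_numE// ltey.
move: N0; rewrite NE; set G := fine N in NE *; rewrite lee_fin => G0.
have step (H : R) : (0 < H)%R -> (G <= H)%R ->
    X (fun x => f x * ((posfin v x)^-1)%:E) <= ((2 * B) `^ conj_exponent q * H)%:E.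
  move=> H0 GH.
  apply: (extrapolation_step weight_u weight_v uv_loc X_BFS q1 K0 e0 C0 B0 H0
    (fun h mh => M' h q mh q0q) Aposv hM nM _ mf f0 mg g0).
    by move=> w Aw; exact: (HB w Aw).
  by rewrite -/N NE lee_fin.
rewrite -EFinM; apply/lee_addgt0Pr => eps eps0.
have d0 : (0 < eps / (2 * B) `^ conj_exponent q)%R by rewrite divr_gt0.
apply: (le_trans (step (G + eps / (2 * B) `^ conj_exponent q)%R _ _)).
- by rewrite ltr_wpDl.
- by rewrite lerDl ltW.
- by rewrite -EFinD lee_fin mulrDr mulrCA mulfV ?gt_eqF// mulr1.
Qed.
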